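(* Let $X$ be either a complex torus (that is, $X=\mathbb{C}^n/\Lambda$, where $\Lambda\subset\mathbb{C}^n$ is a lattice of rank $2n$) or a complex manifold biholomorphic to $(\mathbb{C}^* )^m$ for some $m\ge 2$. Let $L$ be a holomorphic line bundle on $X$ such that $c_{\mathbb{R}}(L)\ne 0$, let $p\colon\mathrm{Tot}_L\to X$ be the natural projection, and let $U\subset\mathrm{Tot}_L$ be a neighborhood of the zero section of $L$ such that, for any $x\in X$, the intersection $L_x\cap U$ is biholomorphic to the unit disc $D\subset\mathbb{C}$. Then the restriction $p|_U\colon U\to X$ is not holomorphically locally trivial.
   Context: $D=\{z\in\mathbb{C}: |z|<1\}$. For a line bundle $L$ over $X$, $\mathrm{Tot}_L$ denotes its total space and $L_x\subset\mathrm{Tot}_L$ its fiber over $x\in X$; $c_1(L)\in H^2(X,\mathbb{Z})$ is its first Chern class and $c_{\mathbb{R}}(L)\in H^2(X,\mathbb{R})$ is the image of $c_1(L)$ in $H^2(X,\mathbb{R})$. Neighborhoods are open. A surjective holomorphic submersion $p\colon Y\to X$ whose fibers are all biholomorphic to a complex manifold $F$ is called holomorphically locally trivial if for any $x\in X$ there exist a neighborhood $V\ni x$ and a biholomorphism $\varphi\colon p^{-1}(V)\to F\times V$ such that $\mathrm{pr}_V\circ\varphi=p|_{p^{-1}(V)}$. *)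

(* Defs.v *)
From HB Require Import structures.
From mathcomp Require Import all_boot all_order all_algebra.
From mathcomp Require Import all_classical all_reals interval_inference topology normedtype.
From mathcomp Require Import landau sequences derive exp trigo.
From mathcomp Require Import complex.
Set Implicit Arguments. Unset Strict Implicit. Unset Printing Implicit Defensive.
Import Order.TTheory GRing.Theory Num.Theory.
Import numFieldNormedType.Exports.
Local Open Scope classical_set_scope.
Local Open Scope ring_scope.

(* The field of complex numbers, as a numFieldType: over it the library's
   differentiable is complex differentiability. *)
Definition Cplx (R : realType) : numFieldType := R[i].

Section Aux.
Variable R : realType.
Local Notation C := (Cplx R).

Lemma prod_second_countable (S T : topologicalType) :
  @second_countable S -> @second_countable T -> @second_countable (S * T)%type.
Proof.
move=> [B cB [oB nB]] [D cD [oD nD]].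
exists [set A `*` E | A in B & E in D].
  have -> : [set A `*` E | A in B & E in D] =
            (fun p : set S * set T => p.1 `*` p.2) @` (B `*` D).
    apply/seteqP; split => X /=.
      by move=> [A BA [E DE <-]]; exists (A, E).
    by move=> [[A E] [/= BA DE] <-]; exists A => //; exists E.
  apply: (@sub_countable _ _ _ (B `*` D)); first exact: card_image_le.
  exact: countableX.
split.
  move=> _ [A BA [E DE <-]]; rewrite openE => -[x y] [/= Ax Ey].
  exists (A, E) => //=; split; apply: open_nbhs_nbhs; split=> //.
    exact: oB.
  exact: oD.
move=> [x y] W [[P Q] [/= nP nQ] sPQ].
have [A [BA Ax] AP] := nB x P nP; have [E [DE Ey] EQ] := nD y Q nQ.
exists (A `*` E); first by split=> //; exists A => //; exists E.
by move=> [a b] [/= Aa Eb]; apply: sPQ; split; [exact: AP|exact: EQ].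
Qed.

Lemma prod_hausdorff (S T : topologicalType) :
  hausdorff_space S -> hausdorff_space T -> hausdorff_space (S * T)%type.
Proof.
move=> hS hT [a b] [c d] cl; congr pair.
  apply: hS => A B nA nB.
  have [] := cl (A `*` setT) (B `*` setT).
  - by exists (A, setT) => //=; split=> //; exact: filterT.
  - by exists (B, setT) => //=; split=> //; exact: filterT.
  by move=> [x y] [[/= ? _] [/= ? _]]; exists x.
apply: hT => A B nA nB.
have [] := cl (setT `*` A) (setT `*` B).
- by exists (setT, A) => //=; split=> //; exact: filterT.
- by exists (setT, B) => //=; split=> //; exact: filterT.
by move=> [x y] [[/= _ ?] [/= _ ?]]; exists y.
Qed.


Lemma gt0_complexP (e : C) : 0 < e -> exists2 r : R, 0 < r & e = (r%:C)%C.
Proof.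
case: e => a b; rewrite ltcE /= => /andP[/eqP -> a0]; by exists a.
Qed.

Lemma dense_second_countable (T : pseudoMetricType C) (I : countType)
    (f : I -> T) :
  (forall (x : T) (r : R), 0 < r -> exists i, ball x ((r%:C)%C : C) (f i)) ->
  @second_countable T.
Proof.
move=> df.
pose b (p : I * nat) : set T := (ball (f p.1) ((p.2.+1%:R^-1 : R)%:C)%C)°.
exists (range b).
  by apply: (@sub_countable _ _ _ [set: I * nat]); [exact: card_image_le|].
split; first by move=> _ [p _ <-]; exact: open_interior.
move=> x A /nbhs_ballP[e /= /gt0_complexP[r r0 ->] xA].
have [n nr] : exists n : nat, (n.+1%:R^-1 : R) < r / 2.
  have r2 : 0 < r / 2 by rewrite divr_gt0.
  have [n _ H] := near_infty_natSinv_lt (PosNum r2).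
  by exists n; apply: H => /=.
have d0 : 0 < (n.+1%:R^-1 / 2 : R) by rewrite divr_gt0.
have [i xi] := df x _ d0.
exists (b (i, n)).
  split; first by exists (i, n).
  apply/nbhs_ballP; exists ((n.+1%:R^-1 / 2 : R)%:C)%C; first by rewrite /= ltcR.
  move=> y xy; rewrite /= [n.+1%:R^-1 in X in ball _ X _]splitr rmorphD.
  by apply: ball_triangle xy; exact: ball_sym.
move=> y /interior_subset /= iy; apply: xA.
have : ball x ((n.+1%:R^-1 / 2 : R)%:C + (n.+1%:R^-1 : R)%:C)%C y.
  exact: ball_triangle iy.
apply: le_ball; rewrite -rmorphD lecR [leRHS]splitr.
apply: lerD; last exact: ltW.
by rewrite (le_trans _ (ltW nr))// ler_pdivrMr// ler_peMr// ler1n.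
Qed.


Definition Qi (q : rat * rat) : C := (ratr q.1 +i* ratr q.2)%C.

Lemma Qi_dense (x : C) (r : R) : 0 < r -> exists q, ball x ((r%:C)%C : C) (Qi q).
Proof.
case: x => a b r0; have r2 : 0 < r / 2 by rewrite divr_gt0.
have rat_near (c : R) : exists p : rat, `|c - ratr p| < r / 2.
  have [|p] := @rat_in_itvoo R (c - r / 2) (c + r / 2).
    by rewrite ltrD2l gtrN.
  by rewrite in_itv/= -ltr_distl distrC => ?; exists p.
have [p pa] := rat_near a; have [q qb] := rat_near b.
exists (p, q); rewrite -ball_normE /ball_ /=.
have -> : (a +i* b)%C - Qi (p, q) =
    ((a - ratr p)%:C + 'i * (b - ratr q)%:C)%C :> C.
  by rewrite /Qi; simpc.
rewrite (le_lt_trans (ler_normD _ _))// normrM.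
have -> : `|'i%C : C| = 1 by rewrite normc_def /= expr0n expr1n add0r sqrtr1.
rewrite mul1r !normc_def /= !expr0n !addr0 !sqrtr_sqr -rmorphD ltcR.
by rewrite [ltRHS]splitr ltrD.
Qed.

Lemma C_second_countable : @second_countable C.
Proof. exact: dense_second_countable Qi_dense. Qed.

Lemma rV_second_countable n : @second_countable 'rV[C]_n.
Proof.
apply: (@dense_second_countable _ _ (fun q : 'rV[(rat * rat)%type]_n => map_mx Qi q)).
move=> x r r0; have /choice[q xq] : forall j, exists q, ball (x 0 j) ((r%:C)%C : C) (Qi q).
  by move=> j; exact: Qi_dense.
exists (\row_j q j); split; first by rewrite ltcR.
by move=> i j; rewrite !mxE ord1.
Qed.
End Aux.

Section Charts.
Variable R : realType.
Local Notation C := (Cplx R).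

(* Values of chart_map outside chart_dom and of chart_inv outside chart_img are
   irrelevant. *)
Record chart (M : topologicalType) (n : nat) := Chart {
  chart_dom : set M;
  chart_img : set 'rV[C]_n;
  chart_map : M -> 'rV[C]_n;
  chart_inv : 'rV[C]_n -> M;
  chart_dom_open : open chart_dom;
  chart_img_open : open chart_img;
  chart_mapP : forall x, chart_dom x ->
    chart_img (chart_map x) /\ chart_inv (chart_map x) = x;
  chart_invP : forall z, chart_img z ->
    chart_dom (chart_inv z) /\ chart_map (chart_inv z) = z;
  chart_map_cts : forall x, chart_dom x -> {for x, continuous chart_map};
  chart_inv_cts : forall z, chart_img z -> {for z, continuous chart_inv}
}.

Record complex_manifold := ComplexManifold {
  mspace :> topologicalType;
  mdim : nat;
  matlas : set (chart mspace mdim);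
  matlas_cover : forall x, exists2 c, matlas c & chart_dom c x;
  matlas_compat : forall c d, matlas c -> matlas d ->
    forall z, chart_img c z -> chart_dom d (chart_inv c z) ->
    differentiable (chart_map d \o chart_inv c) z;
  mspace_hausdorff : hausdorff_space mspace;
  mspace_second_countable : @second_countable mspace
}.
End Charts.

Section OneChart.
Variable R : realType.
Local Notation C := (Cplx R).
Variables (M : topologicalType) (n : nat).
Variables (h : M -> 'rV[C]_n) (k : 'rV[C]_n -> M).
Hypotheses (hK : cancel h k) (kK : cancel k h).
Hypotheses (ch : continuous h) (ck : continuous k).

Definition global_chart : chart R M n :=
  @Chart R M n setT setT h k openT openT (fun x _ => conj I (hK x))
    (fun z _ => conj I (kK z)) (fun x _ => @ch x) (fun z _ => @ck z).

Definition one_chart_manifold (hM : hausdorff_space M)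
  (sM : @second_countable M) : complex_manifold R.
Proof.
apply: (@ComplexManifold R M n [set global_chart] _ _ hM sM).
  by move=> x; exists global_chart.
move=> c d -> -> z _ _.
have -> : chart_map global_chart \o chart_inv global_chart = id.
  by apply/funext => w /=.
exact: ex_diff.
Defined.
End OneChart.

Section Examples.
Variable R : realType.
Local Notation C := (Cplx R).

Lemma id_cts (T : topologicalType) : continuous (@id T).
Proof. by move=> x; exact: cvg_id. Qed.

Definition Cn (n : nat) : complex_manifold R :=
  @one_chart_manifold R 'rV[C]_n n id id (fun=> erefl) (fun=> erefl)
    (@id_cts _) (@id_cts _) (@norm_hausdorff _ _)
    (@rV_second_countable R n).

Lemma C_rVK : cancel (fun z : C => const_mx z : 'rV[C]_1) (fun v => v 0 0).
Proof. by move=> z; rewrite mxE. Qed.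

Lemma rV_CK : cancel (fun v : 'rV[C]_1 => v 0 0) (fun z => const_mx z).
Proof. by move=> v; apply/rowP => j; rewrite !mxE ord1. Qed.

Lemma C_rV_cts : continuous (fun z : C => const_mx z : 'rV[C]_1).
Proof.
move=> z A /nbhs_ballP[e e0 eA]; apply/nbhs_ballP; exists e => //.
by move=> w zw; apply: eA; split => // i j; rewrite !mxE.
Qed.

Definition C1 : complex_manifold R :=
  one_chart_manifold C_rVK rV_CK C_rV_cts (@coord_continuous _ _ _ _ _)
    (@norm_hausdorff _ _) (@C_second_countable R).
End Examples.

Section Product.
Variable R : realType.
Local Notation C := (Cplx R).

Lemma row_mx_cts (m n : nat) :
  continuous (fun p : 'rV[C]_m * 'rV[C]_n => row_mx p.1 p.2).
Proof.
move=> [u v] A /nbhs_ballP[e e0 eA]; apply/nbhs_ballP; exists e => //.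
move=> [u' v'] [/= [_ uu'] [_ vv']]; apply: eA; split => // i j.
by rewrite !mxE; case: (fintype.split j).
Qed.

Lemma row_mx_differentiable (m n : nat) (V : normedModType C)
  (f : V -> 'rV[C]_m) (g : V -> 'rV[C]_n) x :
  differentiable f x -> differentiable g x ->
  differentiable (fun z => row_mx (f z) (g z)) x.
Proof.
move=> df dg.
pose l (p : 'rV[C]_m * 'rV[C]_n) : 'rV[C]_(m + n) := row_mx p.1 p.2.
have lin : linear l by move=> a p q; rewrite /l /= scale_row_mx add_row_mx.
pose lM := GRing.isLinear.Build _ _ _ _ _ lin.
pose L : {linear _ -> _} := HB.pack l lM.
apply: (@differentiable_comp _ _ _ _ (fun z => (f z, g z)) L).
  exact: differentiable_pair.
by apply: linear_differentiable; exact: row_mx_cts.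
Qed.

Section ProdChart.
Variables (M N : topologicalType) (m n : nat) (c : chart R M m) (d : chart R N n).

Definition prod_chart : chart R (M * N)%type (m + n).
Proof.
apply: (@Chart _ _ _ (chart_dom c `*` chart_dom d)
  [set z | chart_img c (lsubmx z) /\ chart_img d (rsubmx z)]
  (fun p => row_mx (chart_map c p.1) (chart_map d p.2))
  (fun z => (chart_inv c (lsubmx z), chart_inv d (rsubmx z)))).
- rewrite openE => -[x y] [/= cx dy].
  by exists (chart_dom c, chart_dom d) => //; split; apply: open_nbhs_nbhs;
    split=> //; exact: chart_dom_open.
- apply: (@openI _ (lsubmx @^-1` chart_img c) (rsubmx @^-1` chart_img d)).
  + by move/continuousP: (@continuous_lsubmx C 1 m n); apply; exact: chart_img_open.
  + by move/continuousP: (@continuous_rsubmx C 1 m n); apply; exact: chart_img_open.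
- move=> [x y] [/= /chart_mapP[? ex] /chart_mapP[? ey]].
  by rewrite row_mxKl row_mxKr ex ey.
- move=> z [/= /chart_invP[? ex] /chart_invP[? ey]].
  by rewrite ex ey hsubmxK.
- move=> [x y] [/= cx dy].
  have cc : {for (x, y), continuous (chart_map c \o fst)}.
    by apply: continuous_comp; [exact: cvg_fst|exact: chart_map_cts].
  have cd : {for (x, y), continuous (chart_map d \o snd)}.
    by apply: continuous_comp; [exact: cvg_snd|exact: chart_map_cts].
  exact: (continuous_comp (cvg_pair cc cd) (@row_mx_cts m n _)).
- move=> z [/= cz dz].
  have cc : {for z, continuous (chart_inv c \o lsubmx)}.
    by apply: continuous_comp; [exact: continuous_lsubmx|exact: chart_inv_cts].
  have cd : {for z, continuous (chart_inv d \o rsubmx)}.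
    by apply: continuous_comp; [exact: continuous_rsubmx|exact: chart_inv_cts].
  exact: (cvg_pair cc cd).
Defined.
End ProdChart.

Variables (M N : complex_manifold R).

Definition prod_atlas : set (chart R (M * N)%type (mdim M + mdim N)) :=
  [set e | exists c d, [/\ matlas c, matlas d & e = prod_chart c d]].

Definition prod_manifold : complex_manifold R.
Proof.
apply: (@ComplexManifold R (M * N)%type (mdim M + mdim N) prod_atlas).
- move=> [x y]; have [c ac cx] := matlas_cover x; have [d ad dy] := matlas_cover y.
  by exists (prod_chart c d) => //; exists c, d.
- move=> _ _ [c [d [ac ad ->]]] [c' [d' [ac' ad' ->]]] z [/= cz dz] [/= cz' dz'].
  apply: row_mx_differentiable.
    apply: (@differentiable_comp _ _ _ _ lsubmx (chart_map c' \o chart_inv c)).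
      exact: differentiable_lsubmx.
    exact: matlas_compat.
  apply: (@differentiable_comp _ _ _ _ rsubmx (chart_map d' \o chart_inv d)).
    exact: differentiable_rsubmx.
  exact: matlas_compat.
- by apply: prod_hausdorff; exact: mspace_hausdorff.
- by apply: prod_second_countable; exact: mspace_second_countable.
Defined.
End Product.

Section NearDiff.
Variables (K : numFieldType) (V W : normedModType K).

Lemma near_eq_differentiable (f g : V -> W) (x : V) :
  (\forall y \near x, f y = g y) -> differentiable f x -> differentiable g x.
Proof.
move=> fg df; rewrite (_ : g = f + (g - f)); last by rewrite addrC subrK.
apply: differentiableD => //; set h := g - f.
have h0 : \forall y \near x, h y = 0.
  by apply: filterS fg => y fgy; rewrite /h -[LHS]/(g y - f y) fgy subrr.
have c0 : continuous (0 : V -> W) by exact: cst_continuous.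
have hdec : h \o shift x = cst (h x) + (\0 : V -> W) +o_ 0 id.
  apply/eqaddoP => eps eps0.
  have -> : h x = 0 by exact: nbhs_singleton h0.
  have : \forall y \near 0, h (y + x) = 0.
    by move: h0; rewrite (near_shift 0 x) subr0.
  apply: filterS => y hy.
  rewrite -[X in `|X|]/(h (y + x) - (0 + 0)) hy addr0 subr0 normr0.
  by rewrite mulr_ge0// ltW.
have d0 : 'd h x = 0 :> (V -> W) by apply/diff_unique.
by apply/diff_locallyP; rewrite d0.
Qed.

End NearDiff.

Lemma cts_ball (T : topologicalType) (K : numFieldType) (V : normedModType K) (h : T -> V) (z : T) (r : K) :
  {for z, continuous h} -> 0 < r -> \forall w \near z, ball (h z) r (h w).
Proof. by move=> ch r0; apply: ch; exact: nbhsx_ballx. Qed.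
Section Transition.
Variables (R : realType) (M : topologicalType) (n : nat) (c d : chart R M n).
Variable z : 'rV[Cplx R]_n.
Hypotheses (cz : chart_img c z) (dz : chart_dom d (chart_inv c z)).

Lemma transition_cts : {for z, continuous (chart_map d \o chart_inv c)}.
Proof. by apply: continuous_comp; [exact: chart_inv_cts|exact: chart_map_cts]. Qed.

Lemma near_transition : \forall w \near z, chart_img c w /\ chart_dom d (chart_inv c w).
Proof.
have nc : nbhs z (chart_img c).
  by apply: open_nbhs_nbhs; split=> //; exact: chart_img_open.
have nd : nbhs z (chart_inv c @^-1` chart_dom d).
  by apply: chart_inv_cts => //; apply: open_nbhs_nbhs; split=> //; exact: chart_dom_open.
exact: filterI nc nd.
Qed.
End Transition.

Lemma open_image_second_countable (S T : topologicalType) (f : S -> T) :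
  continuous f -> (forall A, open A -> open (f @` A)) -> (forall y, exists x, f x = y) ->
  @second_countable S -> @second_countable T.
Proof.
move=> cf fo sf [B cB [oB nB]]; exists [set f @` A | A in B].
  by apply: sub_countable cB; exact: card_image_le.
split; first by move=> _ [A BA <-]; exact/fo/oB.
move=> y W nW; have [x fx] := sf y.
have /nB[A [BA Ax] AW] : nbhs x (f @^-1` W) by apply: cf; rewrite fx.
by exists (f @` A); [split; [exists A|exists x]|move=> _ [a /AW ? <-]].
Qed.

Section Torus.
Variable R : realType.
Local Notation C := (Cplx R).
Local Open Scope quotient_scope.
Variables (n : nat) (e : 'I_(2 * n) -> 'rV[C]_n).

(* Linear independence over the real numbers. *)
Definition real_free := forall c : 'I_(2 * n) -> R,
  \sum_i (((c i)%:C)%C : C) *: e i = 0 -> forall i, c i = 0.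

Definition lattice : set 'rV[C]_n :=
  [set v | exists k : 'I_(2 * n) -> int, v = \sum_i ((k i)%:~R : C) *: e i].

Lemma lattice0 : lattice 0.
Proof. by exists (fun=> 0); rewrite big1// => i _; rewrite scale0r. Qed.

Lemma latticeN v : lattice v -> lattice (- v).
Proof.
move=> [k ->]; exists (fun i => - k i); rewrite -sumrN.
by apply: eq_bigr => i _; rewrite mulrNz scaleNr.
Qed.

Lemma latticeD u v : lattice u -> lattice v -> lattice (u + v).
Proof.
move=> [k ->] [l ->]; exists (fun i => k i + l i); rewrite -big_split.
by apply: eq_bigr => i _; rewrite /= mulrzDr scalerDl.
Qed.

Definition lattice_rel (x y : 'rV[C]_n) : bool := `[< lattice (x - y) >].

Lemma lattice_rel_refl : reflexive lattice_rel.
Proof. by move=> x; apply/asboolP; rewrite subrr; exact: lattice0. Qed.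

Lemma lattice_rel_sym : symmetric lattice_rel.
Proof.
by move=> x y; apply/asboolP/asboolP => /latticeN; rewrite opprB.
Qed.

Lemma lattice_rel_trans : transitive lattice_rel.
Proof.
move=> y x z /asboolP xy /asboolP yz; apply/asboolP.
by rewrite -(subrKA y x); exact: latticeD.
Qed.

Canonical lattice_equiv := EquivRel lattice_rel
  lattice_rel_refl lattice_rel_sym lattice_rel_trans.

Definition torus_space : topologicalType :=
  quotient_topology {eq_quot lattice_equiv}.

Definition torus_proj : 'rV[C]_n -> torus_space := \pi_{eq_quot lattice_equiv}.

Lemma torus_projP x y : torus_proj x = torus_proj y <-> lattice (x - y).
Proof.
split=> [/eqmodP/asboolP//|xy]; apply/eqmodP; exact/asboolP.
Qed.

Lemma torus_proj_surj (p : torus_space) : exists z, torus_proj z = p.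
Proof. by exists (repr (p : {eq_quot lattice_equiv})); exact: reprK. Qed.

Lemma torus_proj_cts : continuous torus_proj.
Proof. exact: pi_continuous. Qed.

Lemma torus_proj_open (A : set 'rV[C]_n) : open A -> open (torus_proj @` A).
Proof.
move=> oA; suff : open (torus_proj @^-1` (torus_proj @` A)) by [].
rewrite openE => z [a Aa /torus_projP az].
have oz : {for z, continuous (fun w : 'rV[C]_n => w + (a - z) : 'rV[C]_n)}.
  apply: (@cvgD C 'rV[C]_n 'rV[C]_n (nbhs z) _ id (cst (a - z)) z (a - z)).
    exact: cvg_id.
  exact: cvg_cst.
have : nbhs z ((fun w : 'rV[C]_n => w + (a - z)) @^-1` A).
  by apply: oz; rewrite addrC subrK; exact: open_nbhs_nbhs.
apply: filterS => w Aw; exists (w + (a - z)) => //.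
by apply/torus_projP; rewrite addrAC subrr add0r.
Qed.

Hypothesis e_free : real_free.

Lemma lattice_discrete : exists2 r : R, 0 < r &
  forall v, lattice v -> (forall j, `|v 0 j| < ((r%:C)%C : C)) -> v = 0.
Proof.
pose w (v : 'rV[C]_n) : 'rV[R]_(n + n) :=
  row_mx (map_mx (@complex.Re R) v) (map_mx (@complex.Im R) v).
pose B : 'M[R]_(2 * n, n + n) := \matrix_i w (e i).
have wB (c : 'rV[R]_(2 * n)) : c *m B = w (\sum_i (((c 0 i)%:C)%C : C) *: e i).
  apply/rowP => j; rewrite mxE; under eq_bigr do rewrite !mxE.
  rewrite !mxE; case: (fintype.split j) => k; rewrite !mxE summxE raddf_sum;
    apply: eq_bigr => i _; rewrite !mxE; case: (e i 0 k) => a b; simpc => //.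
have Bf : row_free B.
  apply: inj_row_free => c; rewrite wB => w0; apply/rowP => i; rewrite mxE.
  apply: (e_free (c := fun i => c 0 i)); apply/rowP => k; rewrite !mxE.
  set s := \sum_i _ in w0 *.
  have re0 := congr1 (fun m : 'rV_(n + n) => m 0 (lshift n k)) w0.
  have im0 := congr1 (fun m : 'rV_(n + n) => m 0 (rshift n k)) w0.
  move: re0 im0; rewrite /w row_mxEl row_mxEr !mxE.
  by case: (s 0 k) => a b /= -> ->.
pose P := pinvmx B.
pose S := \sum_i \sum_j `|P i j|.
have S0 : 0 <= S by rewrite sumr_ge0// => i _; rewrite sumr_ge0.
have S1 : 0 < 1 + S by rewrite ltr_pwDl.
exists (1 + S)^-1; first by rewrite invr_gt0.
move=> v [k ->]; set v' := \sum_i _ => small.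
pose c : 'rV[R]_(2 * n) := \row_i (k i)%:~R.
have cB : c *m B = w v'.
  rewrite wB; congr w; apply: eq_bigr => i _; rewrite !mxE; congr (_ *: _).
  by rewrite rmorph_int.
have wsmall j : `|w v' 0 j| <= (1 + S)^-1.
  have Cbound (z : C) : `|z| < ((1 + S)^-1%:C)%C ->
      `|complex.Re z| <= (1 + S)^-1 /\ `|complex.Im z| <= (1 + S)^-1.
    case: z => a b; rewrite normc_def ltcR /= => zS.
    have ab : 0 <= a ^+ 2 /\ 0 <= b ^+ 2 by rewrite !sqr_ge0.
    split; apply: le_trans (ltW zS); rewrite -sqrtr_sqr ler_wsqrtr//.
      by rewrite lerDl; case: ab.
    by rewrite lerDr; case: ab.
  rewrite mxE; case: (fintype.split j) => l; rewrite mxE.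
    by have [] := Cbound _ (small l).
  by have [] := Cbound _ (small l).
have k0 i : k i = 0.
  apply/eqP; rewrite -absz_eq0 -leqn0 -ltnS -ltz_nat.
  have cE : c = w v' *m P by rewrite -cB mulmxKp.
  have : `|(k i)%:~R : R| < 1.
    have -> : (k i)%:~R = (w v' *m P) 0 i by rewrite -cE mxE.
    rewrite mxE (le_lt_trans (ler_norm_sum _ _ _))//.
    apply: (@le_lt_trans _ _ ((1 + S)^-1 * S)); last first.
      by rewrite mulrC ltr_pdivrMr// mul1r ltrDr.
    rewrite mulr_sumr; apply: ler_sum => j _; rewrite normrM.
    apply: ler_pM => //.
    by rewrite (bigD1 i)//= lerDl sumr_ge0.
  by rewrite -intr_norm (ltrz1 R) => /=.
by rewrite /v' big1// => i _; rewrite k0 scale0r.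
Qed.

Lemma lattice_sep : exists2 r : C, 0 < r &
  forall x y : 'rV[C]_n, lattice (x - y) -> ball x r y -> x = y.
Proof.
have [r r0 rP] := lattice_discrete; exists (r%:C)%C; first by rewrite ltcR.
move=> x y xy [_ xry]; apply/eqP; rewrite -subr_eq0; apply/eqP/rP => // j.
by have := xry 0 j; rewrite -ball_normE /= !mxE.
Qed.

Lemma torus_hausdorff : hausdorff_space torus_space.
Proof.
move=> p q; have [x <-] := torus_proj_surj p; have [y <-] := torus_proj_surj q.
move=> cl; have [r r0 rP] := lattice_sep.
have near_rep (A : set 'rV[C]_n) : nbhs x A -> exists2 z, A z & lattice (z - y).
  move=> /nbhs_ballP[e' e0 eA]; have e2 : 0 < e' / 2 by rewrite divr_gt0.
  have nb (v : 'rV[C]_n) : nbhs (torus_proj v) (torus_proj @` (ball v (e' / 2))).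
    apply: open_nbhs_nbhs; split; last by exists v => //; exact: ballxx.
    by apply: torus_proj_open; exact: ball_open.
  have [_ [[x' xx' <-] [y' yy' /torus_projP x'y']]] := cl _ _ (nb x) (nb y).
  exists (y + (x' - y')).
    apply: eA; rewrite [e']splitr; apply: ball_triangle xx' _.
    move: yy'; rewrite -!ball_normE /ball_ /=.
    by rewrite opprD opprB addrA addrAC addrCA subrr addr0 distrC.
  by rewrite addrAC subrr add0r -opprB; exact: latticeN.
have r2 : 0 < r / 2 by rewrite divr_gt0.
have [z0 xz0 z0y] := near_rep _ (nbhsx_ballx x _ r2).
suff -> : x = z0 by apply/torus_projP.
apply: (@norm_hausdorff _ 'rV[C]_n) => A B nA nB; exists z0; split; last first.
  exact: nbhs_singleton.
have [z [Az xz] zy] := near_rep _ (filterI nA (nbhsx_ballx x _ r2)).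
rewrite -(rP z z0) //.
  by rewrite -(subrKA y) -[y - z0]opprB; exact: latticeD (latticeN _).
by rewrite [r]splitr; apply: ball_triangle xz0; exact: ball_sym.
Qed.

Lemma torus_second_countable : @second_countable torus_space.
Proof.
apply: open_image_second_countable torus_proj_cts torus_proj_open torus_proj_surj _.
exact: rV_second_countable.
Qed.

Lemma sub_id_cts (g : 'rV[C]_n -> 'rV[C]_n) (z : 'rV[C]_n) :
  {for z, continuous g} ->
  {for z, continuous (fun w : 'rV[C]_n => g w - w : 'rV[C]_n)}.
Proof.
move=> cg; apply: (@cvgD C 'rV[C]_n 'rV[C]_n (nbhs z) _ g (fun w => - w) (g z) (- z)).
  exact: cg.
by apply: (@cvgN C 'rV[C]_n 'rV[C]_n (nbhs z) _ id z); exact: cvg_id.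
Qed.

Lemma translation_differentiable (a z : 'rV[C]_n) :
  differentiable (id + cst a : 'rV[C]_n -> 'rV[C]_n) z.
Proof.
apply: (@differentiableD C 'rV[C]_n 'rV[C]_n id (cst a) z); first exact: ex_diff.
exact: (@differentiable_cst C 'rV[C]_n 'rV[C]_n).
Qed.

Lemma lattice_translation_differentiable (g : 'rV[C]_n -> 'rV[C]_n) (z : 'rV[C]_n) :
  {for z, continuous g} -> (\forall w \near z, lattice (g w - w)) ->
  differentiable g z.
Proof.
move=> cg latg; have [r r0 rP] := lattice_sep.
have nb : \forall w \near z, ball (g z - z) r (g w - w).
  exact: (cts_ball (sub_id_cts cg) r0).
apply: near_eq_differentiable (translation_differentiable (g z - z) z).
apply: filterS (filterI latg nb) => w [lw bw].
have gw : g z - z = g w - w.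
  apply: rP bw.
  by apply: latticeD; [exact: nbhs_singleton latg|exact: latticeN].
by change (w + (g z - z) = g w); rewrite gw addrC subrK.
Qed.

(* The charts are the local inverses of the projection from C^n. *)
Definition torus_atlas : set (chart R torus_space n) :=
  [set c | forall z, chart_img c z -> chart_inv c z = torus_proj z].

Lemma torus_atlas_cover p : exists2 c, torus_atlas c & chart_dom c p.
Proof.
have [r r0 rP] := lattice_sep; have [z0 <-] := torus_proj_surj p.
have r2 : 0 < r / 2 by rewrite divr_gt0.
pose B : set 'rV[C]_n := ball z0 (r / 2).
have oB : open B by exact: ball_open.
have inj x y : B x -> B y -> torus_proj x = torus_proj y -> x = y.
  move=> Bx By /torus_projP xy; apply: rP => //.
  by rewrite [r]splitr; apply: ball_triangle By; exact: ball_sym.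
pose s p := xget z0 [set z | B z /\ torus_proj z = p].
have sP z : B z -> s (torus_proj z) = z.
  move=> Bz; have [Bs sz] : [set z' | B z' /\ torus_proj z' = torus_proj z] (s (torus_proj z)).
    by apply: xgetI; split; [exact: Bz|].
  exact: inj.
unshelve eexists (@Chart R torus_space n (torus_proj @` B) B s torus_proj _ oB _ _ _ _).
- exact: torus_proj_open.
- by move=> _ [z Bz <-]; rewrite sP.
- by move=> z Bz; rewrite sP//; split => //; exists z.
- move=> _ [z Bz <-] A; rewrite sP// nbhsE => -[A' [oA' A'z] A'A].
  apply: (@filterS _ _ _ (torus_proj @` (A' `&` B))).
    by move=> _ [w [A'w Bw] <-]; apply: A'A; rewrite sP.
  apply: open_nbhs_nbhs; split; last by exists z.
  by apply: torus_proj_open; exact: openI.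
- by move=> z _; exact: torus_proj_cts.
- by move=> z.
- by exists z0 => //; exact: ballxx.
Qed.

Lemma torus_atlas_compat c d : torus_atlas c -> torus_atlas d ->
  forall z, chart_img c z -> chart_dom d (chart_inv c z) ->
  differentiable (chart_map d \o chart_inv c) z.
Proof.
move=> ac ad z cz dz.
apply: lattice_translation_differentiable; first exact: transition_cts.
apply: filterS (near_transition cz dz) => w [cw dw]; apply/torus_projP.
have [im inv] := chart_mapP dw.
by rewrite -(ad _ im) inv (ac _ cw).
Qed.

Definition complex_torus : complex_manifold R :=
  ComplexManifold torus_atlas_cover torus_atlas_compat
    torus_hausdorff torus_second_countable.
End Torus.

Section Holomorphic.
Variable R : realType.
Local Notation C := (Cplx R).

Definition hol_at (M N : complex_manifold R) (f : M -> N) (x : M) : Prop :=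
  {for x, continuous f} /\
  forall (c : chart R M (mdim M)) (d : chart R N (mdim N)),
    matlas c -> chart_dom c x -> matlas d -> chart_dom d (f x) ->
    differentiable (chart_map d \o f \o chart_inv c) (chart_map c x).

(* A is an arbitrary subset, and f is holomorphic on A when it extends
   holomorphically to a neighbourhood of each point of A.  For A open this is
   holomorphy at every point of A (hol_on_open), and for A an embedded complex
   submanifold, e.g. a fibre of a submersion, it is holomorphy of the
   restriction of f to the manifold A.  Values of f outside A are irrelevant. *)
Definition hol_on (M N : complex_manifold R) (A : set M) (f : M -> N) : Prop :=
  forall x, A x -> exists2 g : M -> N,
    \forall y \near x, hol_at g y & \forall y \near x, A y -> f y = g y.

Lemma near_eq_hol_at (M N : complex_manifold R) (f g : M -> N) (x : M) :
  (\forall y \near x, f y = g y) -> hol_at f x -> hol_at g x.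
Proof.
move=> fg [cf df]; have fgx : f x = g x by exact: nbhs_singleton fg.
split=> [B|c d ac cx ad]; rewrite -fgx.
  by move=> /cf nB; apply: filterS (filterI fg nB) => y [fgy By]; rewrite /preimage /= -fgy.
move=> dx; apply: near_eq_differentiable (df c d ac cx ad dx).
have [im inv] := chart_mapP cx.
have : nbhs (chart_map c x) (chart_inv c @^-1` [set y | f y = g y]).
  by apply: chart_inv_cts => //; rewrite inv.
by apply: filterS => z fgz; exact: (congr1 (chart_map d) fgz).
Qed.

Lemma hol_on_open (M N : complex_manifold R) (A : set M) (f : M -> N) :
  open A -> hol_on A f <-> forall x, A x -> hol_at f x.
Proof.
move=> oA; split=> [Af x Ax|Af x Ax].
  have nA : nbhs x A by exact: open_nbhs_nbhs.
  have [g gx fg] := Af x Ax.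
  apply: near_eq_hol_at (nbhs_singleton gx).
  by apply: filterS (filterI nA fg) => y [Ay /(_ Ay)].
exists f; last exact: nearW.
have nA : nbhs x A by exact: open_nbhs_nbhs.
exact: filterS nA.
Qed.

Definition biholomorphism (M N : complex_manifold R) (A : set M) (B : set N)
    (f : M -> N) (g : N -> M) : Prop :=
  [/\ hol_on A f, hol_on B g,
      forall x, A x -> B (f x) /\ g (f x) = x &
      forall y, B y -> A (g y) /\ f (g y) = y].

Definition biholomorphic (M N : complex_manifold R) (A : set M) (B : set N) :
  Prop := exists f g, biholomorphism A B f g.

Definition submersion_at (M N : complex_manifold R) (f : M -> N) (x : M) : Prop :=
  hol_at f x /\
  forall (c : chart R M (mdim M)) (d : chart R N (mdim N)),
    matlas c -> chart_dom c x -> matlas d -> chart_dom d (f x) ->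
    forall v, exists u,
      'd (chart_map d \o f \o chart_inv c) (chart_map c x) u = v.

(* Local triviality of the restriction p|_Y : Y -> X, for Y open in M. *)
Definition hol_locally_trivial (M X : complex_manifold R) (Y : set M)
    (p : M -> X) : Prop :=
  [/\ p @` Y = setT,
      forall y, Y y -> submersion_at p y &
      exists F : complex_manifold R,
        (forall x, biholomorphic (Y `&` p @^-1` [set x]) [set: F]) /\
        forall x, exists V : set X, [/\ open V, V x &
          exists (phi : M -> prod_manifold F X) (psi : prod_manifold F X -> M),
            biholomorphism (Y `&` p @^-1` V) ([set: F] `*` V : set (prod_manifold F X)) phi psi /\
            forall y, Y y -> V (p y) -> (phi y).2 = p y]].

Definition unit_disc : set (C1 R) := [set z : C | `|z| < 1].

Definition Cstar (m : nat) : set (Cn R m) := [set z : 'rV[C]_m | forall j, z 0 j != 0].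

End Holomorphic.

Arguments unit_disc : clear implicits.
Arguments Cstar : clear implicits.

Section LineBundle.
Variable R : realType.
Local Notation C := (Cplx R).

(* The vector space structure of the fibres is given by fib_add (meaningful on
   two points of the same fibre) and fib_scale; the vector space axioms follow
   from local_triv, whose trivialisations are linear on the fibres. *)
Record line_bundle (X : complex_manifold R) := LineBundle {
  tot : complex_manifold R;
  bundle_proj : tot -> X;
  fib_add : tot -> tot -> tot;
  fib_scale : C -> tot -> tot;
  proj_hol : hol_on setT bundle_proj;
  proj_add : forall v w, bundle_proj v = bundle_proj w -> bundle_proj (fib_add v w) = bundle_proj v;
  proj_scale : forall a v, bundle_proj (fib_scale a v) = bundle_proj v;
  local_triv : forall x, exists V : set X, [/\ open V, V x &
    exists (phi : tot -> prod_manifold X (C1 R))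
           (psi : prod_manifold X (C1 R) -> tot),
    [/\ biholomorphism (bundle_proj @^-1` V) (V `*` [set: C1 R] : set (prod_manifold X (C1 R))) phi psi,
        forall v, V (bundle_proj v) -> (phi v).1 = bundle_proj v,
        forall v w, V (bundle_proj v) -> bundle_proj v = bundle_proj w ->
          (phi (fib_add v w)).2 = (phi v).2 + (phi w).2 :> C &
        forall a v, V (bundle_proj v) ->
          (phi (fib_scale a v)).2 = a * (phi v).2 :> C]]
}.

Arguments bundle_proj {X} L v : rename.
Arguments fib_add {X} L v w : rename.
Arguments fib_scale {X} L a v : rename.

Definition fiber (X : complex_manifold R) (L : line_bundle X) (x : X) :
  set (tot L) := bundle_proj L @^-1` [set x].

Definition zero_section (X : complex_manifold R) (L : line_bundle X) :
  set (tot L) := range (fib_scale L 0).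

End LineBundle.

Arguments bundle_proj {R X} L v : rename.
Arguments fib_add {R X} L v w : rename.
Arguments fib_scale {R X} L a v : rename.
Arguments fiber {R X} L x _.
Arguments zero_section {R X} L _.

Section ChernClass.
Variable R : realType.
Local Notation C := (Cplx R).

Definition open_cover (X : topologicalType) (I : Type) (U : I -> set X) : Prop :=
  (forall i, open (U i)) /\ \bigcup_i U i = setT.

Definition cech_d1 (A : zmodType) (X I : Type) (b : I -> I -> X -> A)
    (i j k : I) (x : X) : A := b j k x - b i k x + b i j x.

(* The sheaf cohomology of the constant sheaf A is taken as Cech cohomology,
   H^2(X, A) = colim_U H^2(U, A) over the open covers U of X.  A cochain on U is
   given by functions, of which only the restrictions to the intersections of
   members of U matter.  A 2-cocycle on U represents 0 in the colimit when its
   pullback to some refinement V of U is a coboundary of locally constant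
   functions. *)
Definition cech_class_eq0 (A : zmodType) (X : topologicalType) (I : Type)
    (U : I -> set X) (c : I -> I -> I -> X -> A) : Prop :=
  exists (J : Type) (V : J -> set X) (t : J -> I) (b : J -> J -> X -> A),
    [/\ open_cover V, forall j, V j `<=` U (t j),
        forall i j x, (V i `&` V j) x ->
          \forall y \near x, (V i `&` V j) y -> b i j y = b i j x &
        forall i j k x, (V i `&` V j `&` V k) x ->
          c (t i) (t j) (t k) x = cech_d1 b i j k x].

Definition complex_exp (z : C) : C :=
  let: (a +i* b)%C := z in (expR a * cos b +i* (expR a * sin b))%C.

(* c represents c_1(L), the image of the class of L under the connecting map
   Pic(X) -> H^2(X, Z) of the exponential sequence: on the open cover U, the
   bundle L has holomorphic frames s i with transition functions
   exp(2 pi i f i j), and c is the Cech coboundary of f.  Being continuous and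
   integer valued, c is locally constant. *)
Definition chern_cocycle (X : complex_manifold R) (L : line_bundle X) (I : Type)
    (U : I -> set X) (c : I -> I -> I -> X -> int) : Prop :=
  open_cover U /\
  exists (s : I -> X -> tot L) (f : I -> I -> X -> C1 R),
    [/\ forall i, hol_on (U i) (s i),
        forall i x, U i x -> fiber L x (s i x) /\ ~ zero_section L (s i x),
        forall i j, hol_on (U i `&` U j) (f i j),
        forall i j x, (U i `&` U j) x ->
          s j x = fib_scale L (complex_exp ((2 * pi)*i%C * (f i j x : C))) (s i x) &
        forall i j k x, (U i `&` U j `&` U k) x ->
          ((c i j k x)%:~R : C) = cech_d1 (f : I -> I -> X -> C) i j k x].

(* c_R(L), the image of c_1(L) in H^2(X, R), is not zero.  All the cocycles that
   represent c_1(L) have the same class in H^2(X, Z), and there is one on a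
   suitable cover, because manifolds are paracompact. *)
Definition real_chern_class_neq0 (X : complex_manifold R) (L : line_bundle X) :
    Prop :=
  forall (I : Type) (U : I -> set X) (c : I -> I -> I -> X -> int),
    chern_cocycle L U c ->
    ~ cech_class_eq0 U (fun i j k x => (c i j k x)%:~R : R).

End ChernClass.

(* Main.v *)
Require Import Defs.
From HB Require Import structures.
From mathcomp Require Import all_boot all_order all_algebra.
From mathcomp Require Import all_classical all_reals topology normedtype.
From mathcomp Require Import landau sequences derive exp trigo.
From mathcomp Require Import measure lebesgue_measure lebesgue_integral ftc.
From mathcomp Require Import complex ring lra.
Set Implicit Arguments.
Unset Strict Implicit.
Unset Printing Implicit Defensive.
Import Order.TTheory GRing.Theory Num.Theory.
Import numFieldNormedType.Exports.
Local Open Scope classical_set_scope.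
Local Open Scope ring_scope.

(** A disc bundle with holomorphic local trivialisations is flat.  The change
    of trivialisations is a family of automorphisms of the unit disc D which
    depends holomorphically on the base point, and such a family is locally
    constant: by Schwarz's lemma its members are Moebius transformations with
    parameters a and c, and both a and c turn out to be holomorphic together with
    their conjugates (disc_automorphism_family_constant).

    The zero section of L is a section of this flat bundle.  Along an entire
    curve C -> X parallel transport turns it, over the disc of radius r, into a
    holomorphic map with values in D; by Cauchy's estimate its derivative at
    the centre is at most 2 / r, so it is 0 (flat_section_derivative_eq0).  X is the
    image of some C^n by an open holomorphic map pr, the projection onto the
    torus or the exponential in each coordinate, so that nearby points of X lie on
    entire curves t |-> pr (z + t v).  Hence in every trivialisation the zero
    section is locally constant.

    The normal bundle of the zero section is L.  The fibre derivatives of the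
    trivialisations along it are holomorphic frames of L, as derivatives of
    holomorphic functions depending on parameters
    (fiber_derivative_differentiable), and their transition functions are the
    derivatives of locally constant automorphisms at locally constant points.
    So L has locally constant transition functions, with locally constant
    logarithms f, and c_1(L) is represented by the coboundary of f.  The real part
    of f shows that it vanishes in real cohomology (flat_chern_class_eq0).

    The function theory of one variable rests on Goursat's theorem for
    rectangles.  In the variable zeta of z + r exp(zeta) it gives the mean value
    property, also for functions which are only continuous at the centre;
    hence the maximum principle holds for difference quotients, and yields
    Schwarz's lemma, Cauchy's estimate and the second order expansion with a
    uniform remainder. *)

(** * The modulus as a real number *)

Section Modulus.
Variable R : realType.
Local Notation C := (Cplx R).
Implicit Types z w : C.

(** The norm of C has values in C; estimates are made in the ordered field R. *)
Definition nrm (z : C) : R := complex.Re `|z|.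

Lemma nrmE z : `|z| = ((nrm z)%:C)%C.
Proof. by rewrite /nrm normc_def. Qed.

Lemma nrm_ge0 z : 0 <= nrm z.
Proof. by rewrite -ler0c -nrmE. Qed.

Lemma nrmD z w : nrm (z + w) <= nrm z + nrm w.
Proof. by rewrite -lecR rmorphD -!nrmE ler_normD. Qed.

Lemma nrmM z w : nrm (z * w) = nrm z * nrm w.
Proof. by apply: complexI; rewrite rmorphM -!nrmE normrM. Qed.

Lemma nrmN z : nrm (- z) = nrm z.
Proof. by rewrite /nrm normrN. Qed.

Lemma nrmB z w : nrm (z - w) = nrm (w - z).
Proof. by rewrite -nrmN opprB. Qed.

Lemma nrm0 : nrm 0 = 0.
Proof. by rewrite /nrm normr0. Qed.

Lemma nrm1 : nrm 1 = 1.
Proof. by rewrite /nrm normr1. Qed.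

Lemma nrm_eq0 z : (nrm z == 0) = (z == 0).
Proof.
by rewrite -[RHS]normr_eq0 nrmE -[X in _ = (_ == X)](rmorph0 (real_complex R))
  (inj_eq (@complexI R)).
Qed.

Lemma nrm_gt0 z : (0 < nrm z) = (z != 0).
Proof. by rewrite lt_neqAle nrm_ge0 andbT eq_sym nrm_eq0. Qed.

Lemma nrmV z : nrm z^-1 = (nrm z)^-1.
Proof. by apply: complexI; rewrite fmorphV -!nrmE normfV. Qed.

Lemma nrm_real (x : R) : nrm (x%:C)%C = `|x|.
Proof. by rewrite /nrm normc_def /= expr0n addr0 sqrtr_sqr. Qed.

Lemma nrm_conj z : nrm (z^*)%C = nrm z.
Proof. by rewrite /nrm normcJ. Qed.

Lemma nrm_i : nrm 'i%C = 1.
Proof. by rewrite /nrm normc_def /= expr0n add0r expr1n sqrtr1. Qed.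

Lemma Re_le_nrm z : `|complex.Re z| <= nrm z.
Proof. by rewrite -lecR -nrmE normc_ge_Re. Qed.

Lemma Im_le_nrm z : `|complex.Im z| <= nrm z.
Proof.
have -> : complex.Im z = - complex.Re (z * 'i%C) by rewrite ReiNIm opprK.
by rewrite normrN (le_trans (Re_le_nrm _))// nrmM nrm_i mulr1.
Qed.

Lemma nrm_le_ReIm z : nrm z <= `|complex.Re z| + `|complex.Im z|.
Proof.
by rewrite {1}(complexE z) (le_trans (nrmD _ _))// nrmM nrm_i mul1r !nrm_real.
Qed.

Lemma mulcJ_nrm z : z * (z^*)%C = ((nrm z ^+ 2)%:C)%C.
Proof. by rewrite -sqr_normc nrmE -rmorphXn. Qed.

Lemma nrm2E z : nrm z ^+ 2 = complex.Re z ^+ 2 + complex.Im z ^+ 2.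
Proof.
apply: complexI; have := add_Re2_Im2 z; rewrite nrmE => ->.
by rewrite -rmorphXn.
Qed.

Lemma nrm_dist z w : nrm z - nrm w <= nrm (z - w).
Proof. by rewrite lerBlDr (le_trans _ (nrmD _ _))// subrK. Qed.

Lemma nbhs_nrmP z (A : set C) :
  nbhs z A <-> exists2 d : R, 0 < d & forall w, nrm (w - z) < d -> A w.
Proof.
split=> [/nbhs_ballP[e /= /gt0_complexP[d d0 ->] eA]|[d d0 dA]].
  by exists d => // w wz; apply: eA; rewrite -ball_normE /ball_ /= nrmE nrmB ltcR.
apply/nbhs_ballP; exists (d%:C)%C; first by rewrite /= ltcR.
by move=> w; rewrite -ball_normE /ball_ /= nrmE nrmB ltcR; exact: dA.
Qed.

Lemma near_nrm z (d : R) : 0 < d -> \forall w \near z, nrm (w - z) < d.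
Proof. by move=> d0; apply/nbhs_nrmP; exists d. Qed.

Lemma open_nrm_lt z (d : R) : open [set w : C | nrm (w - z) < d].
Proof.
rewrite openE => w /= wd; apply/nbhs_nrmP; exists (d - nrm (w - z)).
  by rewrite subr_gt0.
move=> y yw /=; rewrite -(subrKA w) (le_lt_trans (nrmD _ _))//.
by rewrite -ltrBrDr.
Qed.

Lemma cts_nrmP (f : C -> C) z : {for z, continuous f} <->
  forall e : R, 0 < e -> exists2 d, 0 < d &
    forall w, nrm (w - z) < d -> nrm (f w - f z) < e.
Proof.
split=> [cf e e0|H].
  have /nbhs_nrmP[d d0 dP] := cf _ (near_nrm (f z) e0); by exists d.
move=> A /nbhs_nrmP[e e0 eA]; have [d d0 dP] := H e e0.
by apply/nbhs_nrmP; exists d => // w /dP /eA.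
Qed.

Lemma lipschitz_nrm_continuous (f : C -> R) :
  (forall z w, `|f w - f z| <= nrm (w - z)) -> continuous f.
Proof.
move=> lf z A /nbhs_ballP[e e0 eA]; apply/nbhs_nrmP; exists e => // w wz.
by apply: eA; rewrite -ball_normE /ball_ /= distrC (le_lt_trans (lf _ _)).
Qed.

Lemma nrm_continuous : continuous nrm.
Proof.
apply: lipschitz_nrm_continuous => z w.
by rewrite ler_norml nrm_dist andbT lerNl opprB nrmB nrm_dist.
Qed.

Lemma Re_continuous : continuous (@complex.Re R : C -> R).
Proof.
by apply: lipschitz_nrm_continuous => z w; rewrite -raddfB Re_le_nrm.
Qed.

Lemma Im_continuous : continuous (@complex.Im R : C -> R).
Proof.
by apply: lipschitz_nrm_continuous => z w; rewrite -raddfB Im_le_nrm.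
Qed.

Lemma complex_continuous (T : topologicalType) (f g : T -> R) t :
  {for t, continuous f} -> {for t, continuous g} ->
  {for t, continuous (fun s => (f s +i* g s)%C : C)}.
Proof.
move=> cf cg A /nbhs_nrmP[e e0 eA].
have e2 : 0 < e / 2 by rewrite divr_gt0.
have /cvgrPdist_lt/(_ _ e2) Hf : f s @[s --> t] --> f t by exact: cf.
have /cvgrPdist_lt/(_ _ e2) Hg : g s @[s --> t] --> g t by exact: cg.
near=> s; apply: eA; apply: (le_lt_trans (nrm_le_ReIm _)).
rewrite [ltRHS]splitr; apply: ltrD; rewrite raddfB /= distrC.
  by near: s; exact: Hf.
by near: s; exact: Hg.
Unshelve. all: by end_near. Qed.

End Modulus.

(** * Complex derivatives *)

Section ComplexDerivative.
Variable R : realType.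
Local Notation C := (Cplx R).
Implicit Types (f g : C -> C) (z w a b : C).

Lemma is_derive_nrmP f z a : is_derive z (1 : C) f a <->
  forall e : R, 0 < e -> exists2 d : R, 0 < d & forall h,
    nrm h < d -> nrm (f (z + h) - f z - a * h) <= e * nrm h.
Proof.
pose q := fun h : C => h^-1 *: ((f \o shift z) (h *: (1 : C)) - f z) : C.
have qE h : h != 0 -> nrm (q h - a) * nrm h = nrm (f (z + h) - f z - a * h).
  move=> h0; rewrite -nrmM /q /= mulrBl; congr (nrm (_ - _)).
  rewrite -[_ *: _]/(_ * _) [h^-1 * _]mulrC -mulrA mulVf// mulr1.
  by rewrite -[h *: 1]/(h * 1) mulr1 [h + z]addrC.
split=> [fza|H].
  have cq : q @ 0^' --> a.
    by have <- := @derive_val _ _ _ _ _ _ _ fza; have := @ex_derive _ _ _ _ _ _ _ fza.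
  move=> e e0; have /nbhs_nrmP[d d0 dP] := cq _ (near_nrm a e0).
  exists d => // h hd; have [->|h0] := eqVneq h 0.
    by rewrite addr0 subrr mulr0 subr0 nrm0 mulr0.
  rewrite -qE// ler_pM2r ?nrm_gt0//; apply/ltW/dP => //.
  by rewrite subr0.
have cq : q @ 0^' --> a.
  move=> A /nbhs_nrmP[e e0 eA]; have e2 : 0 < e / 2 by rewrite divr_gt0.
  have [d d0 dP] := H _ e2; apply/nbhs_nrmP; exists d => // h; rewrite subr0 => hd h0.
  apply: eA; have := dP _ hd; rewrite -qE// ler_pM2r ?nrm_gt0// => /le_lt_trans; apply.
  by rewrite ltr_pdivrMr// ltr_pMr// ltr1n.
apply: DeriveDef; first by apply/cvg_ex; exists a.
by apply: cvg_lim cq; exact: norm_hausdorff.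
Qed.

Lemma is_derive_differentiable f z a : is_derive z (1 : C) f a -> differentiable f z.
Proof. by move=> [df _]; apply/derivable1_diffP. Qed.

Lemma differentiable_is_derive f z : differentiable f z -> is_derive z (1 : C) f ('D_1 f z).
Proof. by move=> /derivable1_diffP df; exact: derivableP. Qed.

Lemma is_derive_cts f z a : is_derive z (1 : C) f a -> {for z, continuous f}.
Proof. by move=> /is_derive_differentiable /differentiable_continuous. Qed.

Lemma is_derive_uniq f z a b : is_derive z (1 : C) f a -> is_derive z (1 : C) f b -> a = b.
Proof. by move=> [_ <-] [_ <-]. Qed.

Lemma is_derive_chain f g z a b : is_derive z (1 : C) f a -> is_derive (f z) (1 : C) g b ->
  is_derive z (1 : C) (g \o f) (b * a).
Proof.
move=> /is_derive_nrmP fa gb; have cf : {for z, continuous f}.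
  by apply: is_derive_cts; apply/is_derive_nrmP; exact: fa.
move/is_derive_nrmP: gb => gb; apply/is_derive_nrmP => e e0.
pose K := nrm a + 1; have K0 : 0 < K by rewrite ltr_wpDl ?nrm_ge0.
pose e1 := e / (2 * K); have e10 : 0 < e1 by rewrite divr_gt0// mulr_gt0.
pose e2 := Num.min 1 (e / (2 * (nrm b + 1))).
have b0 : 0 < nrm b + 1 by rewrite ltr_wpDl ?nrm_ge0.
have e20 : 0 < e2 by rewrite lt_min ltr01 divr_gt0// mulr_gt0.
have [d1 d10 H1] := gb _ e10; have [d2 d20 H2] := fa _ e20.
have /cts_nrmP/(_ _ d10)[d3 d30 H3] := cf.
exists (Num.min d2 d3); first by rewrite lt_min d20.
move=> h; rewrite lt_min => /andP[hd2 hd3].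
pose k := f (z + h) - f z.
have kd1 : nrm k < d1 by apply: H3; rewrite addrAC subrr add0r.
have kh : nrm (k - a * h) <= e2 * nrm h by exact: H2.
have kK : nrm k <= K * nrm h.
  rewrite -(subrK (a * h) k) (le_trans (nrmD _ _))// nrmM mulrDl mul1r addrC lerD2l.
  by rewrite (le_trans kh)// ler_piMl ?nrm_ge0// /e2 ge_min lexx.
have gk : nrm (g (f z + k) - g (f z) - b * k) <= e1 * nrm k by exact: H1.
have -> : (g \o f) (z + h) - (g \o f) z - b * a * h =
    (g (f z + k) - g (f z) - b * k) + b * (k - a * h).
  by rewrite /= [f z + k]addrC subrK; ring.
rewrite (le_trans (nrmD _ _))// nrmM.
have -> : e * nrm h = e / 2 * nrm h + e / 2 * nrm h by rewrite -mulrDl -splitr.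
apply: lerD.
  rewrite (le_trans gk)// (le_trans (ler_wpM2l (ltW e10) kK))// mulrA.
  by rewrite ler_wpM2r ?nrm_ge0// /e1 invfM mulrA mulfVK// gt_eqF.
rewrite (le_trans (ler_wpM2l (nrm_ge0 _) kh))// mulrA ler_wpM2r ?nrm_ge0//.
apply: (@le_trans _ _ ((nrm b + 1) * (e / (2 * (nrm b + 1))))).
  apply: ler_pM; rewrite ?nrm_ge0 ?(ltW e20) ?lerDl//.
  by rewrite /e2 ge_min lexx orbT.
rewrite le_eqVlt; apply/orP; left; apply/eqP; field; exact: lt0r_neq0.
Qed.

Lemma nrm_small_eq0 z (K : R) : (forall e : R, 0 < e -> nrm z <= K * e) -> z = 0.
Proof.
move=> H; apply/eqP; rewrite -nrm_eq0 eq_le nrm_ge0 andbT.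
apply/ler_addgt0Pr => e e0; rewrite add0r.
have K0 : 0 < `|K| + 1 by rewrite ltr_wpDl.
apply: (le_trans (H (e / (`|K| + 1)) _)); first by rewrite divr_gt0.
rewrite mulrCA ler_piMr ?(ltW e0)// ler_pdivrMr// mul1r.
by rewrite (le_trans (ler_norm _))// lerDl.
Qed.

(** The derivative of f is linear and that of its conjugate antilinear over C;
    increments along 1 and along i are compatible with both only if it is 0. *)
Lemma is_derive_conj_eq0 f g z a b :
  (\forall w \near z, g w = (f w)^*%C) ->
  is_derive z (1 : C) f a -> is_derive z (1 : C) g b -> a = 0.
Proof.
move=> /nbhs_nrmP[d d0 gf] /is_derive_nrmP fa /is_derive_nrmP gb.
have key (u : C) : nrm u = 1 -> (a * u)^*%C = b * u.
  move=> u1; apply/eqP; rewrite -subr_eq0; apply/eqP/(@nrm_small_eq0 _ 2) => e e0.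
  have [d1 d10 H1] := fa _ e0; have [d2 d20 H2] := gb _ e0.
  pose t := Num.min d (Num.min d1 d2) / 2.
  have m0 : 0 < Num.min d (Num.min d1 d2) by rewrite !lt_min d0 d10.
  have t0 : 0 < t by rewrite divr_gt0.
  have tm : t < Num.min d (Num.min d1 d2) by rewrite ltr_pdivrMr// ltr_pMr// ltr1n.
  pose h := (t%:C)%C * u : C.
  have ht : nrm h = t by rewrite nrmM u1 mulr1 nrm_real gtr0_norm.
  move: tm; rewrite -ht !lt_min => /and3P[hd hd1 hd2].
  have gzh : g (z + h) = (f (z + h))^*%C by apply: gf; rewrite addrAC subrr add0r.
  have gz : g z = (f z)^*%C by apply: gf; rewrite subrr nrm0.
  have := H1 _ hd1; have := H2 _ hd2; rewrite gzh gz -rmorphB => gh.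
  rewrite -nrm_conj rmorphB => fh.
  have : nrm ((a * h)^*%C - b * h) <= e * nrm h + e * nrm h.
    apply: (le_trans _ (lerD gh fh)); rewrite -[X in _ <= _ + X]nrmN.
    apply: (le_trans _ (nrmD _ _)); rewrite opprB [X in _ <= nrm X]addrC subrKA.
    by rewrite le_eqVlt eqxx.
  rewrite /h [a * _]mulrCA [b * _]mulrCA [X in nrm (X - _)]rmorphM [X in nrm (X * _ - _)](conjc_real t) -mulrBr nrmM nrm_real.
  rewrite gtr0_norm// -mulrDl [X in _ <= X]mulrC ht ler_pM2l//.
  by rewrite mulr_natl mulr2n.
have a1 : a^*%C = b by have := key 1 (nrm1 R); rewrite !mulr1.
have := key 'i%C (nrm_i R); rewrite -a1; case: (a) => x y.
by case=> ? ?; apply/eqP; rewrite eq_complex /=; apply/andP; split; apply/eqP; lra.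
Qed.

End ComplexDerivative.

(** * Goursat's theorem on rectangles *)

Section Antiderivative.
Variable R : realType.
Local Notation C := (Cplx R).

Lemma continuous_antiderivative (u : R -> R) (a b : R) : continuous u ->
  exists U : R -> R, forall x, a < x < b -> is_derive x (1 : R) U (u x).
Proof.
move=> cu; have [ba|ab] := leP b a.
  by exists u => x /andP[ax xb]; have := lt_trans ax xb; rewrite ltNge ba.
exists (fun x => (\int[lebesgue_measure]_(t in [set` Interval (BLeft a) (BRight x)]) (u t))%R).
move=> x /andP[ax xb].
have iu : lebesgue_measure.-integrable [set` Interval (BLeft a) (BRight b)] (EFin \o u).
  apply: continuous_compact_integrable; first exact: segment_compact.
  by apply: continuous_subspaceT.
have [] := @continuous_FTC1 R u (BLeft a) x b xb iu _ (cu x).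
  by rewrite lte_fin.
move=> dU U'; apply: DeriveDef; first exact: dU.
by rewrite -derive1E.
Qed.

(** C is normed over itself only, hence the derivative by components. *)
Definition rderive (E : R -> C) (x : R) (e : C) :=
  is_derive x (1 : R) (fun t => complex.Re (E t)) (complex.Re e) /\
  is_derive x (1 : R) (fun t => complex.Im (E t)) (complex.Im e).

Lemma rderive_mean (E e : R -> C) (a b : R) : a <= b ->
  (forall x, a <= x <= b -> rderive E x (e x)) ->
  exists2 x, a <= x <= b & complex.Re (E b - E a) = complex.Re (e x) * (b - a).
Proof.
move=> ab H.
have [x xab Ex] : exists2 c, c \in `[a, b]%R &
    complex.Re (E b) - complex.Re (E a) = complex.Re (e c) * (b - a).
  apply: (@MVT_segment R (fun t => complex.Re (E t)) (fun t => complex.Re (e t)) a b) => //.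
    by move=> x; rewrite in_itv /= => /andP[ax xb]; apply: (H _ _).1; rewrite !ltW.
  apply: derivable_within_continuous => x; rewrite in_itv /= => /H[] [dx _] _.
  exact: dx.
by exists x; [move: xab; rewrite in_itv|rewrite raddfB].
Qed.

(** The factor 2 comes from the mean value theorem for each component. *)
Lemma rderive_bound (E e : R -> C) (M a b : R) : a <= b ->
  (forall x, a <= x <= b -> rderive E x (e x)) ->
  (forall x, a <= x <= b -> nrm (e x) <= M) ->
  nrm (E b - E a) <= 2 * M * (b - a).
Proof.
move=> ab H HM; have ba : 0 <= b - a by rewrite subr_ge0.
apply: (le_trans (nrm_le_ReIm _)); rewrite -mulrA mulr_natl mulr2n; apply: lerD.
  have [x xab ->] := rderive_mean ab H; rewrite normrM (ger0_norm ba).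
  by rewrite ler_wpM2r// (le_trans (Re_le_nrm _))// HM.
have Hi x : a <= x <= b -> rderive (fun t => - 'i%C * E t) x (- 'i%C * e x).
  move=> /H[H1 H2].
  have re (z : C) : complex.Re (- 'i%C * z) = complex.Im z.
    by rewrite mulNr raddfN /= mulrC ReiNIm opprK.
  have im (z : C) : complex.Im (- 'i%C * z) = - complex.Re z.
    by rewrite mulNr raddfN /= mulrC ImiRe.
  split; first by under eq_fun do rewrite re; rewrite re.
  by under eq_fun do rewrite im; rewrite im; exact: is_deriveN.
have [x xab] := rderive_mean ab Hi.
rewrite -mulrBr mulNr raddfN /= [_ * (_ - _)]mulrC ReiNIm opprK => ->.
rewrite normrM (ger0_norm ba) ler_wpM2r//.
by rewrite (le_trans (Re_le_nrm _))// nrmM nrmN nrm_i mul1r HM.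
Qed.

End Antiderivative.

Section Nested.
Variable R : realType.

Lemma nested_segments (a : nat -> R) (l : R) : 0 <= l ->
  (forall n, a n.+1 = a n \/ a n.+1 = a n + l / 2 ^+ n.+1) ->
  exists x, forall n, [/\ a 0%N <= a n, a n + l / 2 ^+ n <= a 0%N + l &
    a n <= x <= a n + l / 2 ^+ n].
Proof.
move=> l0 H.
have step n : a n <= a n.+1 /\ a n.+1 + l / 2 ^+ n.+1 <= a n + l / 2 ^+ n.
  have e : l / 2 ^+ n = l / 2 ^+ n.+1 + l / 2 ^+ n.+1.
    by rewrite exprSr invfM mulrA -splitr.
  have p0 : 0 <= l / 2 ^+ n.+1 by rewrite divr_ge0// exprn_ge0.
  by case: (H n) => ->; rewrite e; split; lra.
have up n k : a n <= a (n + k)%N /\ a (n + k)%N + l / 2 ^+ (n + k) <= a n + l / 2 ^+ n.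
  elim: k => [|k [IH1 IH2]]; first by rewrite addn0.
  have [s1 s2] := step (n + k)%N.
  by rewrite addnS; split; [exact: le_trans s1|exact: le_trans IH2].
have pos n : 0 <= l / 2 ^+ n by rewrite divr_ge0// exprn_ge0.
have ub n m : a m <= a n + l / 2 ^+ n.
  have [nm|/ltnW mn] := leqP n m.
    have [_] := up n (m - n)%N; rewrite subnKC// => /(le_trans _); apply.
    by rewrite lerDl.
  have [+ _] := up m (n - m)%N; rewrite subnKC// => /le_trans; apply.
  by rewrite lerDl.
exists (sup (range a)) => n.
have [u1 u2] := up 0%N n; move: u1 u2; rewrite add0n expr0 divr1 => u1 u2.
split=> //; apply/andP; split.
  apply: ub_le_sup; last by exists n.
  by exists (a n + l / 2 ^+ n) => _ [m _ <-].
apply: ge_sup; first by exists (a 0%N), 0%N.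
by move=> _ [m _ <-].
Qed.

End Nested.

Section Goursat.
Variable R : realType.
Local Notation C := (Cplx R).
Variables (g : C -> C) (HP VP : R -> R -> C) (K K' : R).

Let pt (x y : R) : C := (x +i* y)%C.

Hypothesis HPd : forall y x, `|x| < K -> rderive (HP y) x (g (pt x y)).
Hypothesis VPd : forall x y, `|y| < K' -> rderive (VP x) y (g (pt x y)).

(** The integral of g along the boundary of the rectangle with corners
    a + ic and b + id; HP and VP are antiderivatives of g along the horizontal
    and the vertical lines, which makes additivity a telescoping identity. *)
Definition contour (a b c d : R) : C :=
  HP c b - HP c a + 'i%C * (VP b d - VP b c) - (HP d b - HP d a)
  - 'i%C * (VP a d - VP a c).

Lemma contour_split a m b c n d : contour a b c d =
  contour a m c n + contour m b c n + contour a m n d + contour m b n d.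
Proof. rewrite /contour; ring. Qed.

(** The affine part of g has a quadratic primitive A, whose increments cancel
    around the rectangle; only the remainder L of g contributes. *)
Lemma contour_le (a b c d x0 y0 e : R) (g0 g1 : C) :
  - K < a -> b < K -> - K' < c -> d < K' -> a <= x0 <= b -> c <= y0 <= d -> 0 <= e ->
  (forall x y, a <= x <= b -> c <= y <= d ->
    nrm (g (pt x y) - g0 - g1 * (pt x y - pt x0 y0)) <= e * nrm (pt x y - pt x0 y0)) ->
  nrm (contour a b c d) <= 4 * e * (b - a + (d - c)) ^+ 2.
Proof.
move=> Ka bK Kc dK /andP[ax0 x0b] /andP[cy0 y0d] e0 He.
have ab : a <= b := le_trans ax0 x0b.
have cd : c <= d := le_trans cy0 y0d.
pose p := complex.Re g0; pose q := complex.Im g0.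
pose r := complex.Re g1; pose s := complex.Im g1.
have g0E : g0 = (p +i* q)%C by rewrite /p /q; case: (g0).
have g1E : g1 = (r +i* s)%C by rewrite /r /s; case: (g1).
pose A (x y : R) : C :=
  ((p * x - q * y + (r * ((x - x0) ^+ 2 - (y - y0) ^+ 2) - 2 * s * ((x - x0) * (y - y0))) / 2)
   +i* (q * x + p * y + (s * ((x - x0) ^+ 2 - (y - y0) ^+ 2) + 2 * r * ((x - x0) * (y - y0))) / 2))%C.
pose L x y : C := g (pt x y) - g0 - g1 * (pt x y - pt x0 y0).
have LR x y : complex.Re (L x y) =
    complex.Re (g (pt x y)) - (p + r * (x - x0) - s * (y - y0)).
  by rewrite /L g0E g1E /pt; case: (g _) => u v /=; ring.
have LI x y : complex.Im (L x y) =
    complex.Im (g (pt x y)) - (q + s * (x - x0) + r * (y - y0)).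
  by rewrite /L g0E g1E /pt; case: (g _) => u v /=; ring.
have EH y x : a <= x <= b -> rderive (fun t => HP y t - A t y) x (L x y).
  move=> /andP[ax xb].
  have [|H1 H2] := @HPd y x; first by rewrite ltr_norml (lt_le_trans Ka)// (le_lt_trans xb).
  split; rewrite ?LR ?LI.
    under eq_fun do rewrite raddfB /=.
    apply: is_deriveB; apply: is_derive_eq.
    by rewrite /GRing.scale /=; field.
  under eq_fun do rewrite raddfB /=.
  apply: is_deriveB; apply: is_derive_eq.
  by rewrite /GRing.scale /=; field.
have EV x y : c <= y <= d -> rderive (fun t => VP x t + 'i%C * A x t) y (L x y).
  move=> /andP[cy yd].
  have [|H1 H2] := @VPd x y; first by rewrite ltr_norml (lt_le_trans Kc)// (le_lt_trans yd).
  have re (u v : C) : complex.Re (u + 'i%C * v) = complex.Re u - complex.Im v.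
    by case: u v => ? ? [? ?] /=; ring.
  have im (u v : C) : complex.Im (u + 'i%C * v) = complex.Im u + complex.Re v.
    by case: u v => ? ? [? ?] /=; ring.
  split; rewrite ?LR ?LI.
    under eq_fun do rewrite re /=.
    apply: is_deriveB; apply: is_derive_eq.
    by rewrite /GRing.scale /=; field.
  under eq_fun do rewrite im /=.
  apply: is_deriveD; apply: is_derive_eq.
  by rewrite /GRing.scale /=; field.
pose D := b - a + (d - c).
have ba0 : 0 <= b - a by rewrite subr_ge0.
have dc0 : 0 <= d - c by rewrite subr_ge0.
have LM x y : a <= x <= b -> c <= y <= d -> nrm (L x y) <= e * D.
  move=> xab ycd; apply: (le_trans (He _ _ xab ycd)); rewrite ler_wpM2l//.
  apply: (le_trans (nrm_le_ReIm _)); rewrite /pt /D.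
  move: xab ycd => /andP[ax xb] /andP[cy yd].
  by apply: lerD; rewrite raddfB /= ler_norml; apply/andP; split; lra.
have aba : a <= a <= b by rewrite lexx.
have abb : a <= b <= b by rewrite lexx andbT.
have cdc : c <= c <= d by rewrite lexx.
have cdd : c <= d <= d by rewrite lexx andbT.
have h1 := rderive_bound (e := (fun x => L x c)) ab (EH c) (fun x xab => LM x c xab cdc).
have h2 := rderive_bound (e := (fun x => L x d)) ab (EH d) (fun x xab => LM x d xab cdd).
have h3 := rderive_bound (e := (L b)) cd (EV b) (fun y ycd => LM b y abb ycd).
have h4 := rderive_bound (e := (L a)) cd (EV a) (fun y ycd => LM a y aba ycd).
pose Hc := HP c b - A b c - (HP c a - A a c); pose Hd := HP d b - A b d - (HP d a - A a d).
pose Vb := VP b d + 'i%C * A b d - (VP b c + 'i%C * A b c).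
pose Va := VP a d + 'i%C * A a d - (VP a c + 'i%C * A a c).
move: h1 h2 h3 h4; rewrite -/Hc -/Hd -/Vb -/Va.
have ii : 'i%C * 'i%C = - 1 :> C by rewrite -expr2 sqr_i.
have -> : contour a b c d = (Hc + 'i%C * Vb) + - (Hd + 'i%C * Va).
  rewrite /contour /Hc /Hd /Vb /Va; ring: ii.
move=> h1 h2 h3 h4.
apply: (le_trans (nrmD _ _)); rewrite nrmN.
have n1 := nrmD Hc ('i%C * Vb); have n2 := nrmD Hd ('i%C * Va).
move: n1 n2; rewrite !nrmM !nrm_i !mul1r -/D => n1 n2.
have : 2 * (e * D) * (b - a) + 2 * (e * D) * (d - c) = 2 * e * D ^+ 2.
  by rewrite /D; ring.
move=> E; lra.
Qed.

Lemma contour_quarter (a b c d : R) :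
  exists p : R * R, [/\ p.1 = a \/ p.1 = (a + b) / 2, p.2 = c \/ p.2 = (c + d) / 2 &
    nrm (contour a b c d) <=
      4 * nrm (contour p.1 (p.1 + (b - a) / 2) p.2 (p.2 + (d - c) / 2))].
Proof.
pose m := (a + b) / 2; pose n := (c + d) / 2.
have ma : a + (b - a) / 2 = m by rewrite /m; field.
have mb : m + (b - a) / 2 = b by rewrite /m; field.
have nc : c + (d - c) / 2 = n by rewrite /n; field.
have nd : n + (d - c) / 2 = d by rewrite /n; field.
pose N := nrm (contour a b c d) / 4.
have four : nrm (contour a b c d) <= nrm (contour a m c n) + nrm (contour m b c n)
    + nrm (contour a m n d) + nrm (contour m b n d).
  rewrite (contour_split a m b c n d).
  apply: (le_trans (nrmD _ _)); rewrite lerD2r.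
  apply: (le_trans (nrmD _ _)); rewrite lerD2r.
  exact: nrmD.
have [H1|H1] := leP N (nrm (contour a m c n)).
  exists (a, c); split; [by left|by left|]; rewrite /= ma nc; move: H1; rewrite /N; lra.
have [H2|H2] := leP N (nrm (contour m b c n)).
  exists (m, c); split; [by right|by left|]; rewrite /= mb nc; move: H2; rewrite /N; lra.
have [H3|H3] := leP N (nrm (contour a m n d)).
  exists (a, n); split; [by left|by right|]; rewrite /= ma nd; move: H3; rewrite /N; lra.
exists (m, n); split; [by right|by right|]; rewrite /= mb nd; move: H1 H2 H3; rewrite /N; lra.
Qed.

(** Goursat's argument: if the integral is not zero, it is of the order of the
    area on a nested sequence of rectangles, against differentiability at
    their common point. *)
Lemma goursat (a l c h : R) : 0 <= l -> 0 <= h ->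
  - K < a -> a + l < K -> - K' < c -> c + h < K' ->
  (forall x y, a <= x <= a + l -> c <= y <= c + h -> differentiable g (pt x y)) ->
  contour a (a + l) c (c + h) = 0.
Proof.
move=> l0 h0 Ka lK Kc hK dg.
pose J n (p : R * R) := nrm (contour p.1 (p.1 + l / 2 ^+ n) p.2 (p.2 + h / 2 ^+ n)).
have half n (u : R) : u / 2 ^+ n / 2 = u / 2 ^+ n.+1 by rewrite exprSr invfM mulrA.
have mid (u v : R) : (u + (u + v)) / 2 = u + v / 2 by field.
have /choice[F FP] : forall np : nat * (R * R), exists p' : R * R,
    [/\ p'.1 = np.2.1 \/ p'.1 = np.2.1 + l / 2 ^+ np.1.+1,
        p'.2 = np.2.2 \/ p'.2 = np.2.2 + h / 2 ^+ np.1.+1 &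
        J np.1 np.2 <= 4 * J np.1.+1 p'].
  move=> [n p]; have [p' [H1 H2 H3]] := contour_quarter p.1 (p.1 + l / 2 ^+ n) p.2 (p.2 + h / 2 ^+ n).
  exists p'; split; rewrite /=; first by case: H1 => ->; [left|right; rewrite mid half].
    by case: H2 => ->; [left|right; rewrite mid half].
  by move: H3; rewrite /J ![_ + _ - _]addrAC !subrr !add0r !half.
pose P := fix P n : R * R := if n is m.+1 then F (m, P m) else (a, c).
have JP n : J 0%N (a, c) <= 4 ^+ n * J n (P n).
  elim: n => [|n IH]; first by rewrite expr0 mul1r.
  rewrite (le_trans IH)// exprSr -mulrA ler_wpM2l ?exprn_ge0//.
  by have [_ _] := FP (n, P n).
have [x xP] := @nested_segments _ (fun n => (P n).1) _ l0
  (fun n => let: And3 H _ _ := FP (n, P n) in H).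
have [y yP] := @nested_segments _ (fun n => (P n).2) _ h0
  (fun n => let: And3 _ H _ := FP (n, P n) in H).
have [_ _] := xP 0%N; have [_ _] := yP 0%N.
rewrite /= expr0 !divr1 => yr xr.
have /differentiable_is_derive/is_derive_nrmP D := dg _ _ xr yr.
apply: (@nrm_small_eq0 _ _ (4 * (l + h) ^+ 2)) => e e0.
have [d d0 dP] := D _ e0.
have lh0 : 0 <= l + h by rewrite addr_ge0.
have [n nd] : exists n : nat, (l + h) / 2 ^+ n < d.
  exists (Num.bound ((l + h) / d)); rewrite ltr_pdivrMr ?exprn_gt0// mulrC -ltr_pdivrMr//.
  have := archi_boundP (divr_ge0 lh0 (ltW d0)) => /lt_trans; apply.
  by rewrite -natrX ltr_nat ltn_expl.
have [x1 x2 x3] := xP n; have [y1 y2 y3] := yP n; move: x1 x2 x3 y1 y2 y3 => /=.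
set u := (P n).1; set v := (P n).2 => x1 x2 x3 y1 y2 y3.
have main : J n (P n) <= 4 * e * ((l + h) / 2 ^+ n) ^+ 2.
  have := @contour_le u (u + l / 2 ^+ n) v (v + h / 2 ^+ n) x y e
    (g (pt x y)) ('D_1 g (pt x y)) (lt_le_trans Ka x1) (le_lt_trans x2 lK)
    (lt_le_trans Kc y1) (le_lt_trans y2 hK) x3 y3 (ltW e0).
  rewrite ![_ + _ / _ - _]addrAC !subrr !add0r -mulrDl; apply.
  move=> s t us vt; have -> : g (pt s t) = g (pt x y + (pt s t - pt x y)) by rewrite addrC subrK.
  apply: dP; apply: le_lt_trans nd; rewrite mulrDl.
  apply: (le_trans (nrm_le_ReIm _)).
  move: us vt x3 y3 => /andP[? ?] /andP[? ?] /andP[? ?] /andP[? ?].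
  by apply: lerD; rewrite raddfB /= ler_norml; apply/andP; split; lra.
have := JP n; rewrite /J /= expr0 !divr1 => /le_trans; apply.
apply: (le_trans (ler_wpM2l _ main)); first by rewrite exprn_ge0.
rewrite le_eqVlt; apply/orP; left; apply/eqP.
rewrite expr_div_n -exprM mulnC exprM.
have -> : (2 : R) ^+ 2 = 4 by rewrite expr2 -natrM.
by field; rewrite expf_neq0// pnatr_eq0.
Qed.

End Goursat.



(** * The complex exponential *)

Section Exponential.
Variable R : realType.
Local Notation C := (Cplx R).

Lemma complex_expD (z w : C) : complex_exp (z + w) = complex_exp z * complex_exp w.
Proof.
case: z w => a b [c d]; rewrite /complex_exp /= expRD cosD sinD.
by apply/eqP; rewrite eq_complex /=; apply/andP; split; apply/eqP; ring.
Qed.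

Lemma nrm_exp (z : C) : nrm (complex_exp z) = expR (complex.Re z).
Proof.
case: z => a b; apply/eqP; rewrite -(@eqrXn2 _ 2%N) ?nrm_ge0 ?expR_ge0//.
rewrite nrm2E /= !exprMn -mulrDr cos2Dsin2 mulr1 eqxx //.
Qed.

Lemma complex_exp0 : complex_exp (0 : C) = 1.
Proof. by rewrite /complex_exp /= expR0 cos0 sin0 mulr0 mulr1. Qed.

Lemma complex_exp_neq0 (z : C) : complex_exp z != 0.
Proof. by rewrite -nrm_gt0 nrm_exp expR_gt0. Qed.

Lemma is_derive_absP (f : R -> R) (x a : R) : is_derive x (1 : R) f a <->
  forall e : R, 0 < e -> exists2 d : R, 0 < d & forall h,
    `|h| < d -> `|f (x + h) - f x - a * h| <= e * `|h|.
Proof.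
pose q := fun h : R => h^-1 *: ((f \o shift x) (h *: (1 : R)) - f x) : R.
have qE h : h != 0 -> `|q h - a| * `|h| = `|f (x + h) - f x - a * h|.
  move=> h0; rewrite -normrM /q /= mulrBl; congr (`|_ - _|).
  rewrite -[_ *: _]/(_ * _) [h^-1 * _]mulrC -mulrA mulVf// mulr1.
  by rewrite -[h *: 1]/(h * 1) mulr1 [h + x]addrC.
split=> [fxa|H].
  have cq : q @ 0^' --> a.
    by have <- := @derive_val _ _ _ _ _ _ _ fxa; have := @ex_derive _ _ _ _ _ _ _ fxa.
  move=> e e0; have /cvgrPdist_lt/(_ _ e0) := cq.
  move=> /nbhs_ballP[d d0 dP]; exists d => // h hd; have [->|h0] := eqVneq h 0.
    by rewrite addr0 subrr mulr0 subr0 normr0 mulr0.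
  rewrite -qE// ler_pM2r ?normr_gt0//; apply/ltW; rewrite distrC; apply: dP => //.
  by rewrite -ball_normE /ball_ /= sub0r normrN.
have cq : q @ 0^' --> a.
  apply/cvgrPdist_le => e e0; have [d d0 dP] := H _ e0.
  apply/nbhs_ballP; exists d => // h; rewrite -ball_normE /ball_ /= sub0r normrN => hd h0.
  by have := dP _ hd; rewrite -qE// distrC ler_pM2r ?normr_gt0.
apply: DeriveDef; first by apply/cvg_ex; exists a.
by apply: cvg_lim cq; exact: norm_hausdorff.
Qed.

(** By the addition formula it is enough to expand at 0. *)
Lemma is_derive_exp (z : C) : is_derive z (1 : C) (@complex_exp R) (complex_exp z).
Proof.
apply/is_derive_nrmP => e e0.
have Hlin (e1 : R) : 0 < e1 -> exists2 d : R, 0 < d & forall h : C, nrm h < d ->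
    nrm (complex_exp h - 1 - h) <= e1 * nrm h.
  move=> e10; have [e2 [e20 e21 e2e]] : exists e2 : R, [/\ 0 < e2, e2 <= 1 & 9 * e2 <= e1].
    exists (Num.min 1 (e1 / 9)); split; first by rewrite lt_min ltr01 divr_gt0.
      by rewrite ge_min lexx.
    by rewrite mulrC -ler_pdivlMr// ge_min lexx orbT.
  have [d1 d10 H1] := (is_derive_absP _ _ _).1 (is_derive_expR 0) _ e20.
  have [d2 d20 H2] := (is_derive_absP _ _ _).1 (is_derive_cos 0) _ e20.
  have [d3 d30 H3] := (is_derive_absP _ _ _).1 (is_derive_sin 0) _ e20.
  exists (Num.min e2 (Num.min 1 (Num.min d1 (Num.min d2 d3)))).
    by rewrite !lt_min e20 ltr01 d10 d20.
  case=> a b; set h := (a +i* b)%C; rewrite !lt_min => /and5P[he h1 hd1 hd2 hd3].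
  have aN : `|a| <= nrm h := Re_le_nrm h; have bN : `|b| <= nrm h := Im_le_nrm h.
  have := H1 a (le_lt_trans aN hd1); have := H2 b (le_lt_trans bN hd2).
  have := H3 b (le_lt_trans bN hd3).
  rewrite !add0r expR0 cos0 sin0 oppr0 mul0r !subr0 addr0 !mul1r => sb cb ea.
  have E1 : `|expR a - 1| <= 2 * nrm h.
    rewrite -(subrK a (expR a - 1)) (le_trans (ler_normD _ _))// mulr_natl mulr2n.
    apply: lerD => //; apply: (le_trans ea); apply: (le_trans _ aN).
    by rewrite ler_piMl.
  pose E : C := (cos b +i* sin b)%C.
  have Eb : nrm (E - 1 - ((0 : R) +i* b)%C) <= 2 * e2 * nrm h.
    apply: (le_trans (nrm_le_ReIm _)); rewrite !raddfB /= !subr0.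
    rewrite -mulrA mulr_natl mulr2n.
    apply: lerD; first by apply: (le_trans cb); rewrite ler_pM2l.
    by apply: (le_trans sb); rewrite ler_pM2l.
  (* The remainder is e^a (e^(ib) - 1 - ib) + (e^a - 1 - a) + ib (e^a - 1); its
     summands are bounded by 6, 1 and 2 times e2 |h|. *)
  have -> : complex_exp h - 1 - h = ((expR a)%:C)%C * (E - 1 - ((0 : R) +i* b)%C) +
      ((expR a - 1 - a)%:C)%C + ((0 : R) +i* b)%C * ((expR a - 1)%:C)%C.
    by apply/eqP; rewrite eq_complex /=; apply/andP; split; apply/eqP; ring.
  apply: (le_trans (nrmD _ _)); rewrite nrmM nrm_real.
  have b2 : nrm ((0 : R) +i* b)%C <= nrm h.
    by apply: (le_trans (nrm_le_ReIm _)); rewrite /= normr0 add0r.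
  have t1 := nrmD (((expR a)%:C)%C * (E - 1 - ((0 : R) +i* b)%C)) ((expR a - 1 - a)%:C)%C.
  move: t1; rewrite nrmM !nrm_real => t1.
  have ea3 : `|expR a| <= 3.
    rewrite -(subrK 1 (expR a)) (le_trans (ler_normD _ _))// normr1.
    move: E1 h1; lra.
  have p1 : `|expR a| * nrm (E - 1 - ((0 : R) +i* b)%C) <= 3 * (2 * e2 * nrm h).
    by rewrite ler_pM ?nrm_ge0.
  have p2 : nrm ((0 : R) +i* b)%C * `|expR a - 1| <= nrm h * (2 * nrm h).
    by rewrite ler_pM ?nrm_ge0.
  have p3 : nrm h * (2 * nrm h) <= 2 * e2 * nrm h.
    by rewrite mulrC -!mulrA ler_pM2l// ler_wpM2r ?nrm_ge0// ltW.
  have p4 : e2 * `|a| <= e2 * nrm h by rewrite ler_pM2l.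
  have p5 : 9 * e2 * nrm h <= e1 * nrm h by rewrite ler_wpM2r ?nrm_ge0.
  lra.
have n0 : 0 < nrm (complex_exp z) by rewrite nrm_gt0 complex_exp_neq0.
have [d d0 H] := Hlin _ (divr_gt0 e0 n0).
exists d => // h /H hd; rewrite complex_expD.
have -> : complex_exp z * complex_exp h - complex_exp z - complex_exp z * h =
   complex_exp z * (complex_exp h - 1 - h) by ring.
rewrite nrmM (le_trans (ler_wpM2l (ltW n0) hd))//.
by rewrite mulrA [nrm _ * _]mulrC divfK// gt_eqF.
Qed.

Lemma complex_exp_surj (z : C) : z != 0 -> exists w : C, complex_exp w = z.
Proof.
rewrite -nrm_gt0 => n0; pose r := nrm z.
pose c := complex.Re z / r; pose s := complex.Im z / r.
have cs : c ^+ 2 + s ^+ 2 = 1.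
  rewrite /c /s !expr_div_n -mulrDl -nrm2E divff// expf_neq0// gt_eqF//.
have c1 : -1 <= c <= 1.
  by rewrite -ler_norml -(@expr_le1 _ 2%N)// real_normK ?num_real// -cs lerDl sqr_ge0.
have [t [ct st]] : exists t : R, cos t = c /\ sin t = s.
  have ca : cos (acos c) = c by apply: acosK; rewrite in_itv.
  have sa : sin (acos c) = `|s|.
    by rewrite sin_acos// -cs addrAC subrr add0r sqrtr_sqr.
  have [s0|s0] := leP 0 s.
    by exists (acos c); rewrite sa ger0_norm.
  exists (- acos c); rewrite cosN sinN sa ca; split=> //.
  by rewrite ltr0_norm// opprK.
exists (ln r +i* t)%C; rewrite /complex_exp lnK ?posrE// ct st /c /s.
by rewrite ![r * _]mulrC !divfK ?gt_eqF//; case: (z).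
Qed.

End Exponential.

(** * The mean value property *)

Section MeanValue.
Variable R : realType.
Local Notation C := (Cplx R).
Implicit Types (f : C -> C) (z w : C).

Lemma antiderivatives (u : R -> R -> C) (K : R) : (forall x, continuous (u x)) ->
  exists P : R -> R -> C, forall x t, `|t| < K -> rderive (P x) t (u x t).
Proof.
move=> cu; suff /choice[P PP] : forall x, exists P : R -> C,
    forall t, `|t| < K -> rderive P t (u x t) by exists P.
move=> x.
have [|P1 H1] := @continuous_antiderivative R (fun t => complex.Re (u x t)) (- K) K.
  by move=> t; apply: continuous_comp; [exact: cu|exact: Re_continuous].
have [|P2 H2] := @continuous_antiderivative R (fun t => complex.Im (u x t)) (- K) K.
  by move=> t; apply: continuous_comp; [exact: cu|exact: Im_continuous].
exists (fun t => (P1 t +i* P2 t)%C) => t; rewrite ltr_norml => tK.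
by split; [exact: H1|exact: H2].
Qed.

(** By periodicity the horizontal sides of a rectangle of height T contribute
    equally to the integral, hence so do the vertical ones. On a vertical side
    the real part of the mean is a value of Re g. *)
Lemma periodic_strip_mean (g : C -> C) (T : R) : 0 < T -> continuous g ->
  (forall z, complex.Re z <= 0 -> differentiable g z) ->
  (forall x : R, g (x +i* T)%C = g (x +i* 0)%C) ->
  exists y1, forall x : R, x <= 0 -> exists y,
    complex.Re (g (x +i* y)%C) = complex.Re (g ((0 : R) +i* y1)%C).
Proof.
move=> T0 cg dg per.
have cv x : continuous (fun y => g (x +i* y)%C).
  move=> y; apply: (@continuous_comp _ _ _ (fun y => (x +i* y)%C : C) g); last exact: cg.
  by apply: complex_continuous; [exact: cst_continuous|exact: cvg_id].
have ch y : continuous (fun x => g (x +i* y)%C).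
  move=> x; apply: (@continuous_comp _ _ _ (fun x => (x +i* y)%C : C) g); last exact: cg.
  by apply: complex_continuous; [exact: cvg_id|exact: cst_continuous].
have [VP VPd] := antiderivatives (T + 1) cv.
have Vmean x : exists y, complex.Re (VP x T - VP x 0) = complex.Re (g (x +i* y)%C) * T.
  have [|y _] := @rderive_mean R (VP x) (fun y => g (x +i* y)%C) 0 T (ltW T0).
    move=> y /andP[y0 yT]; apply: VPd.
    by rewrite ger0_norm// (le_lt_trans yT)// ltrDl.
  by rewrite subr0 => ->; exists y.
have [y1 Hy1] := Vmean 0; exists y1 => x x0.
have [HP HPd] := antiderivatives (- x + 1) ch.
have E : contour HP VP x (x + (- x)) 0 (0 + T) = 0.
  have := @goursat _ g HP VP _ _ HPd VPd x (- x) 0 T; apply.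
  - by rewrite oppr_ge0.
  - exact: ltW.
  - lra.
  - lra.
  - lra.
  - lra.
  - by move=> s t /andP[_ sx] _; apply: dg => /=; rewrite subrr in sx.
move: E; rewrite subrr add0r /contour.
have -> : HP T 0 - HP T x = HP 0 0 - HP 0 x.
  apply/eqP; rewrite -subr_eq0 -nrm_eq0 eq_le nrm_ge0 andbT.
  have -> : HP T 0 - HP T x - (HP 0 0 - HP 0 x) = HP T 0 - HP 0 0 - (HP T x - HP 0 x) by ring.
  apply: (le_trans (@rderive_bound R (fun s => HP T s - HP 0 s) (fun=> 0) 0 x 0 x0 _ _)).
  - move=> s /andP[xs s0].
    have sK : `|s| < - x + 1 by rewrite ler0_norm//; lra.
    have [r1 i1] := HPd T _ sK; have [r2 i2] := HPd 0 _ sK.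
    rewrite per in r1 i1; split.
      under eq_fun do rewrite raddfB /=.
      by apply: is_derive_eq; rewrite subrr.
    under eq_fun do rewrite raddfB /=.
    by apply: is_derive_eq; rewrite subrr.
  - by move=> s _; rewrite nrm0.
  - by rewrite mulr0 mul0r.
move=> E; have V : VP x T - VP x 0 = VP 0 T - VP 0 0.
  apply/esym/eqP; rewrite -subr_eq0; apply/eqP.
  have i0 : 'i%C != 0 :> C by rewrite -nrm_gt0 nrm_i ltr01.
  apply: (mulfI i0); rewrite mulr0 -E; ring.
have [y Hy] := Vmean x; exists y; apply: (mulIf (lt0r_neq0 T0)).
by rewrite -Hy V Hy1.
Qed.

(** After the substitution z + r exp(zeta) the mean over circles becomes an
    integral over segments of length 2 pi on vertical lines; it does not depend
    on the line, and the centre is reached in the limit by continuity. *)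
Lemma mean_value f z (r rho : R) : 0 < r -> r < rho ->
  (forall w, nrm w < rho -> {for z + w, continuous f}) ->
  (forall w, 0 < nrm w -> nrm w < rho -> differentiable f (z + w)) ->
  exists2 w, nrm w = r & complex.Re (f (z + w)) = complex.Re (f z).
Proof.
move=> r0 rrho cf df.
have [s s0 rs] : exists2 s : R, 0 < s & r * expR s < rho.
  have l0 : 0 < ln (rho / r) by apply: ln_gt0; rewrite ltr_pdivlMr// mul1r.
  exists (ln (rho / r) / 2); first by rewrite divr_gt0.
  rewrite mulrC -ltr_pdivlMr// -[ltRHS]lnK ?posrE ?divr_gt0 ?(lt_trans r0 rrho)//.
  by rewrite ltr_expR ltr_pdivrMr// ltr_pMr// ltr1n.
pose cl (t : C) : C := (Num.min (complex.Re t) s +i* complex.Im t)%C.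
pose g t := f (z + (r%:C)%C * complex_exp (cl t)).
have ns t : nrm ((r%:C)%C * complex_exp (cl t)) < rho.
  rewrite nrmM nrm_real gtr0_norm// nrm_exp (le_lt_trans _ rs)// ler_pM2l//.
  by rewrite ler_expR /= ge_min lexx orbT.
have dexp (t : C) : is_derive t (1 : C) (fun t => z + (r%:C)%C * complex_exp t : C)
    ((r%:C)%C * complex_exp t).
  have := @is_derive_exp R t => ?; apply: is_derive_eq.
  by rewrite add0r.
have ccl : continuous cl.
  move=> t; apply: (@complex_continuous R C (fun t : C => Num.min (complex.Re t) s)
    (fun t : C => complex.Im t)); last exact: Im_continuous.
  apply: (@continuous_min _ _ (@complex.Re R : C -> R) (cst s)).
    exact: Re_continuous.
  exact: cst_continuous.
have cg : continuous g.
  move=> t; apply: (@continuous_comp _ _ _ cl (fun u => f (z + (r%:C)%C * complex_exp u))).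
    exact: ccl.
  apply: (@continuous_comp _ _ _ (fun u : C => z + (r%:C)%C * complex_exp u : C) f).
    exact: is_derive_cts (dexp _).
  exact: cf (ns _).
have dg (t : C) : complex.Re t <= 0 -> differentiable g t.
  move=> t0; have ts : complex.Re t < s by exact: le_lt_trans s0.
  have clt : cl t = t by rewrite /cl min_l ?ltW//; case: (t).
  apply: (@near_eq_differentiable _ _ _ (f \o (fun u : C => z + (r%:C)%C * complex_exp u : C))).
    apply/nbhs_nrmP; exists (s - complex.Re t); first by rewrite subr_gt0.
    move=> w wt; rewrite /g (_ : cl w = w)// /cl min_l; first by case: (w).
    have := le_lt_trans (Re_le_nrm _) wt; rewrite raddfB /= => /(le_lt_trans (ler_norm _)).
    by rewrite ltrD2r => /ltW.
  apply: differentiable_comp; first exact: is_derive_differentiable (dexp t).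
  apply: df; last by rewrite -clt; exact: ns.
  by rewrite nrmM nrm_real gtr0_norm// mulr_gt0// nrm_exp expR_gt0.
have pi20 : 0 < 2 * pi :> R by rewrite mulr_gt0// pi_gt0.
have [|y1 H] := periodic_strip_mean pi20 cg dg.
  move=> x; rewrite /g /cl /=; congr (f (z + _ * _)); rewrite /complex_exp.
  by rewrite mulr_natl cos2pi sin2pi cos0 sin0.
exists ((r%:C)%C * complex_exp ((0 : R) +i* y1)%C).
  by rewrite nrmM nrm_real gtr0_norm// nrm_exp /= expR0 mulr1.
have -> : f (z + (r%:C)%C * complex_exp ((0 : R) +i* y1)%C) = g ((0 : R) +i* y1)%C.
  by rewrite /g /cl /= min_l// ltW.
set q := g _; apply/eqP; rewrite -subr_eq0 -normr_le0; apply/ler_addgt0Pr => e e0.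
rewrite add0r.
have /cts_nrmP/(_ _ e0)[d d0 dP] : {for z, continuous f}.
  by have := cf 0; rewrite addr0; apply; rewrite nrm0 (lt_trans r0).
pose x := Num.min 0 (ln (d / r) - 1).
have [y <-] : exists y, complex.Re (g (x +i* y)%C) = complex.Re q.
  by apply: H; rewrite ge_min lexx.
rewrite -raddfB (le_trans (Re_le_nrm _))// ltW//; apply: dP.
rewrite addrAC subrr add0r nrmM nrm_real gtr0_norm// nrm_exp /= mulrC -ltr_pdivlMr//.
rewrite -[ltRHS]lnK ?posrE ?divr_gt0// ltr_expR gt_min; apply/orP; left.
rewrite gt_min; apply/orP; right; lra.
Qed.

End MeanValue.

(** * The maximum modulus principle and Schwarz's lemma *)

Section MaximumModulus.
Variable R : realType.
Local Notation C := (Cplx R).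
Implicit Types (f : C -> C) (z w : C).

Lemma closed_disc_compact (r : R) : compact [set z : C | nrm z <= r].
Proof.
apply: (@subclosed_compact _ _ ((fun p : R * R => (p.1 +i* p.2)%C : C) @` (`[- r, r] `*` `[- r, r]))).
- apply: (@closed_comp _ _ (@nrm R) [set x | x <= r]); last exact: closed_le.
  by move=> z _; exact: nrm_continuous.
- apply: continuous_compact; last by apply: compact_setX; exact: segment_compact.
  apply: continuous_subspaceT => p.
  by apply: complex_continuous; [exact: cvg_fst|exact: cvg_snd].
- move=> [a b] /= zr; exists (a, b) => //=; rewrite !in_itv /=.
  by split; rewrite -ler_norml; apply: le_trans zr;
    [exact: (Re_le_nrm (a +i* b)%C)|exact: (Im_le_nrm (a +i* b)%C)].
Qed.

(** Difference quotients have this regularity at their centre. *)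
Definition removable_at f z := {for z, continuous f} /\
  exists2 d : R, 0 < d & forall w, 0 < nrm w -> nrm w < d -> differentiable f (z + w).

(** At an interior maximum of |f|^2 + e |z|^2 the mean value property of a
    suitable linear expression in f and z gives a nearby larger value. *)
Lemma maximum_modulus f (r m : R) : 0 < r ->
  (forall z, nrm z <= r -> removable_at f z) ->
  (forall z, nrm z = r -> nrm (f z) <= m) ->
  forall z, nrm z <= r -> nrm (f z) <= m.
Proof.
move=> r0 rf fm z0 z0r; rewrite leNgt; apply/negP => mf.
have m0 : 0 <= m.
  by apply: (le_trans (nrm_ge0 (f (r%:C)%C))); apply: fm; rewrite nrm_real gtr0_norm.
have r20 : 0 < r ^+ 2 by rewrite exprn_gt0.
have fz0 : m ^+ 2 < nrm (f z0) ^+ 2 by rewrite ltrXn2r ?nrm_ge0.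
pose e := (nrm (f z0) ^+ 2 - m ^+ 2) / (2 * r ^+ 2).
have e0 : 0 < e by rewrite divr_gt0 ?subr_gt0// mulr_gt0.
have er : e * r ^+ 2 = (nrm (f z0) ^+ 2 - m ^+ 2) / 2.
  by rewrite /e; field; rewrite lt0r_neq0.
pose N z := nrm (f z) ^+ 2 + e * nrm z ^+ 2.
have cN : {within [set z : C | nrm z <= r], continuous N}.
  apply: continuous_in_subspaceT => z; rewrite inE /= => /rf[cf _].
  have cnf : {for z, continuous (fun w => nrm (f w))}.
    by apply: (@continuous_comp _ _ _ f (@nrm R)) => //; exact: nrm_continuous.
  have cn := @nrm_continuous R z.
  exact: (continuousD (continuousM cnf cnf)
    (continuousM (@cst_continuous _ _ e z) (continuousM cn cn))).
have ne : [set z : C | nrm z <= r] !=set0 by exists z0.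
have [z1 + maxN] := compact_EVT_max ne (@closed_disc_compact r) cN.
rewrite inE /= => z1r.
have N01 : N z0 <= N z1 by apply: maxN; rewrite inE.
have f0N : nrm (f z0) ^+ 2 <= N z0 by rewrite lerDl mulr_ge0 ?exprn_ge0 ?nrm_ge0 ?(ltW e0).
move: z1r; rewrite le_eqVlt => /orP[/eqP z1r|z1r].
  have : nrm (f z1) ^+ 2 <= m ^+ 2 by rewrite lerXn2r ?nnegrE ?nrm_ge0// fm.
  by move: N01 f0N; rewrite /N z1r er; lra.
have [c1 [d d0 df]] := rf z1 (ltW z1r).
pose rho := Num.min d (r - nrm z1).
have rho0 : 0 < rho by rewrite /rho lt_min d0 subr_gt0.
have [rd rr] : rho <= d /\ rho <= r - nrm z1 by rewrite /rho !ge_min !lexx orbT.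
pose c := f z1.
pose K (z : C) : C := (c^*)%C * f z + (e%:C)%C * (z1^*)%C * (z - z1).
have dK z : differentiable f z -> differentiable K z.
  move=> fz; have dc (u : C) : differentiable (cst u : C -> C) z := differentiable_cst u z.
  have di : differentiable (@id C) z by exact: ex_diff.
  exact: (differentiableD (differentiableM (dc (c^*)%C) fz)
    (differentiableM (dc ((e%:C)%C * (z1^*)%C)) (differentiableB di (dc z1)))).
have cK : {for z1, continuous K}.
  have ci : {for z1, continuous (@id C)} by exact: cvg_id.
  exact: (continuousD (continuousM (@cst_continuous _ _ ((c^*)%C : C) z1) c1)
    (continuousM (@cst_continuous _ _ ((e%:C)%C * (z1^*)%C : C) z1)
      (continuousB ci (@cst_continuous _ _ z1 z1)))).
have rho2 : 0 < rho / 2 by rewrite divr_gt0.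
have [|w|w w0 wr|w wrho] := @mean_value R K z1 (rho / 2) rho rho2.
- by rewrite ltr_pdivrMr// ltr_pMr// ltr1n.
- have [->|w0] := eqVneq w 0; first by rewrite addr0.
  by move=> wr; apply/differentiable_continuous/dK/df; rewrite ?nrm_gt0// (lt_le_trans wr).
- by apply/dK/df => //; rewrite (lt_le_trans wr).
have z1w : nrm (z1 + w) <= r.
  by apply: (le_trans (nrmD _ _)); rewrite wrho; lra.
have := maxN (z1 + w); rewrite inE => /(_ z1w).
have w2 : nrm w ^+ 2 = (rho / 2) ^+ 2 by rewrite wrho.
have rho22 : 0 < e * (rho / 2) ^+ 2 by rewrite mulr_gt0// exprn_gt0.
rewrite /N !nrm2E /K -/c; move: w2; rewrite nrm2E; move: rho22; set rho2' := (_ / _) ^+ 2.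
case: (f (z1 + w)) => u v; case: (c) => p q; case: (z1) => a b; case: (w) => s t /=.
move=> rho22 w2 H1 H2.
have H3 := sqr_ge0 (u - p); have H4 := sqr_ge0 (v - q).
have : e * (s ^+ 2 + t ^+ 2) = e * rho2' by rewrite w2.
nra.
Qed.

Definition slope_at f w b z : C := if z == w then b else (f z - f w) / (z - w).

Lemma slope_removable f (r : R) w b : (forall z, nrm z < r -> differentiable f z) ->
  nrm w < r -> is_derive w (1 : C) f b ->
  forall z, nrm z < r -> removable_at (slope_at f w b) z.
Proof.
move=> df wr fb z zr.
have ds y : nrm y < r -> y != w -> differentiable (slope_at f w b) y.
  move=> yr yw; have yw0 : y - w != 0 by rewrite subr_eq0.
  apply: (@near_eq_differentiable _ _ _ (fun t => (f t - f w) * (t - w)^-1)).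
    apply/nbhs_nrmP; exists (nrm (y - w)); first by rewrite nrm_gt0.
    move=> t ty; rewrite /slope_at; case: eqP => // tw; move: ty.
    by rewrite tw nrmB ltxx.
  apply: differentiableM; first by apply: differentiableB => //; exact: df.
  by apply: differentiableV => //; apply: differentiableB.
have near_in y : nrm y < r -> forall t, nrm t < r - nrm y -> nrm (y + t) < r.
  by move=> yr t tr; rewrite (le_lt_trans (nrmD _ _))// -ltrBrDl.
have [zw|zw] := eqVneq z w; last first.
  split; first exact/differentiable_continuous/ds.
  have zw0 : z - w != 0 by rewrite subr_eq0.
  exists (Num.min (r - nrm z) (nrm (z - w))).
    by rewrite lt_min subr_gt0 zr nrm_gt0.
  move=> t t0; rewrite lt_min => /andP[tr tzw]; apply: ds; first exact: near_in.
  apply/eqP => ztw; move: tzw; rewrite -ztw opprD addrA subrr sub0r nrmN ltxx //.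
rewrite {z zr}zw; split.
  apply/cts_nrmP => e e0; have e2 : 0 < e / 2 by rewrite divr_gt0.
  have [d d0 H] := (is_derive_nrmP f w b).1 fb _ e2.
  exists d => // y yd; rewrite {2}/slope_at eqxx /slope_at.
  have [_|yw] := eqVneq y w; first by rewrite subrr nrm0.
  have yw0 : y - w != 0 by rewrite subr_eq0.
  have n0 : 0 < nrm (y - w) by rewrite nrm_gt0.
  have := H _ yd; rewrite [w + _]addrC subrK => Hd.
  have -> : (f y - f w) / (y - w) - b = (f y - f w - b * (y - w)) / (y - w) by field.
  rewrite nrmM nrmV ltr_pdivrMr// (le_lt_trans Hd)// ltr_pM2r//.
  by rewrite ltr_pdivrMr// ltr_pMr// ltr1n.
exists (r - nrm w); first by rewrite subr_gt0.
move=> t t0 tr; apply: ds; first exact: near_in.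
by rewrite -subr_eq0 addrAC subrr add0r -nrm_gt0.
Qed.

(** The maximum principle for f z / z on the circles of radius rho < r. *)
Lemma slope_bound f (r M : R) a :
  (forall z, nrm z < r -> differentiable f z) ->
  (forall z, nrm z < r -> nrm (f z) <= M) -> f 0 = 0 ->
  is_derive (0 : C) (1 : C) f a ->
  forall z, nrm z < r -> nrm (slope_at f 0 a z) * r <= M.
Proof.
move=> df fM f0 fa z zr.
have r0 : 0 < r := le_lt_trans (nrm_ge0 z) zr.
have H (rho : R) : 0 < rho -> rho < r -> nrm z <= rho -> nrm (slope_at f 0 a z) * rho <= M.
  move=> rho0 rhor zrho; rewrite -ler_pdivlMr//.
  apply: (@maximum_modulus _ rho) => //.
    move=> y yr; apply: (slope_removable df) => //; first by rewrite nrm0.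
    exact: le_lt_trans rhor.
  move=> y yr; rewrite /slope_at f0 !subr0.
  have /negbTE -> : y != 0 by rewrite -nrm_gt0 yr.
  by rewrite nrmM nrmV yr ler_pM2r ?invr_gt0// fM// yr.
rewrite leNgt; apply/negP => MQ; pose Q := nrm (slope_at f 0 a z).
have M0 : 0 <= M by apply: (le_trans (nrm_ge0 (f z))); exact: fM.
have Q0 : 0 < Q.
  rewrite lt_neqAle nrm_ge0 andbT; apply/eqP => Q0; move: MQ.
  by rewrite -/Q -Q0 mul0r ltNge M0.
have MQr : M / Q < r by rewrite ltr_pdivrMr// mulrC.
pose rho := (Num.max (nrm z) (M / Q) + r) / 2.
have [rz rM rr] : [/\ nrm z < rho, M / Q < rho & rho < r].
  have [m1 m2 m3] : [/\ nrm z <= Num.max (nrm z) (M / Q), M / Q <= Num.max (nrm z) (M / Q)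
      & Num.max (nrm z) (M / Q) < r].
    by rewrite !le_max !lexx orbT gt_max zr.
  by rewrite /rho; split; lra.
have := H rho (le_lt_trans (nrm_ge0 z) rz) rr (ltW rz).
by rewrite leNgt -/Q mulrC -ltr_pdivrMr// rM.
Qed.

Lemma schwarz f (r M : R) :
  (forall z, nrm z < r -> differentiable f z) ->
  (forall z, nrm z < r -> nrm (f z) <= M) -> f 0 = 0 ->
  forall z, nrm z < r -> nrm (f z) <= M * nrm z / r.
Proof.
move=> df fM f0 z zr; have r0 : 0 < r := le_lt_trans (nrm_ge0 z) zr.
have [->|z0] := eqVneq z 0; first by rewrite f0 nrm0 mulr0 mul0r.
have fa : is_derive (0 : C) (1 : C) f ('D_1 f 0).
  by apply: differentiable_is_derive; apply: df; rewrite nrm0.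
have := slope_bound df fM f0 fa zr; rewrite /slope_at (negbTE z0) f0 !subr0.
rewrite nrmM nrmV ler_pdivlMr// mulrAC ler_pdivrMr ?nrm_gt0//.
Qed.

(** The factor 2 is due to the subtraction of the value at the centre. *)
Lemma cauchy_estimate f z (r M : R) a : 0 < r ->
  (forall w, nrm w < r -> differentiable f (z + w)) ->
  (forall w, nrm w < r -> nrm (f (z + w)) <= M) ->
  is_derive z (1 : C) f a -> nrm a <= 2 * M / r.
Proof.
move=> r0 df fM fa; pose g w := f (z + w) - f z.
have dz w : is_derive w (1 : C) (fun w => z + w : C) 1.
  by apply: is_derive_eq; rewrite add0r.
have dg w b : is_derive (z + w) (1 : C) f b -> is_derive w (1 : C) g b.
  move=> fb; have := is_derive_chain (dz w) fb; rewrite mulr1 => fzb.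
  by apply: is_derive_eq; rewrite subr0.
have n0 : nrm (0 : C) < r by rewrite nrm0.
have H : nrm (slope_at g 0 a 0) * r <= 2 * M.
  apply: slope_bound.
  - move=> w wr; apply: is_derive_differentiable; apply: dg.
    by apply: differentiable_is_derive; exact: df.
  - move=> w wr; rewrite /g (le_trans (nrmD _ _))// nrmN mulr_natl mulr2n.
    by apply: lerD; [exact: fM|rewrite -[z]addr0; exact: fM].
  - by rewrite /g addr0 subrr.
  - by apply: dg; rewrite addr0.
  - exact: n0.
by move: H; rewrite /slope_at eqxx ler_pdivlMr.
Qed.

(** The difference of the difference quotients at w and at 0 is bounded on the
    circle of radius r/2 by a multiple of |w|, hence also at 0. *)
Lemma second_order_bound f (r M : R) a w :
  (forall z, nrm z < r -> differentiable f z) ->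
  (forall z, nrm z < r -> nrm (f z) <= M) -> f 0 = 0 ->
  is_derive (0 : C) (1 : C) f a ->
  nrm w <= r / 4 -> nrm (f w - a * w) <= 12 * M / r ^+ 2 * nrm w ^+ 2.
Proof.
move=> df fM f0 fa wr4.
have [->|w0] := eqVneq w 0; first by rewrite f0 mulr0 subrr nrm0 expr0n mulr0.
have nw0 : 0 < nrm w by rewrite nrm_gt0.
have r0 : 0 < r by lra.
have wr : nrm w < r by lra.
have M0 : 0 <= M by apply: (le_trans (nrm_ge0 (f w))); exact: fM.
have fb := differentiable_is_derive (df w wr).
set b := 'D_1 f w in fb.
pose q z := slope_at f w b z - slope_at f 0 a z.
have n00 : nrm (0 : C) < r by rewrite nrm0.
have rq z : nrm z <= r / 2 -> removable_at q z.
  move=> zr2; have zr : nrm z < r by lra.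
  have [c1 [d1 d10 D1]] := slope_removable df wr fb zr.
  have [c2 [d2 d20 D2]] := slope_removable df n00 fa zr.
  split; first exact: (@cvgB _ _ _ _ _ _ _ _ _ c1 c2).
  exists (Num.min d1 d2); first by rewrite lt_min d10.
  move=> y y0; rewrite lt_min => /andP[y1 y2].
  by apply: differentiableB; [exact: D1|exact: D2].
have bq z : nrm z = r / 2 -> nrm (q z) <= 12 * M / r ^+ 2 * nrm w.
  move=> zr2; have z0 : z != 0 by rewrite -nrm_gt0 zr2 divr_gt0.
  have zw : r / 4 <= nrm (z - w) by apply: le_trans (nrm_dist _ _); lra.
  have zw0 : z - w != 0 by rewrite -nrm_gt0; lra.
  have zr : nrm z < r by lra.
  rewrite /q /slope_at (negbTE z0) -[z == w]subr_eq0 (negbTE zw0) f0 !subr0.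
  have -> : (f z - f w) / (z - w) - f z / z = (w * f z - z * f w) / (z * (z - w)).
    by field; rewrite z0 zw0.
  rewrite nrmM nrmV nrmM zr2 ler_pdivrMr; last by rewrite mulr_gt0 ?divr_gt0//; lra.
  apply: (@le_trans _ _ (3 / 2 * M * nrm w)).
    apply: (le_trans (nrmD _ _)); rewrite nrmN !nrmM zr2.
    have h1 := ler_wpM2l (nrm_ge0 w) (fM _ zr).
    have h2 : r / 2 * nrm (f w) <= r / 2 * (M * nrm w / r).
      by rewrite ler_wpM2l ?divr_ge0 ?(ltW r0)//; exact: schwarz.
    have e : r / 2 * (M * nrm w / r) = M * nrm w / 2 by field; exact: lt0r_neq0.
    by move: h1 h2; rewrite e; lra.
  have -> : 3 / 2 * M * nrm w = 12 * M / r ^+ 2 * nrm w * (r / 2 * (r / 4)).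
    by field; exact: lt0r_neq0.
  rewrite ler_wpM2l//.
    by apply: mulr_ge0 (nrm_ge0 _); apply: divr_ge0; [exact: mulr_ge0|exact/ltW/exprn_gt0].
  by rewrite ler_wpM2l// divr_ge0// ltW.
have r20 : 0 < r / 2 by rewrite divr_gt0.
have := @maximum_modulus q (r / 2) (12 * M / r ^+ 2 * nrm w) r20 rq bq 0.
rewrite nrm0 => /(_ (ltW r20)).
rewrite /q /slope_at eqxx eq_sym (negbTE w0) f0 !sub0r => H.
have -> : f w - a * w = (- f w / - w - a) * w by field.
by rewrite nrmM expr2 mulrA ler_pM2r.
Qed.

End MaximumModulus.

(** * Holomorphic automorphisms of the disc *)

Section DiscAutomorphisms.
Variable R : realType.
Local Notation C := (Cplx R).
Implicit Types (f g h : C -> C) (z w a c : C).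

Lemma rderive_line f z (h : C) (s : R) a : is_derive (z + (s%:C)%C * h) (1 : C) f a ->
  rderive (fun t : R => f (z + (t%:C)%C * h)) s (a * h).
Proof.
move=> /is_derive_nrmP H.
have key (e : R) : 0 < e -> exists2 d : R, 0 < d & forall k : R, `|k| < d ->
    nrm (f (z + ((s + k)%:C)%C * h) - f (z + (s%:C)%C * h) - a * h * (k%:C)%C) <= e * `|k|.
  move=> e0; have n0 : 0 < nrm h + 1 by rewrite ltr_wpDl ?nrm_ge0.
  have [d d0 dP] := H _ (divr_gt0 e0 n0).
  exists (d / (nrm h + 1)); first by rewrite divr_gt0.
  move=> k kd; pose y := (k%:C)%C * h : C.
  have yE : nrm y = `|k| * nrm h by rewrite nrmM nrm_real.
  have yk : nrm y <= `|k| * (nrm h + 1) by rewrite yE ler_wpM2l// lerDl.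
  have yd : nrm y < d by rewrite (le_lt_trans yk)// -ltr_pdivlMr.
  have := dP _ yd; rewrite /y -[z + _ + _]addrA -mulrDl -rmorphD => /le_trans Hd.
  rewrite -mulrA [h * _]mulrC; apply: Hd; rewrite -/y mulrAC ler_pdivrMr//.
  by rewrite -mulrA ler_pM2l.
by split; apply/is_derive_absP => e /key[d d0 dP]; exists d => // k /dP;
  apply: le_trans; [apply: le_trans (Re_le_nrm _)|apply: le_trans (Im_le_nrm _)];
  rewrite !raddfB /=; case: (a * h) => u v; simpc.
Qed.

Lemma zero_derivative_segment f z (h : C) :
  (forall s : R, 0 <= s <= 1 -> is_derive (z + (s%:C)%C * h) (1 : C) f 0) ->
  f (z + h) = f z.
Proof.
move=> H; apply/eqP; rewrite -subr_eq0 -nrm_eq0 eq_le nrm_ge0 andbT.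
have := @rderive_bound R (fun t : R => f (z + (t%:C)%C * h)) (fun=> 0) 0 0 1 ler01.
rewrite mul1r mul0r addr0 mulr0 mul0r; apply=> [s s01|s _]; last by rewrite nrm0.
by rewrite -(mul0r h); apply/rderive_line/H.
Qed.

Lemma zero_derivative_ball f z w (r : R) :
  (forall y, nrm (y - z) < r -> is_derive y (1 : C) f 0) ->
  nrm (w - z) < r -> f w = f z.
Proof.
move=> H wr; rewrite -[w](subrK z) addrC; apply: zero_derivative_segment => s /andP[s0 s1].
apply: H; rewrite addrAC subrr add0r nrmM nrm_real ger0_norm// (le_lt_trans _ wr)//.
by rewrite ler_piMl ?nrm_ge0.
Qed.

Definition blaschke a z : C := (z + a) / (1 + (a^*)%C * z).

Lemma nrm_mul_lt1 z w : nrm z < 1 -> nrm w < 1 -> nrm (z * w) < 1.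
Proof.
move=> z1 w1; rewrite nrmM; apply: le_lt_trans z1.
by rewrite ler_piMr ?nrm_ge0// ltW.
Qed.

Lemma blaschke_denom a z : nrm a < 1 -> nrm z < 1 -> 1 + (a^*)%C * z != 0.
Proof.
move=> a1 z1; rewrite -nrm_gt0 -[_ * z]opprK; apply: lt_le_trans (nrm_dist _ _).
by rewrite nrm1 nrmN subr_gt0 nrm_mul_lt1// nrm_conj.
Qed.

Lemma blaschke_lt1 a z : nrm a < 1 -> nrm z < 1 -> nrm (blaschke a z) < 1.
Proof.
move=> a1 z1; have d0 := blaschke_denom a1 z1.
rewrite nrmM nrmV ltr_pdivrMr ?nrm_gt0// mul1r -(@ltr_pXn2r _ 2%N) ?nnegrE ?nrm_ge0//.
have a2 : nrm a ^+ 2 < 1 by rewrite exprn_ilt1 ?nrm_ge0.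
have z2 : nrm z ^+ 2 < 1 by rewrite exprn_ilt1 ?nrm_ge0.
move: a2 z2; rewrite !nrm2E; case: (a) => p q; case: (z) => u v /=.
by move=> a2 z2; nra.
Qed.

Lemma conjcN a : ((- a)^*)%C = - (a^*)%C.
Proof. exact: rmorphN. Qed.

Lemma blaschkeK a z : nrm a < 1 -> nrm z < 1 -> blaschke (- a) (blaschke a z) = z.
Proof.
move=> a1 z1; have d0 := blaschke_denom a1 z1.
have b1 := blaschke_lt1 a1 z1.
have e0 : 1 + ((- a)^*)%C * blaschke a z != 0 by rewrite blaschke_denom// nrmN.
have f0 : 1 - (a^*)%C * a != 0.
  rewrite -nrm_gt0 (lt_le_trans _ (nrm_dist _ _))// nrm1 subr_gt0 nrm_mul_lt1//.
  by rewrite nrm_conj.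
move: e0; rewrite /blaschke conjcN => e0.
field; apply/andP; split; first exact: d0.
apply: contraNneq f0 => <-; apply/eqP; ring.
Qed.

Lemma blaschke_differentiable a z : nrm a < 1 -> nrm z < 1 ->
  differentiable (blaschke a) z.
Proof.
move=> a1 z1; have d0 := blaschke_denom a1 z1.
have dc (u : C) : differentiable (cst u : C -> C) z := differentiable_cst u z.
have di : differentiable (@id C) z by exact: ex_diff.
exact: (differentiableM (differentiableD di (dc a))
  (differentiableV (differentiableD (dc 1) (differentiableM (dc (a^*)%C) di)) d0)).
Qed.

(** Mutually inverse holomorphic bijections of the disc are pairs g, h with
    disc_bijection g h and disc_bijection h g. *)
Definition disc_bijection g h := forall z, nrm z < 1 ->
  [/\ differentiable g z, nrm (g z) < 1 & h (g z) = z].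

(** Schwarz's lemma for g and for its inverse gives |g z| = |z|. The conjugate of
    q z = g z / z is therefore the inverse of q, so that q has derivative 0; it
    is constant on rays, with value the derivative of g at 0. *)
Lemma disc_automorphism_fix0 g h : disc_bijection g h -> disc_bijection h g -> g 0 = 0 ->
  exists2 c, nrm c = 1 & forall z, nrm z < 1 -> g z = c * z.
Proof.
move=> gP hP g0; have n0 : nrm (0 : C) < 1 by rewrite nrm0 ltr01.
have h0 : h 0 = 0 by rewrite -{1}g0; have [] := gP 0 n0.
have le_of k k' (kP : disc_bijection k k') : k 0 = 0 -> forall z, nrm z < 1 -> nrm (k z) <= nrm z.
  move=> k0 z z1; rewrite -[leRHS]mul1r -[leRHS]divr1.
  by apply: schwarz => // y y1; have [? ? _] := kP y y1 => //; exact: ltW.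
have ng z : nrm z < 1 -> nrm (g z) = nrm z.
  move=> z1; apply/eqP; rewrite eq_le (le_of _ _ gP)//=.
  have [_ gz1 gzK] := gP z z1; rewrite -[X in nrm X <= _]gzK.
  exact: (le_of _ _ hP).
have gn z : nrm z < 1 -> z != 0 -> g z != 0.
  by move=> z1 z0; rewrite -nrm_gt0 ng// nrm_gt0.
pose c := 'D_1 g 0.
have gc : is_derive (0 : C) (1 : C) g c.
  by apply: differentiable_is_derive; have [] := gP 0 n0.
pose q z := g z / z.
have dq z : nrm z < 1 -> z != 0 -> is_derive z (1 : C) q 0.
  move=> z1 z0; have [dg _ _] := gP z z1.
  have di : differentiable (@id C) z by exact: ex_diff.
  have dq : differentiable q z := differentiableM dg (differentiableV di z0).
  have dq' : differentiable (fun z => (q z)^-1) z.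
    by apply: differentiableV => //; rewrite mulf_neq0 ?invr_eq0// gn.
  rewrite -[0](_ : 'D_1 q z = 0); first exact: differentiable_is_derive.
  apply: (is_derive_conj_eq0 _ (differentiable_is_derive dq) (differentiable_is_derive dq')).
  apply/nbhs_nrmP; exists (Num.min (1 - nrm z) (nrm z)).
    by rewrite lt_min subr_gt0 z1 nrm_gt0.
  move=> y; rewrite lt_min => /andP[y1 yz].
  have y0 : y != 0 by apply: contraTneq yz => ->; rewrite sub0r nrmN ltxx.
  have y1' : nrm y < 1 by rewrite -(subrK z y) (le_lt_trans (nrmD _ _))// -ltrBrDr.
  have qy : q y != 0 by rewrite mulf_neq0 ?invr_eq0// gn.
  apply: (mulfI qy); rewrite divff// mulcJ_nrm nrmM nrmV ng// divff ?expr1n//.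
  by rewrite nrm_eq0.
have qc z : nrm z < 1 -> z != 0 -> q z = c.
  move=> z1 z0; apply/eqP; rewrite -subr_eq0; apply/eqP/(@nrm_small_eq0 _ _ 1) => e e0.
  have [d d0 dP] := (is_derive_nrmP _ _ _).1 gc _ e0.
  pose s := Num.min 1 (d / 2).
  have [s0 s1 sd] : [/\ 0 < s, s <= 1 & s < d].
    rewrite /s; split; first by rewrite lt_min ltr01 divr_gt0.
      by rewrite ge_min lexx.
    by rewrite gt_min; apply/orP; right; rewrite ltr_pdivrMr// ltr_pMr// ltr1n.
  have n (t : R) : 0 <= t <= 1 -> nrm ((t%:C)%C * z) < 1.
    move=> /andP[t0 t1]; rewrite nrmM nrm_real ger0_norm//.
    by apply: le_lt_trans z1; rewrite ler_piMl ?nrm_ge0.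
  have qs : q z = q ((s%:C)%C * z).
    have -> : q z = q ((s%:C)%C * z + (1 - (s%:C)%C) * z).
      by congr q; ring.
    apply: zero_derivative_segment => t /andP[t0 t1].
    have -> : (s%:C)%C * z + (t%:C)%C * ((1 - (s%:C)%C) * z) = ((s + t * (1 - s))%:C)%C * z.
      by rewrite rmorphD rmorphM rmorphB rmorph1; ring.
    have p0 : 0 < s + t * (1 - s) by rewrite ltr_pwDl// mulr_ge0// subr_ge0.
    apply: dq.
      apply: n; rewrite (ltW p0)/=; nra.
    by rewrite mulf_neq0// -nrm_gt0 nrm_real gtr0_norm.
  have sz0 : (s%:C)%C * z != 0 :> C by rewrite mulf_neq0// -nrm_gt0 nrm_real gtr0_norm.
  have szd : nrm ((s%:C)%C * z) < d.
    rewrite nrmM nrm_real gtr0_norm//; apply: le_lt_trans sd.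
    by rewrite ler_piMr// ltW.
  have := dP _ szd; rewrite add0r g0 subr0.
  have -> : g ((s%:C)%C * z) - c * ((s%:C)%C * z) = (q z - c) * ((s%:C)%C * z).
    by rewrite qs /q mulrBl divfK.
  by rewrite nrmM ler_pM2r ?nrm_gt0// mul1r.
exists c.
  have h2 : ((2^-1 : R)%:C)%C != 0 :> C.
    by rewrite -nrm_gt0 nrm_real gtr0_norm ?invr_gt0.
  have h1 : nrm ((2^-1 : R)%:C)%C < 1.
    by rewrite nrm_real gtr0_norm ?invr_gt0// invf_lt1// ltr1n.
  by rewrite -(qc _ h1 h2) nrmM nrmV ng// divff// nrm_eq0.
move=> z z1; have [->|z0] := eqVneq z 0; first by rewrite g0 mulr0.
by rewrite -(qc z)// divfK.
Qed.

(** The Blaschke factor that maps 0 to the zero a of g reduces to the case where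
    0 is fixed. *)
Lemma disc_automorphism g h : disc_bijection g h -> disc_bijection h g ->
  exists a c, [/\ nrm a < 1, nrm c = 1 &
    forall z, nrm z < 1 -> g z * (1 - (a^*)%C * z) = c * (z - a)].
Proof.
move=> gP hP; have n0 : nrm (0 : C) < 1 by rewrite nrm0 ltr01.
pose a := h 0; have [_ a1 ga] := hP 0 n0; rewrite -/a in a1 ga.
have na1 : nrm (- a) < 1 by rewrite nrmN.
have [|||c c1 H] := @disc_automorphism_fix0 (g \o blaschke a) (blaschke (- a) \o h).
- move=> z z1; have b1 := blaschke_lt1 a1 z1; have [dg gb1 gbK] := gP _ b1; split.
  + by apply: differentiable_comp; [exact: blaschke_differentiable|exact: dg].
  + exact: gb1.
  + by rewrite /comp gbK; exact: blaschkeK.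
- move=> z z1; have [dh hz1 hzK] := hP _ z1; split.
  + by apply: differentiable_comp; [exact: dh|exact: blaschke_differentiable].
  + exact: blaschke_lt1.
  + by have := blaschkeK na1 hz1; rewrite opprK /comp => ->.
- by rewrite /= /blaschke add0r mulr0 addr0 divr1.
exists a, c; split=> // z z1; have d0 := blaschke_denom na1 z1.
rewrite conjcN mulNr in d0.
have := H _ (blaschke_lt1 na1 z1); have := blaschkeK na1 z1; rewrite opprK /= => -> ->.
by rewrite /blaschke conjcN mulNr -mulrA divfK.
Qed.

(** The parameters of the Moebius transformation G t are recovered from the
    values at 0 and at plus or minus 1/2: the conjugate of a is a quotient of
    values, c is then a polynomial in it, and both a and the conjugate of c are
    obtained by division.  So a and c are holomorphic together with their
    conjugates. *)
Lemma disc_automorphism_family_constant (G H : C -> C -> C) z0 (r : R) :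
  (forall t, nrm (t - z0) < r -> disc_bijection (G t) (H t) /\ disc_bijection (H t) (G t)) ->
  (forall t w, nrm (t - z0) < r -> nrm w < 1 -> differentiable (G ^~ w) t) ->
  forall t w, nrm (t - z0) < r -> nrm w < 1 -> G t w = G z0 w.
Proof.
move=> GH dG.
have /choice[ac acP] : forall t, exists ac : C * C, nrm (t - z0) < r ->
    [/\ nrm ac.1 < 1, nrm ac.2 = 1 & forall z, nrm z < 1 ->
      G t z * (1 - (ac.1^*)%C * z) = ac.2 * (z - ac.1)].
  move=> t; have [tr|tr] := pselect (nrm (t - z0) < r); last by exists (0, 0).
  have [GHt HGt] := GH t tr; have [a [c acP]] := disc_automorphism GHt HGt.
  by exists (a, c).
have in_r t : nrm (t - z0) < r -> \forall s \near t, nrm (s - z0) < r.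
  move=> tr; apply: open_nbhs_nbhs; split=> //; exact: open_nrm_lt.
pose u : C := ((2^-1 : R)%:C)%C.
have u0 : u != 0 by rewrite -nrm_gt0 nrm_real gtr0_norm ?invr_gt0.
have uE : 2 * u = 1 by rewrite /u fmorphV rmorph_nat divff// pnatr_eq0.
have u1 : nrm u < 1 by rewrite nrm_real gtr0_norm ?invr_gt0// invf_lt1// ltr1n.
have nu1 : nrm (- u) < 1 by rewrite nrmN.
have n0 : nrm (0 : C) < 1 by rewrite nrm0 ltr01.
have Gne t : nrm (t - z0) < r -> G t u - G t (- u) != 0.
  move=> tr; have [GHt _] := GH t tr; rewrite subr_eq0; apply/eqP => E.
  have [_ _ E1] := GHt _ u1; have [_ _ E2] := GHt _ nu1.
  have : u = - u by rewrite -{1}E1 E E2.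
  move=> /eqP; rewrite -subr_eq0 opprK -mulr2n -mulr_natl uE => /eqP.
  by apply/eqP; exact: oner_neq0.
pose b t := (2 * (G t u - G t 0) + 2 * (G t (- u) - G t 0)) / (G t u - G t (- u)).
have bE t : nrm (t - z0) < r -> b t = ((ac t).1^*)%C.
  move=> tr; have [_ _ E] := acP t tr.
  apply: (mulIf (Gne t tr)); rewrite divfK ?Gne//.
  have E0 := E _ n0; have E1 := E _ u1; have E2 := E _ nu1.
  move: E0 E1 E2; rewrite mulr0 subr0 mulr1 sub0r.
  set A := (_^*)%C; set p := G t 0; set q := G t u; set s := G t (- u).
  set a := (ac t).1; set c := (ac t).2 => E0 E1 E2.
  have F1 : q - p = u * (c + A * q).
    transitivity (q * (1 - A * u) + u * (A * q) - p); first ring.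
    by rewrite E1 E0; ring.
  have F2 : s - p = - u * (c + A * s).
    transitivity (s * (1 - A * - u) - u * (A * s) - p); first ring.
    by rewrite E2 E0; ring.
  rewrite F1 F2; transitivity (2 * u * (A * (q - s))); first ring.
  by rewrite uE mul1r.
pose c t := 2 * (G t u - G t 0) - b t * G t u.
have cE t : nrm (t - z0) < r -> c t = (ac t).2.
  move=> tr; have [_ _ E] := acP t tr; rewrite /c bE//.
  have E0 := E _ n0; have E1 := E _ u1; move: E0 E1; rewrite mulr0 subr0 mulr1 sub0r.
  set A := (_^*)%C; set p := G t 0; set q := G t u.
  set a := (ac t).1; set k := (ac t).2 => E0 E1.
  have F1 : q - p = u * (k + A * q).
    transitivity (q * (1 - A * u) + u * (A * q) - p); first ring.
    by rewrite E1 E0; ring.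
  rewrite F1; transitivity (2 * u * (k + A * q) - A * q); first ring.
  by rewrite uE mul1r addrK.
have c_neq0 t : nrm (t - z0) < r -> c t != 0.
  by move=> tr; have [_ n1 _] := acP t tr; rewrite -nrm_gt0 cE// n1.
have dcst (y t : C) : differentiable (cst y : C -> C) t := differentiable_cst y t.
have db t : nrm (t - z0) < r -> differentiable b t.
  move=> tr; have d0 := dG _ _ tr n0; have d1 := dG _ _ tr u1; have d2 := dG _ _ tr nu1.
  exact: (differentiableM (differentiableD (differentiableM (dcst 2 t) (differentiableB d1 d0))
    (differentiableM (dcst 2 t) (differentiableB d2 d0)))
    (differentiableV (differentiableB d1 d2) (Gne _ tr))).
have dc t : nrm (t - z0) < r -> differentiable c t.
  move=> tr; have d0 := dG _ _ tr n0; have d1 := dG _ _ tr u1.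
  exact: (differentiableB (differentiableM (dcst 2 t) (differentiableB d1 d0))
    (differentiableM (db _ tr) d1)).
have c_der0 t : nrm (t - z0) < r -> is_derive t (1 : C) c 0.
  move=> tr; have dcV := differentiableV (dc t tr) (c_neq0 t tr).
  rewrite -[0](_ : 'D_1 c t = 0); first exact: differentiable_is_derive (dc t tr).
  apply: (is_derive_conj_eq0 _ (differentiable_is_derive (dc t tr)) (differentiable_is_derive dcV)).
  apply: filterS (in_r _ tr) => s sr; apply: (mulfI (c_neq0 _ sr)).
  rewrite divff ?c_neq0// mulcJ_nrm cE//.
  by have [_ -> _] := acP s sr; rewrite expr1n.
pose a t := - (G t 0) / c t.
have aE t : nrm (t - z0) < r -> a t = (ac t).1.
  move=> tr; have [_ _ E] := acP t tr; have := E _ n0.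
  rewrite mulr0 subr0 mulr1 sub0r /a => ->; rewrite cE// mulrN opprK mulrAC divff ?mul1r//.
  by rewrite -cE// c_neq0.
have da t : nrm (t - z0) < r -> differentiable a t.
  move=> tr; have d0 := dG _ _ tr n0.
  exact: (differentiableM (differentiableN d0) (differentiableV (dc _ tr) (c_neq0 _ tr))).
have a_der0 t : nrm (t - z0) < r -> is_derive t (1 : C) a 0.
  move=> tr; rewrite -[0](_ : 'D_1 a t = 0); first exact: differentiable_is_derive (da t tr).
  apply: (is_derive_conj_eq0 _ (differentiable_is_derive (da t tr))
    (differentiable_is_derive (db t tr))).
  by apply: filterS (in_r _ tr) => s sr; rewrite bE// aE.
move=> t w tr w1.
have z0r : nrm (z0 - z0) < r by rewrite subrr nrm0 (le_lt_trans (nrm_ge0 _) tr).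
have ct := zero_derivative_ball c_der0 tr; have at_ := zero_derivative_ball a_der0 tr.
have [a1 _ Et] := acP t tr; have [_ _ E0] := acP z0 z0r.
have := Et w w1; have := E0 w w1; rewrite -!aE// -!cE// ct at_.
rewrite -aE// at_ in a1.
have na1 : nrm (- a z0) < 1 by rewrite nrmN.
have := blaschke_denom na1 w1; rewrite conjcN mulNr => d0.
by move=> <- /(mulIf d0).
Qed.

End DiscAutomorphisms.

(** * Sections of flat disc bundles over the complex line *)

Section FlatDiscBundle.
Variable R : realType.
Local Notation C := (Cplx R).
(** E t is the fibre over t of a bundle on the complex line with total space T,
    and (Phi i, Psi i) is a trivialisation over B i with fibre the unit disc. *)
Variables (T I : Type) (E : C -> set T) (B : I -> set C).
Variables (Phi : I -> T -> C) (Psi : I -> C -> C -> T) (o : C -> T).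

Hypothesis B_open : forall i, open (B i).
Hypothesis B_cover : forall t, exists i, B i t.
Hypothesis PhiP : forall i t v, B i t -> E t v -> nrm (Phi i v) < 1 /\ Psi i t (Phi i v) = v.
Hypothesis PsiP : forall i t w, B i t -> nrm w < 1 -> E t (Psi i t w) /\ Phi i (Psi i t w) = w.
Hypothesis trans_fiber : forall i j t w, B i t -> B j t -> nrm w < 1 ->
  differentiable (fun w => Phi j (Psi i t w)) w.
Hypothesis trans_base : forall i j t w, B i t -> B j t -> nrm w < 1 ->
  differentiable (fun t => Phi j (Psi i t w)) t.

Lemma trans_disc_bijection i j t : B i t -> B j t ->
  disc_bijection (fun w => Phi j (Psi i t w)) (fun w => Phi i (Psi j t w)).
Proof.
move=> it jt z z1; have [Ez Pz] := PsiP it z1; have [P1 PK] := PhiP jt Ez.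
by split=> //; [exact: trans_fiber|rewrite PK].
Qed.

(** The bundle is flat, since families of automorphisms of the disc are
    constant. *)
Lemma trans_constant i j t s w (r : R) :
  (forall u, nrm (u - t) < r -> B i u /\ B j u) -> nrm (s - t) < r -> nrm w < 1 ->
  Phi j (Psi i s w) = Phi j (Psi i t w).
Proof.
move=> ijB sr w1.
apply: (@disc_automorphism_family_constant R (fun t w => Phi j (Psi i t w))
  (fun t w => Phi i (Psi j t w)) t r) => // [u ur|u y ur y1].
  by have [iu ju] := ijB u ur; split; exact: trans_disc_bijection.
by have [iu ju] := ijB u ur; exact: trans_base.
Qed.

(** d is a Lebesgue number of the cover; the chart c 0 is prescribed so that
    transport to 0 ends in the same chart for all r. *)
Lemma lebesgue_choice (r : R) i0 : B i0 0 -> exists2 d : R, 0 < d &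
  exists2 c : C -> I, c 0 = i0 &
    forall t s, nrm t <= r -> nrm (s - t) < d -> B (c t) s.
Proof.
move=> i00.
have [d1 d10 H1] : exists2 d : R, 0 < d &
    forall t, nrm t <= r -> exists i, forall s, nrm (s - t) < d -> B i s.
  have /compact_near_coveringP/(_ R 0^'+
      (fun d t => exists i, forall s, nrm (s - t) < d -> B i s) _) := @closed_disc_compact R r.
  case=> [t _|d /= d0 H].
    have [i it] := B_cover t.
    have /nbhs_nrmP[e e0 eB] : nbhs t (B i) by apply: open_nbhs_nbhs.
    have e2 : 0 < e / 2 by rewrite divr_gt0.
    exists ([set t' | nrm (t' - t) < e / 2], [set d | d < e / 2]).
      by split; [exact: near_nrm|exact: nbhs_right_lt].
    move=> [t' d] /= [tt' de]; exists i => s st'; apply: eB.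
    rewrite -(subrKA t') (le_lt_trans (nrmD _ _))// [e]splitr ltrD//.
    exact: lt_trans de.
  exists (d / 2); first by rewrite divr_gt0.
  apply: H; last by rewrite divr_gt0.
  by rewrite /= sub0r normrN gtr0_norm ?divr_gt0// ltr_pdivrMr// ltr_pMr// ltr1n.
have /nbhs_nrmP[d2 d20 H2] : nbhs (0 : C) (B i0) by apply: open_nbhs_nbhs.
have /choice[c cP] : forall t, exists i, nrm t <= r ->
    forall s, nrm (s - t) < d1 -> B i s.
  move=> t; have [tr|tr] := pselect (nrm t <= r); last by exists i0.
  by have [i iP] := H1 t tr; exists i.
exists (Num.min d1 d2); first by rewrite lt_min d10.
exists (fun t => if t == 0 then i0 else c t); first by rewrite eqxx.
move=> t s tr; rewrite lt_min => /andP[s1 s2].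
by case: eqP s2 => [-> s2|_ _]; [exact: H2|exact: cP].
Qed.

Section Transport.
Variables (r d : R) (c : C -> I).
Hypothesis d0 : 0 < d.
Hypothesis cP : forall t s, nrm t <= r -> nrm (s - t) < d -> B (c t) s.

Let G (a b w : C) : C := Phi (c b) (Psi (c a) a w).
Let close (a b : C) := [/\ nrm a <= r, nrm b <= r & nrm (a - b) < d / 2].

Let close_refl a : nrm a <= r -> close a a.
Proof. by move=> ar; split; rewrite // subrr nrm0 divr_gt0. Qed.

Let closeB a b : close a b -> B (c a) a /\ B (c b) a.
Proof.
by move=> [ar br ab]; split; apply: cP => //; [rewrite subrr nrm0|move: ab d0; lra].
Qed.

Let G_disc a b w : close a b -> nrm w < 1 -> nrm (G a b w) < 1.
Proof.
by move=> /closeB[aa ba] w1; have [] := trans_disc_bijection aa ba w1.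
Qed.

Let G_differentiable a b w : close a b -> nrm w < 1 -> differentiable (G a b) w.
Proof. by move=> /closeB[aa ba] w1; exact: trans_fiber. Qed.

Let G_const a b s w : close a b -> nrm (s - a) < d / 2 -> nrm w < 1 ->
  Phi (c b) (Psi (c a) s w) = G a b w.
Proof.
move=> [ar br ab] sa w1; apply: (@trans_constant _ _ a s w (d / 2)) => // u ua.
split; apply: cP => //; first by move: ua d0; lra.
by rewrite -(subrKA a) (le_lt_trans (nrmD _ _))// [d]splitr ltrD.
Qed.

Let G_refl a w : nrm a <= r -> nrm w < 1 -> G a a w = w.
Proof. by move=> /close_refl/closeB[aa _] w1; have [_] := PsiP aa w1. Qed.

Let G_cocycle x y z w : close x y -> close y z -> close x z -> nrm w < 1 ->
  G y z (G x y w) = G x z w.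
Proof.
move=> xy yz xz w1; have [xx yx] := closeB xy; have [_ _ nxy] := xy.
rewrite -(@G_const y z x)//; last exact: G_disc.
have [Ew _] := PsiP xx w1; have [_ PK] := PhiP yx Ew.
by rewrite /G PK.
Qed.

Variable n : nat.
Hypothesis r0 : 0 <= r.
Hypothesis nP : r / n.+1%:R < d / 8.

Let pt (t : C) (k : nat) : C := ((k%:R / n.+1%:R : R)%:C)%C * t.

(** Parallel transport from pt t k to 0 along the points pt t m, m <= k. *)
Fixpoint transport (t : C) (k : nat) (w : C) : C :=
  if k is m.+1 then transport t m (G (pt t m.+1) (pt t m) w) else w.

Let pt_le t k : (k <= n.+1)%N -> nrm (pt t k) <= nrm t.
Proof.
move=> kn; rewrite nrmM nrm_real ger0_norm; last by rewrite divr_ge0.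
by rewrite ler_piMl ?nrm_ge0// ler_pdivrMr// mul1r ler_nat.
Qed.

Let pt_near t s k : (k <= n.+1)%N -> nrm (pt t k - pt s k) <= nrm (t - s).
Proof.
move=> kn; rewrite -mulrBr; exact: pt_le.
Qed.

Let pt_step t k : nrm t <= r -> nrm (pt t k.+1 - pt t k) < d / 8.
Proof.
move=> tr; rewrite -mulrBl -rmorphB -mulrBl -natrB// subSn// subnn.
rewrite nrmM nrm_real ger0_norm ?divr_ge0//; apply: le_lt_trans nP.
by rewrite mulrC mulrA mulr1 ler_pM2r// invr_gt0.
Qed.

Let close_step t s k l : nrm t <= r -> nrm s <= r -> nrm (t - s) < d / 8 ->
  (k <= n.+1)%N -> (l <= n.+1)%N -> (k <= l.+1)%N -> (l <= k.+1)%N ->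
  close (pt t k) (pt s l).
Proof.
move=> tr sr ts kn ln kl lk.
split; [exact: le_trans (pt_le _ _) tr|exact: le_trans (pt_le _ _) sr|].
have kk := pt_near t s kn.
have kl' : nrm (pt s k - pt s l) < d / 8.
  have [->|] := eqVneq k l; first by rewrite subrr nrm0 divr_gt0.
  rewrite neq_ltn => /orP[kl1|lk1].
    by rewrite nrmB (_ : l = k.+1)//; [exact: pt_step|apply/eqP; rewrite eqn_leq lk].
  by rewrite (_ : k = l.+1)//; [exact: pt_step|apply/eqP; rewrite eqn_leq kl].
rewrite -(subrKA (pt s k)) (le_lt_trans (nrmD _ _))//.
by move: kk kl' ts d0; lra.
Qed.

Let tt_lt (t : C) : nrm (t - t) < d / 8.
Proof. by rewrite subrr nrm0 divr_gt0. Qed.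

Let close_self t k : nrm t <= r -> (k < n.+1)%N -> close (pt t k.+1) (pt t k).
Proof. by move=> tr kn; apply: close_step; rewrite ?tt_lt//; exact: ltnW. Qed.

Lemma transport_disc t k w : nrm t <= r -> (k <= n.+1)%N -> nrm w < 1 ->
  nrm (transport t k w) < 1 /\ differentiable (transport t k) w.
Proof.
move=> tr; elim: k w => [|k IH] w kn w1; first by split; [exact: w1|exact: ex_diff].
have cl := close_self tr kn.
have [IH1 IH2] := IH _ (ltnW kn) (G_disc cl w1); split; first exact: IH1.
apply: (@differentiable_comp _ _ _ _ (G (pt t k.+1) (pt t k)) (transport t k)).
  exact: G_differentiable.
exact: IH2.
Qed.

(** Corresponding and consecutive points of the two lines lie in common charts,
    so that the cocycle relation moves the comparison along the lines. *)
Lemma transport_near t s k w : nrm t <= r -> nrm s <= r -> nrm (t - s) < d / 8 ->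
  (k <= n.+1)%N -> nrm w < 1 ->
  transport t k w = transport s k (G (pt t k) (pt s k) w).
Proof.
move=> tr sr ts; elim: k w => [|k IH] w kn w1.
  by rewrite /= /pt !mul0r G_refl// nrm0.
have cl := close_self tr kn.
rewrite /= IH ?(ltnW kn)//; last exact: G_disc.
by congr transport; rewrite !G_cocycle//; apply: close_step; rewrite ?tt_lt//; exact: ltnW.
Qed.

Lemma transport0 k w : (k <= n.+1)%N -> nrm w < 1 -> transport 0 k w = w.
Proof.
elim: k w => [//|k IH] w kn w1 /=.
by rewrite /pt !mulr0 G_refl ?nrm0// IH// ltnW.
Qed.

Lemma pt_last t : pt t n.+1 = t.
Proof. by rewrite /pt divff ?pnatr_eq0// rmorph1 mul1r. Qed.

End Transport.

Hypothesis o_in : forall t, E t (o t).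
Hypothesis o_differentiable : forall i t, B i t -> differentiable (fun t => Phi i (o t)) t.

(** Transport to 0 turns the section o into a holomorphic function on the disc
    of radius r with values in the unit disc, equal to Phi i (o t) near 0. By
    Cauchy's estimate its derivative at 0 is at most 2 / r, for all r. *)
Theorem flat_section_derivative_eq0 i : B i 0 ->
  is_derive (0 : C) (1 : C) (fun t => Phi i (o t)) 0.
Proof.
move=> i0; pose f (t : C) : C := Phi i (o t).
have [a Da] : exists a, is_derive (0 : C) (1 : C) f a.
  by eexists; apply: differentiable_is_derive; exact: o_differentiable.
suff a0 : a = 0 by rewrite a0 in Da.
have bound (r : R) : 0 < r -> nrm a <= 2 * 1 / r.
  move=> r0; have [d d0 [c c0 cP]] := lebesgue_choice r i0.
  have d8 : 0 < d / 8 by rewrite divr_gt0.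
  have [n nP] : exists n : nat, r / n.+1%:R < d / 8.
    exists (Num.bound (r / (d / 8))); rewrite ltr_pdivrMr// mulrC -ltr_pdivrMr//.
    have := archi_boundP (divr_ge0 (ltW r0) (ltW d8)) => /lt_trans; apply.
    by rewrite ltr_nat.
  pose tr := transport c n.
  pose tau t := tr t n.+1 (Phi (c t) (o t)).
  have cc t : nrm t <= r -> B (c t) t by move=> tr'; apply: cP => //; rewrite subrr nrm0.
  have o1 t : nrm t <= r -> nrm (Phi (c t) (o t)) < 1.
    by move=> /cc ct; have [] := PhiP ct (o_in t).
  have near_tau t s : nrm t <= r -> nrm s <= r -> nrm (s - t) < d / 8 ->
      tau s = tr t n.+1 (Phi (c t) (o s)).
    move=> tr' sr st; rewrite /tau /tr.
    rewrite (transport_near d0 cP (ltW r0) nP sr tr' st (leqnn _) (o1 _ sr)) !pt_last.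
    by have [_ ->] := PhiP (cc s sr) (o_in s).
  have dtau t : nrm t < r -> differentiable tau t.
    move=> t_r; have t_le := ltW t_r.
    apply: (@near_eq_differentiable _ _ _ (tr t n.+1 \o (fun s => Phi (c t) (o s)))).
      apply/nbhs_nrmP; exists (Num.min (d / 8) (r - nrm t)); first by rewrite lt_min d8 subr_gt0.
      move=> s; rewrite lt_min => /andP[sd sr]; rewrite (near_tau t)//.
      by rewrite -(subrK t s) (le_trans (nrmD _ _))// -lerBrDr ltW.
    apply: differentiable_comp; first exact/o_differentiable/cc.
    by have [] := transport_disc d0 cP nP t_le (leqnn _) (o1 _ t_le).
  apply: (@cauchy_estimate _ tau 0 r 1 a r0).
  - by move=> w wr; rewrite add0r; exact: dtau.
  - move=> w wr; rewrite add0r ltW//.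
    by have [] := transport_disc d0 cP nP (ltW wr) (leqnn _) (o1 _ (ltW wr)).
  - apply: near_eq_is_derive Da; apply/nbhs_nrmP.
    exists (Num.min (d / 8) r); first by rewrite lt_min d8.
    move=> s; rewrite subr0 lt_min => /andP[sd sr].
    have n0 : nrm (0 : C) <= r by rewrite nrm0 ltW.
    have B0 : B i s.
      by rewrite -c0; apply: cP; rewrite // subr0; move: sd d0; lra.
    rewrite (near_tau 0) ?subr0 ?(ltW sr)// c0 /tr (transport0 d0 cP (ltW r0))//.
    by have [] := PhiP B0 (o_in s).
apply: (@nrm_small_eq0 _ _ 1) => e e0; rewrite mul1r.
have := bound (2 / e) (divr_gt0 (ltr0n _ 2) e0).
by rewrite invf_div mulrC mulr1 divfK// pnatr_eq0.
Qed.

End FlatDiscBundle.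

(** * Holomorphic dependence of derivatives on parameters *)

Section VectorNorm.
Variable R : realType.
Local Notation C := (Cplx R).
Variable V : normedModType C.
Implicit Types (x y h : V).

Definition vnrm x : R := complex.Re `|x|.

Lemma vnrmE x : `|x| = ((vnrm x)%:C)%C :> C.
Proof. by rewrite /vnrm RRe_real// ger0_real. Qed.

Lemma vnrm_ge0 x : 0 <= vnrm x.
Proof. by rewrite -ler0c -vnrmE normr_ge0. Qed.

Lemma vnrmZ (a : C) x : vnrm (a *: x) = nrm a * vnrm x.
Proof. by apply: complexI; have := normrZ a x; rewrite !vnrmE nrmE -rmorphM. Qed.

Lemma vnrm0 : vnrm 0 = 0.
Proof. by rewrite /vnrm normr0. Qed.

Lemma vnrm_eq0 x : (vnrm x == 0) = (x == 0).
Proof.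
by rewrite -[RHS]normr_eq0 vnrmE -[X in _ = (_ == X)](rmorph0 (real_complex R))
  (inj_eq (@complexI R)).
Qed.

Lemma nbhs_vnrmP x (A : set V) :
  nbhs x A <-> exists2 d : R, 0 < d & forall y, vnrm (y - x) < d -> A y.
Proof.
split=> [/nbhs_ballP[e /= /gt0_complexP[d d0 ->] eA]|[d d0 dA]].
  exists d => // w wx; apply: eA; rewrite -ball_normE /ball_ /=.
  by rewrite -normrN opprB vnrmE ltcR.
apply/nbhs_ballP; exists (d%:C)%C; first by rewrite /= ltcR.
move=> w; rewrite -ball_normE /ball_ /= -normrN opprB vnrmE ltcR; exact: dA.
Qed.

Lemma line_differentiable (g : V -> C) x h (t : C) : differentiable g (x + t *: h) ->
  differentiable (fun s : C => g (x + s *: h)) t.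
Proof.
move=> dg; apply: (@differentiable_comp _ _ _ _ (fun s : C => x + s *: h) g); last exact: dg.
have d1 : differentiable (fun s : C => s *: h) t by exact: ex_diff.
exact: (differentiableD (differentiable_cst x t) d1).
Qed.

Lemma line_is_derive (g : V -> C) x h : differentiable g x ->
  is_derive (0 : C) (1 : C) (fun s : C => g (x + s *: h)) ('d g x h).
Proof.
move=> dg; have /derivable1P dl := @diff_derivable _ _ _ g x h dg.
have e : (fun s : C => g (x + s *: h)) = (fun s : C => g (s *: h + x)).
  by apply/funext => s; rewrite addrC.
rewrite e; apply: DeriveDef; first exact: dl.
transitivity ('D_h g x); last exact: deriveE.
pose l (s : C) : C := g (s *: h + x).
pose u (s : C) : C := s^-1 *: ((l \o shift 0) (s *: (1 : C)) - l 0).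
pose v (s : C) : C := s^-1 *: ((g \o shift x) (s *: h) - g x).
have uv : u = v.
  by apply/funext => s; rewrite /u /v /l /= addr0 scale0r add0r [_%:A]mulr1.
by change (lim (u @ 0^') = lim (v @ 0^')); rewrite uv.
Qed.

(** Recognises a pointwise limit of differentials as a differential. *)
Lemma differentiable_of_bound (g l : V -> C) x (K d : R) : 0 < d -> linear l ->
  (forall h, nrm (l h) <= K * vnrm h) ->
  (forall h, vnrm h <= d -> nrm (g (x + h) - g x - l h) <= K * vnrm h ^+ 2) ->
  differentiable g x.
Proof.
move=> d0 lin lK gl.
pose lM := GRing.isLinear.Build _ _ _ _ _ lin.
pose L : {linear V -> C} := HB.pack l lM.
have K1 : 0 < `|K| + 1 by rewrite ltr_wpDl.
have KK (y : R) : 0 <= y -> K * y <= (`|K| + 1) * y.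
  by move=> y0; rewrite ler_wpM2r// (le_trans (ler_norm _))// lerDl.
have cL : continuous L.
  move=> y A /nbhs_nrmP[e e0 eA]; apply/nbhs_vnrmP.
  exists (e / (`|K| + 1)); first by rewrite divr_gt0.
  move=> z zy; apply: eA; rewrite -raddfB /= (le_lt_trans (lK _))//.
  by rewrite (le_lt_trans (KK _ (vnrm_ge0 _)))// mulrC -ltr_pdivlMr.
have dec : g \o shift x = cst (g x) + L +o_ 0 id.
  apply/eqaddoP => e /gt0_complexP[e' e0 ->].
  apply/nbhs_vnrmP; exists (Num.min d (e' / (`|K| + 1))).
    by rewrite lt_min d0 divr_gt0.
  move=> h; rewrite subr0 lt_min => /andP[hd he].
  rewrite -[X in `|X|]/(g (h + x) - (g x + l h)) nrmE vnrmE -rmorphM lecR.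
  rewrite opprD addrA [h + x]addrC (le_trans (gl _ (ltW hd)))// expr2 mulrA.
  rewrite ler_wpM2r ?vnrm_ge0// (le_trans (KK _ (vnrm_ge0 _)))//.
  by rewrite mulrC -ler_pdivlMr// ltW.
have dE : 'd g x = L :> (V -> C) by apply/diff_unique.
by apply/diff_locallyP; rewrite dE.
Qed.

End VectorNorm.

Section FiberDerivative.
Variable R : realType.
Local Notation C := (Cplx R).

(** In each component the numbers u i - e i lie below the numbers u j + e j, so
    that the supremum of the former is a limit. *)
Lemma cauchy_family (I : Type) (i0 : I) (s : I -> C) (e : I -> R) :
  (forall i j, nrm (s i - s j) <= e i + e j) ->
  exists y : C, forall i, nrm (y - s i) <= 2 * e i.
Proof.
move=> H.
have real_family (u : I -> R) : (forall i j, `|u i - u j| <= e i + e j) ->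
    exists y : R, forall i, `|y - u i| <= e i.
  move=> Hu; have ub j : ubound (range (fun i => u i - e i)) (u j + e j).
    by move=> _ [i _ <-]; have := Hu i j; rewrite ler_norml => /andP[_]; lra.
  exists (sup (range (fun i => u i - e i))) => i; rewrite ler_norml; apply/andP; split.
    rewrite lerBrDr addrC; apply: ub_le_sup; last by exists i.
    by exists (u i + e i); exact: ub.
  rewrite lerBlDr addrC; apply: ge_sup; last exact: ub.
  by exists (u i0 - e i0), i0.
have [|x Hx] := real_family (fun i => complex.Re (s i)).
  by move=> i j; rewrite -raddfB (le_trans (Re_le_nrm _)).
have [|y Hy] := real_family (fun i => complex.Im (s i)).
  by move=> i j; rewrite -raddfB (le_trans (Im_le_nrm _)).
exists (x +i* y)%C => i; apply: (le_trans (nrm_le_ReIm _)).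
by rewrite mulr_natl mulr2n !raddfB /= lerD.
Qed.

Variable V : normedModType C.

(** On the complex line through x in the direction h the radius is rho / |h|. *)
Lemma line_cauchy_estimate (g : V -> C) x h (rho M : R) : 0 < rho ->
  (forall y, vnrm (y - x) < rho -> differentiable g y) ->
  (forall y, vnrm (y - x) < rho -> nrm (g y) <= M) ->
  nrm ('d g x h) <= 2 * M / rho * vnrm h.
Proof.
move=> rho0 dg gM.
have dgx : differentiable g x by apply: dg; rewrite subrr vnrm0.
have [->|h0] := eqVneq h 0; first by rewrite linear0 nrm0 vnrm0 mulr0.
have hn0 : 0 < vnrm h by rewrite lt_neqAle vnrm_ge0 andbT eq_sym vnrm_eq0.
have in_ball (t : C) : nrm t < rho / vnrm h -> vnrm (x + t *: h - x) < rho.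
  by move=> tr; rewrite addrAC subrr add0r vnrmZ -ltr_pdivlMr.
have := @cauchy_estimate _ (fun s : C => g (x + s *: h)) 0 (rho / vnrm h) M
  ('d g x h) (divr_gt0 rho0 hn0).
rewrite invf_div mulrA mulrAC; apply.
- by move=> t tr; rewrite add0r; apply/line_differentiable/dg/in_ball.
- by move=> t tr; rewrite add0r; apply/gM/in_ball.
- exact: line_is_derive.
Qed.

Lemma line_second_order (g : V -> C) x h (rho M : R) : 0 < rho ->
  (forall y, vnrm (y - x) < rho -> differentiable g y) ->
  (forall y, vnrm (y - x) < rho -> nrm (g y) <= M) ->
  vnrm h <= rho / 4 ->
  nrm (g (x + h) - g x - 'd g x h) <= 24 * M / rho ^+ 2 * vnrm h ^+ 2.
Proof.
move=> rho0 dg gM hr.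
have dgx : differentiable g x by apply: dg; rewrite subrr vnrm0.
have [->|h0] := eqVneq h 0.
  by rewrite addr0 linear0 subrr subr0 nrm0 vnrm0 expr0n mulr0.
have hn0 : 0 < vnrm h by rewrite lt_neqAle vnrm_ge0 andbT eq_sym vnrm_eq0.
have in_ball (t : C) : nrm t < rho / vnrm h -> vnrm (x + t *: h - x) < rho.
  by move=> tr; rewrite addrAC subrr add0r vnrmZ -ltr_pdivlMr.
have gx : nrm (g x) <= M by apply: gM; rewrite subrr vnrm0.
have := @second_order_bound _ (fun s : C => g (x + s *: h) - g x) (rho / vnrm h) (2 * M)
  ('d g x h) 1.
rewrite scale1r mulr1 nrm1 expr1n mulr1.
have -> : 12 * (2 * M) / (rho / vnrm h) ^+ 2 = 24 * M / rho ^+ 2 * vnrm h ^+ 2.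
  by field; rewrite !lt0r_neq0.
apply.
- move=> t tr; have d1 := line_differentiable (dg _ (in_ball t tr)).
  exact: (differentiableB d1 (differentiable_cst (g x) t)).
- move=> t tr; rewrite (le_trans (nrmD _ _))// nrmN mulr_natl mulr2n lerD//.
  exact/gM/in_ball.
- by rewrite scale0r addr0 subrr.
- have d1 := line_is_derive h dgx.
  by apply: is_derive_eq; exact: subr0.
- by rewrite mulrAC ler_pdivlMr// mul1r.
Qed.

(** The derivative in the fibre direction is the uniform limit of the
    difference quotients in w, whose differentials in x converge by Cauchy's
    estimate. *)
Theorem fiber_derivative_differentiable (F : V -> C -> C) x0 (w0 : C) (M r rho : R) :
  0 < r -> 0 < rho ->
  (forall x w, vnrm (x - x0) < rho -> nrm (w - w0) < r ->
    [/\ differentiable (F x) w, differentiable (F ^~ w) x & nrm (F x w) <= M]) ->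
  differentiable (fun x => 'D_1 (F x) w0) x0.
Proof.
move=> r0 rho0 H.
have r40 : 0 < r / 4 by rewrite divr_gt0.
have w00 : nrm (w0 - w0) < r by rewrite subrr nrm0.
have x00 : vnrm (x0 - x0) < rho by rewrite subrr vnrm0.
have M0 : 0 <= M by have [_ _ hM] := H _ _ x00 w00; exact: le_trans (nrm_ge0 _) hM.
pose k n : C := ((r / 4 / n.+1%:R)%:C)%C.
have kE n : nrm (k n) = r / 4 / n.+1%:R by rewrite nrm_real gtr0_norm// divr_gt0.
have k0 n : k n != 0 by rewrite -nrm_gt0 kE divr_gt0.
have kr n : nrm (k n) <= r / 4.
  by rewrite kE ler_pdivrMr// ler_peMr ?(ltW r40)// ler1n.
have kr' n : nrm (w0 + k n - w0) < r.
  rewrite addrAC subrr add0r (le_lt_trans (kr n))// ltr_pdivrMr// ltr_pMr// ltr1n//.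
have k_small (e : R) : 0 < e -> exists n, nrm (k n) < e.
  move=> e0; exists (Num.bound (r / 4 / e)); rewrite kE ltr_pdivrMr// [ltRHS]mulrC -ltr_pdivrMr//.
  by have := archi_boundP (divr_ge0 (ltW r40) (ltW e0)) => /lt_trans; apply; rewrite ltr_nat.
pose D x := 'D_1 (F x) w0.
pose Q n x := (F x (w0 + k n) - F x w0) * (k n)^-1.
have dsh (t : C) : is_derive t (1 : C) (fun t => w0 + t : C) 1.
  by apply: is_derive_eq; rewrite add0r.
have dF0 x t : vnrm (x - x0) < rho -> nrm t < r ->
    differentiable (fun t => F x (w0 + t) - F x w0) t.
  move=> xr tr; have [|d1 _ _] := H x (w0 + t) xr; first by rewrite addrAC subrr add0r.
  have d2 : differentiable (fun t => F x (w0 + t)) t.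
    apply: (@differentiable_comp _ _ _ _ (fun t : C => w0 + t : C) (F x)); last exact: d1.
    exact: is_derive_differentiable (dsh t).
  exact: (differentiableB d2 (differentiable_cst (F x w0) t)).
have dFD x : vnrm (x - x0) < rho ->
    is_derive (0 : C) (1 : C) (fun t => F x (w0 + t) - F x w0) (D x).
  move=> xr; have [d1 _ _] := H x w0 xr w00.
  have d2 : is_derive (w0 + 0) (1 : C) (F x) (D x).
    by rewrite addr0; exact: differentiable_is_derive.
  have d3 := is_derive_chain (dsh 0) d2; rewrite mulr1 in d3.
  by apply: is_derive_eq; exact: subr0.
have F2M x t : vnrm (x - x0) < rho -> nrm t < r -> nrm (F x (w0 + t) - F x w0) <= 2 * M.
  move=> xr tr; have [|_ _ m1] := H x (w0 + t) xr; first by rewrite addrAC subrr add0r.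
  have [_ _ m2] := H x w0 xr w00.
  by rewrite (le_trans (nrmD _ _))// nrmN mulr_natl mulr2n lerD.
pose C1 := 24 * M / r ^+ 2; pose M2 := 2 * M / r.
have C10 : 0 <= C1 by apply: divr_ge0; [exact: mulr_ge0|exact/ltW/exprn_gt0].
have QD n x : vnrm (x - x0) < rho -> nrm (Q n x - D x) <= C1 * nrm (k n).
  move=> xr.
  have := second_order_bound (fun t tr => dF0 x t xr tr) (fun t tr => F2M x t xr tr) _
    (dFD x xr) (kr n).
  rewrite addr0 subrr => /(_ erefl).
  have -> : F x (w0 + k n) - F x w0 - D x * k n = (Q n x - D x) * k n.
    by rewrite mulrBl divfK.
  rewrite nrmM expr2 [X in _ <= X]mulrA ler_pM2r ?nrm_gt0// /C1.
  by rewrite (_ : 12 * (2 * M) = 24 * M)//; ring.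
have QM n x : vnrm (x - x0) < rho -> nrm (Q n x) <= M2.
  move=> xr; rewrite nrmM nrmV ler_pdivrMr ?nrm_gt0//.
  have krn : nrm (k n) < r by have := kr' n; rewrite addrAC subrr add0r.
  have := schwarz (fun t tr => dF0 x t xr tr) (fun t tr => F2M x t xr tr) _ krn.
  by rewrite addr0 subrr => /(_ erefl); rewrite mulrAC.
have dQ n x : vnrm (x - x0) < rho -> differentiable (Q n) x.
  move=> xr; have [_ d1 _] := H x _ xr (kr' n); have [_ d2 _] := H x _ xr w00.
  exact: (differentiableM (differentiableB d1 d2) (differentiable_cst (k n)^-1 x)).
have x0r : vnrm (x0 - x0) < rho := x00.
have lcauchy n m h : nrm ('d (Q n) x0 h - 'd (Q m) x0 h) <=
    2 * C1 / rho * vnrm h * nrm (k n) + 2 * C1 / rho * vnrm h * nrm (k m).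
  pose q x := Q n x - Q m x.
  have dq x : vnrm (x - x0) < rho -> differentiable q x.
    by move=> xr; exact: (differentiableB (dQ n x xr) (dQ m x xr)).
  have -> : 'd (Q n) x0 h - 'd (Q m) x0 h = 'd q x0 h.
    have d1 := line_is_derive h (dQ n _ x0r); have d2 := line_is_derive h (dQ m _ x0r).
    exact: (is_derive_uniq (is_deriveB d1 d2) (line_is_derive h (dq _ x0r))).
  have -> : 2 * C1 / rho * vnrm h * nrm (k n) + 2 * C1 / rho * vnrm h * nrm (k m)
      = 2 * (C1 * nrm (k n) + C1 * nrm (k m)) / rho * vnrm h by ring.
  apply: (line_cauchy_estimate h rho0 dq) => y yr.
  rewrite /q -(subrKA (D y)) (le_trans (nrmD _ _))//.
  by apply: lerD; [exact: QD|rewrite nrmB; exact: QD].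
have /choice[l lP] : forall h, exists y : C, forall n,
    nrm (y - 'd (Q n) x0 h) <= 2 * (2 * C1 / rho * vnrm h * nrm (k n)).
  by move=> h; apply: (@cauchy_family nat 0%N) => n m; exact: lcauchy.
pose C2 := 4 * C1 / rho.
have C20 : 0 <= C2 by apply: divr_ge0; [exact: mulr_ge0|exact: ltW].
have {}lP h n : nrm (l h - 'd (Q n) x0 h) <= C2 * vnrm h * nrm (k n).
  apply: (le_trans (lP h n)); rewrite le_eqVlt; apply/orP; left; apply/eqP.
  by rewrite /C2; ring.
have lin : linear l.
  move=> a u v; apply/eqP; rewrite -subr_eq0; apply/eqP.
  pose A := C2 * (vnrm (a *: u + v) + nrm a * vnrm u + vnrm v).
  apply: (@nrm_small_eq0 _ _ A) => e /k_small[n ne].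
  have A0 : 0 <= A by rewrite mulr_ge0// !addr_ge0 ?mulr_ge0 ?vnrm_ge0 ?nrm_ge0.
  apply: (@le_trans _ _ (A * nrm (k n))); last by rewrite ler_wpM2l// ltW.
  have h1 := lP (a *: u + v) n; have h2 := lP u n; have h3 := lP v n.
  have -> : l (a *: u + v) - (a *: l u + l v) =
      (l (a *: u + v) - 'd (Q n) x0 (a *: u + v))
      - (a * (l u - 'd (Q n) x0 u) + (l v - 'd (Q n) x0 v)).
    have -> : 'd (Q n) x0 (a *: u + v) = a * 'd (Q n) x0 u + 'd (Q n) x0 v.
      by rewrite linearP.
    by rewrite -[a *: l u]/(a * l u); ring.
  apply: (le_trans (nrmD _ _)); rewrite nrmN.
  have h4 := nrmD (a * (l u - 'd (Q n) x0 u)) (l v - 'd (Q n) x0 v).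
  rewrite nrmM in h4; have h5 := ler_wpM2l (nrm_ge0 a) h2.
  by rewrite /A; move: h1 h3 h4 h5; lra.
pose K1 := C2 * nrm (k 0%N) + 2 * M2 / rho.
pose K2 := 24 * M2 / rho ^+ 2.
have M20 : 0 <= M2 by apply: divr_ge0; [exact: mulr_ge0|exact: ltW].
have K10 : 0 <= K1.
  apply: addr_ge0; first by apply: mulr_ge0; last exact: nrm_ge0.
  by apply: divr_ge0; [exact: mulr_ge0|exact: ltW].
have K20 : 0 <= K2 by apply: divr_ge0; [exact: mulr_ge0|exact/ltW/exprn_gt0].
apply: (@differentiable_of_bound _ _ D l x0 (K1 + K2) (rho / 8)) => //.
- by rewrite divr_gt0.
- move=> h; rewrite -(subrK ('d (Q 0%N) x0 h) (l h)) (le_trans (nrmD _ _))//.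
  have h1 := lP h 0%N; have h2 := line_cauchy_estimate h rho0 (dQ 0%N) (QM 0%N).
  have h3 : 0 <= K2 * vnrm h by rewrite mulr_ge0 ?vnrm_ge0.
  by move: h1 h2 h3; rewrite /K1; lra.
- move=> h hr; have hr4 : vnrm h <= rho / 4 by lra.
  have xh : vnrm (x0 + h - x0) < rho by rewrite addrAC subrr add0r; lra.
  apply: (@le_trans _ _ (K2 * vnrm h ^+ 2)); last first.
    by rewrite ler_wpM2r ?exprn_ge0 ?vnrm_ge0// lerDr.
  pose A := 2 * C1 + C2 * vnrm h.
  have A0 : 0 <= A by apply: addr_ge0; apply: mulr_ge0 => //; exact: vnrm_ge0.
  apply/ler_addgt0Pr => e e0.
  have A1 : 0 < A + 1 by rewrite ltr_wpDl.
  have [n ne] := k_small _ (divr_gt0 e0 A1).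
  have h1 := QD n _ xh; have h2 := QD n _ x0r; have h3 := lP h n.
  have h4 := line_second_order rho0 (dQ n) (QM n) hr4.
  have h5 : A * nrm (k n) <= e.
    move: ne; rewrite ltr_pdivlMr// => /ltW; apply: le_trans.
    by rewrite mulrC ler_wpM2l ?nrm_ge0// lerDl.
  have E (a b c p q s : C) : a - b - c = (p - q - s) - (p - a) + (q - b) - (c - s) by ring.
  rewrite (E _ _ _ (Q n (x0 + h)) (Q n x0) ('d (Q n) x0 h)).
  set X1 := Q n (x0 + h) - Q n x0 - 'd (Q n) x0 h in h4 *.
  set X2 := Q n (x0 + h) - D (x0 + h) in h1 *.
  set X3 := Q n x0 - D x0 in h2 *; set X4 := l h - 'd (Q n) x0 h in h3 *.
  have t1 := nrmD (X1 - X2 + X3) (- X4); have t2 := nrmD (X1 - X2) X3.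
  have t3 := nrmD X1 (- X2); rewrite !nrmN in t1 t3.
  rewrite -/K2 in h4; rewrite /A in h5.
  clear -h1 h2 h3 h4 h5 t1 t2 t3; clearbody X1 X2 X3 X4 K2 C1 C2 k; move: h1 h2 h3 h4 h5 t1 t2 t3.
  by move: (nrm _) (nrm _) (nrm _) (nrm _) (nrm _) (nrm _) (nrm _) (nrm _) => *; lra.
Qed.

End FiberDerivative.

(** * Holomorphic maps between manifolds *)

Section HolomorphicMaps.
Variable R : realType.
Local Notation C := (Cplx R).
Implicit Types (M N P : complex_manifold R).

Lemma hol_at_cts M N (f : M -> N) x : hol_at f x -> {for x, continuous f}.
Proof. by case. Qed.

Lemma hol_at_comp M N P (f : M -> N) (g : N -> P) x :
  hol_at f x -> hol_at g (f x) -> hol_at (g \o f) x.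
Proof.
move=> [cf df] [cg dg]; split; first exact: continuous_comp.
move=> c e ac cx ae ex; have [d ad dx] := matlas_cover (f x).
have dfx := df c d ac cx ad dx; have dgx := dg d e ad dx ae ex.
have [cim cinv] := chart_mapP cx.
apply: (@near_eq_differentiable _ _ _
  ((chart_map e \o g \o chart_inv d) \o (chart_map d \o f \o chart_inv c))).
  have nd : nbhs (f x) (chart_dom d).
    by apply: open_nbhs_nbhs; split=> //; exact: chart_dom_open.
  have : nbhs (chart_map c x) (chart_inv c @^-1` (f @^-1` chart_dom d)).
    by apply: chart_inv_cts => //; rewrite cinv; exact: cf.
  by apply: filterS => z dz; have [_ /= ->] := chart_mapP dz.
apply: differentiable_comp; first exact: dfx.
by rewrite /= cinv; exact: dgx.
Qed.

Lemma hol_at_id M x : hol_at (@id M) x.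
Proof.
split; first exact: cvg_id.
by move=> c d ac cx ad dx; have [im inv] := chart_mapP cx;
  apply: matlas_compat => //; rewrite inv.
Qed.

Lemma hol_at_cst M N (y : N) (x : M) : hol_at (cst y : M -> N) x.
Proof.
by split; [exact: cst_continuous|move=> c d _ _ _ _;
  exact: (differentiable_cst (chart_map d y) (chart_map c x))].
Qed.

Lemma hol_at_fst M N (q : prod_manifold M N) :
  hol_at (fst : prod_manifold M N -> M) q.
Proof.
split; first exact: cvg_fst.
move=> _ d' [c [d [ac ad ->]]] [/= cq dq] ad' d'q.
have [im inv] := chart_mapP cq.
apply: (@differentiable_comp _ _ _ _ lsubmx (chart_map d' \o chart_inv c)).
  exact: differentiable_lsubmx.
by rewrite row_mxKl; apply: matlas_compat => //; rewrite inv.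
Qed.

Lemma hol_at_snd M N (q : prod_manifold M N) :
  hol_at (snd : prod_manifold M N -> N) q.
Proof.
split; first exact: cvg_snd.
move=> _ d' [c [d [ac ad ->]]] [/= cq dq] ad' d'q.
have [im inv] := chart_mapP dq.
apply: (@differentiable_comp _ _ _ _ rsubmx (chart_map d' \o chart_inv d)).
  exact: differentiable_rsubmx.
by rewrite row_mxKr; apply: matlas_compat => //; rewrite inv.
Qed.

Lemma hol_at_pair M N P (f : P -> M) (g : P -> N) x : hol_at f x -> hol_at g x ->
  hol_at (fun t => (f t, g t) : prod_manifold M N) x.
Proof.
move=> [cf df] [cg dg]; split; first exact: (cvg_pair cf cg).
move=> e _ ae ex [c [d [ac ad ->]]] [/= cx dx].
by apply: row_mx_differentiable; [exact: df|exact: dg].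
Qed.

Lemma const_mx_differentiable (z : C) : differentiable (fun t : C => const_mx t : 'rV[C]_1) z.
Proof.
have lin : linear (fun t : C => const_mx t : 'rV[C]_1).
  by move=> a u v; apply/rowP => j; rewrite !mxE.
pose lM := GRing.isLinear.Build _ _ _ _ _ lin.
pose L : {linear C -> 'rV[C]_1} := HB.pack (fun t : C => const_mx t : 'rV[C]_1) lM.
apply: (@linear_differentiable _ _ _ L); exact: C_rV_cts.
Qed.

Lemma entry_differentiable (v : 'rV[C]_1) : differentiable (fun v : 'rV[C]_1 => v 0 0 : C) v.
Proof. exact: differentiable_coord. Qed.

Definition C1_chart : chart R (C1 R) 1 :=
  @global_chart R (C1 R) 1 (fun z : C => const_mx z) (fun v => v 0 0)
    (@C_rVK R) (@rV_CK R) (@C_rV_cts R) (@coord_continuous _ _ _ _ _).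

Lemma hol_at_to_C1 M (f : M -> C1 R) x : hol_at f x <->
  {for x, continuous f} /\ forall c : chart R M (mdim M), matlas c -> chart_dom c x ->
    differentiable ((f : M -> C) \o chart_inv c) (chart_map c x).
Proof.
split=> [[cf df]|[cf df]]; split; [exact: cf| |exact: cf|].
  move=> c ac cx; have d1 := df c C1_chart ac cx erefl I.
  have -> : (f : M -> C) \o chart_inv c = (fun v : 'rV[C]_1 => v 0 0 : C)
      \o (chart_map C1_chart \o f \o chart_inv c).
    by apply/funext => t /=; rewrite mxE.
  exact: (differentiable_comp d1 (entry_differentiable _)).
move=> c d ac cx -> _; have d1 := df c ac cx.
exact: (differentiable_comp d1 (const_mx_differentiable _)).
Qed.

Lemma hol_at_C1 (f : C1 R -> C1 R) (z : C) : hol_at f z <-> differentiable (f : C -> C) z.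
Proof.
split=> [/hol_at_to_C1[_ df]|df].
  have d1 := df C1_chart erefl I.
  have e : (f : C -> C) = ((f : C -> C) \o (fun v : 'rV[C]_1 => v 0 0 : C))
      \o (fun t : C => const_mx t : 'rV[C]_1).
    by apply/funext => t /=; rewrite mxE.
  by rewrite e; exact: (differentiable_comp (const_mx_differentiable z) d1).
apply/hol_at_to_C1; split; first exact: (@differentiable_continuous _ _ _ _ (f : C -> C) df).
move=> c -> _; apply: (@differentiable_comp _ _ _ _ (fun v : 'rV[C]_1 => v 0 0 : C) (f : C -> C)).
  exact: entry_differentiable.
by rewrite /= mxE.
Qed.

Lemma hol_at_line (n : nat) (z v : 'rV[C]_n) (t : C) :
  hol_at ((fun t : C => z + t *: v) : C1 R -> Cn R n) t.
Proof.
have dl s : differentiable (fun t : C => z + t *: v) s.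
  have d1 : differentiable (fun s : C => s *: v) s by exact: ex_diff.
  exact: (differentiableD (differentiable_cst z s) d1).
split; first exact: (@differentiable_continuous _ _ _ _ _ (dl t)).
move=> c d -> _ -> _; apply: (@differentiable_comp _ _ _ _ (fun v : 'rV[C]_1 => v 0 0 : C)
  (fun t : C => z + t *: v)).
  exact: entry_differentiable.
exact: dl.
Qed.

End HolomorphicMaps.

(** * Trivialisations and universal coverings *)

Section Trivializations.
Variable R : realType.
Local Notation C := (Cplx R).
Implicit Types (M N P X : complex_manifold R).

Lemma unit_discE (z : C) : unit_disc R z <-> nrm z < 1.
Proof. by rewrite /unit_disc /= nrmE -(ltcR (nrm z) 1). Qed.

Lemma setTX_open (S T : topologicalType) (V : set T) : open V ->
  open ([set: S] `*` V).
Proof.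
move=> oV; rewrite openE => -[a b] [_ /= Vb].
by exists ([set: S], V) => //; split=> /=; [exact: filterT|exact: open_nbhs_nbhs].
Qed.

Lemma setXT_open (S T : topologicalType) (V : set S) : open V ->
  open (V `*` [set: T]).
Proof.
move=> oV; rewrite openE => -[a b] [/= Va _].
by exists (V, [set: T]) => //; split=> /=; [exact: open_nbhs_nbhs|exact: filterT].
Qed.

Lemma hol_on_setT M N (f : M -> N) : hol_on setT f -> forall x, hol_at f x.
Proof. by move=> /(hol_on_open _ openT) H x; exact: H. Qed.

(** Near g x, f extends to a holomorphic map f', and g does not leave A. *)
Lemma hol_on_comp M N P (A : set M) (f : M -> N) (g : P -> M) x : hol_on A f ->
  hol_at g x -> (\forall t \near x, A (g t)) -> hol_at (f \o g) x.
Proof.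
move=> Af gx nA; have [f' hf' ff'] := Af (g x) (nbhs_singleton nA).
have cg := hol_at_cts gx.
have hf'x : hol_at f' (g x) by exact: nbhs_singleton hf'.
apply: (@near_eq_hol_at _ _ _ (f' \o g)); last exact: hol_at_comp gx hf'x.
have n1 : \forall t \near x, A (g t) -> f (g t) = f' (g t) by exact: (cg _ ff').
by apply: filterS (filterI nA n1) => t [At /(_ At)].
Qed.

(** A holomorphic trivialisation of Y over V with fibre the unit disc. *)
Definition disc_chart M X (p : M -> X) (Y : set M) (V : set X) (Phi : M -> C1 R)
    (Psi : prod_manifold (C1 R) X -> M) :=
  [/\ open V,
      forall v, Y v -> V (p v) -> [/\ hol_at Phi v, nrm (Phi v) < 1 & Psi (Phi v, p v) = v] &
      forall (w : C) y, nrm w < 1 -> V y -> [/\ hol_at Psi (w : C1 R, y), Y (Psi (w : C1 R, y)),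
        p (Psi (w : C1 R, y)) = y & Phi (Psi (w : C1 R, y)) = w]].

(** The model fibre F is biholomorphic to any fibre, hence to the disc. *)
Lemma disc_chart_exists M X (p : M -> X) (Y : set M) x0 : open Y -> continuous p ->
  hol_locally_trivial Y p -> biholomorphic (Y `&` p @^-1` [set x0]) (unit_disc R) ->
  forall x, exists V Phi Psi, V x /\ @disc_chart M X p Y V Phi Psi.
Proof.
move=> oY cp [_ _ [F [Ffib Ftriv]]] [f2 [g2 [hf2 hg2 fg2 gf2]]] x.
have [f1 [g1 [hf1 hg1 fg1 gf1]]] := Ffib x0.
have oD : open (unit_disc R : set (C1 R)).
  rewrite openE => z /unit_discE z1; apply/nbhs_nrmP; exists (1 - nrm z).
    by rewrite subr_gt0.
  move=> w wz; apply/unit_discE; rewrite -(subrK z w) (le_lt_trans (nrmD _ _))//.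
  by rewrite -ltrBrDr.
pose h : F -> C1 R := f2 \o g1; pose k : C1 R -> F := f1 \o g2.
have hh a : hol_at h a.
  apply: (hol_on_comp hf2); first exact: hol_on_setT.
  by apply: nearW => b; have [] := gf1 b I.
have hk (w : C) : nrm w < 1 -> hol_at k (w : C1 R).
  move=> /unit_discE w1; apply: (hol_on_comp hf1).
    by move: w1; exact: (hol_on_open _ oD).1.
  have : \forall t \near (w : C1 R), unit_disc R t by exact: open_nbhs_nbhs.
  by apply: filterS => t t1; have [] := gf2 t t1.
have kh a : k (h a) = a.
  by have [A1 E1] := gf1 a I; have [_ E2] := fg2 _ A1; rewrite /k /h /= E2 E1.
have hkK (w : C) : nrm w < 1 -> h (k (w : C1 R)) = w.
  move=> /unit_discE w1; have [A1 E1] := gf2 w w1; have [_ E2] := fg1 _ A1.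
  by rewrite /k /h /= E2 E1.
have h1 a : nrm (h a : C) < 1.
  by apply/unit_discE; have [A1 _] := gf1 a I; have [] := fg2 _ A1.
have [V [oV Vx [phi [psi [[hphi hpsi phiP psiP] phi2]]]]] := Ftriv x.
have oYV : open (Y `&` p @^-1` V).
  by apply: openI => //; apply: open_comp => // y _; exact: cp.
exists V, (fun v => h (phi v).1), (fun q => psi (k q.1, q.2)).
split; first exact: Vx.
split; first exact: oV.
- move=> v Yv Vv; have Av : (Y `&` p @^-1` V) v by [].
  have hv := (hol_on_open _ oYV).1 hphi v Av; split.
  + apply: (hol_at_comp (g := h)); last exact: hh.
    by apply: hol_at_comp hv _; exact: hol_at_fst.
  + exact: h1.
  + by rewrite /= kh -(phi2 _ Yv Vv) -surjective_pairing; have [] := phiP v Av.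
- move=> w y w1 Vy; have B : ([set: F] `*` V) (k (w : C1 R), y) by [].
  have [[Yv Vv] E] := psiP _ B; have E2 := phi2 _ Yv Vv; rewrite E /= in E2.
  split; [|exact: Yv|exact: esym E2|by rewrite E; exact: hkK].
  apply: (hol_at_comp (f := fun q : prod_manifold (C1 R) X => (k q.1, q.2) : prod_manifold F X)
    (g := psi)).
    apply: hol_at_pair; last exact: hol_at_snd.
    apply: (hol_at_comp (f := fst : prod_manifold (C1 R) X -> C1 R)); first exact: hol_at_fst.
    exact: hk.
  have oFV : open ([set: F] `*` V : set (prod_manifold F X)) by exact: setTX_open.
  exact: ((hol_on_open psi oFV).1 hpsi _ B).
Qed.

(** A holomorphic trivialisation of L over V; its compatibility with the scalar
    multiplication makes the transition functions linear. *)
Definition line_chart X (L : line_bundle X) (V : set X) (l : tot L -> C1 R)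
    (eta : prod_manifold X (C1 R) -> tot L) :=
  [/\ open V,
      forall v, V (bundle_proj L v) -> [/\ hol_at l v, eta (bundle_proj L v, l v) = v &
        forall a, l (fib_scale L a v) = a * (l v : C) :> C] &
      forall y (c : C), V y -> [/\ hol_at eta (y, c : C1 R),
        bundle_proj L (eta (y, c : C1 R)) = y & l (eta (y, c : C1 R)) = c]].

Lemma line_chart_exists X (L : line_bundle X) x :
  exists V l eta, V x /\ @line_chart X L V l eta.
Proof.
have [V [oV Vx [phi [psi [[hphi hpsi phiP psiP] phi1 _ phiZ]]]]] := local_triv L x.
have cp : continuous (bundle_proj L).
  by move=> v; exact: hol_at_cts (hol_on_setT (@proj_hol R X L) v).
have oVp : open (bundle_proj L @^-1` V) by apply: open_comp => // y _; exact: cp.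
exists V, (fun v => (phi v).2), psi.
split; first exact: Vx.
split; first exact: oV.
- move=> v Vv; split.
  + have hv := (hol_on_open _ oVp).1 hphi v Vv.
    by apply: hol_at_comp hv _; exact: hol_at_snd.
  + by rewrite -(phi1 _ Vv) -surjective_pairing; have [] := phiP v Vv.
  + by move=> a; exact: phiZ.
- move=> y c Vy; have B : (V `*` [set: C1 R]) (y, c : C1 R) by [].
  have [Vv E] := psiP _ B; have E1 := phi1 _ Vv; rewrite E /= in E1.
  split; [|exact: esym E1|by rewrite E].
  have oVC : open (V `*` [set: C1 R] : set (prod_manifold X (C1 R))) by exact: setXT_open.
  exact: ((hol_on_open psi oVC).1 hpsi _ B).
Qed.

End Trivializations.

Section Coverings.
Variable R : realType.
Local Notation C := (Cplx R).

(** A property of the universal coverings of tori and of powers of the punctured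
    plane; it joins nearby points of X by images of complex lines. *)
Definition open_holomorphic_surjection (n : nat) (X : complex_manifold R)
    (pr : Cn R n -> X) (A : set X) :=
  [/\ forall z, hol_at pr z, forall z, A (pr z), forall x, A x -> exists z, pr z = x &
      forall z W, nbhs z W -> nbhs (pr z) (pr @` W)].

Lemma torus_covering n (e : 'I_(2 * n) -> 'rV[C]_n) (he : real_free e) :
  @open_holomorphic_surjection n (complex_torus he) (torus_proj e) setT.
Proof.
split=> //.
- move=> z; split; first exact: torus_proj_cts.
  move=> c d -> _ ad dz.
  have cd : {for z, continuous (chart_map d \o torus_proj e)}.
    by apply: continuous_comp; [exact: torus_proj_cts|exact: chart_map_cts].
  apply: (@lattice_translation_differentiable R n e he (chart_map d \o torus_proj e)) => //.
  have : nbhs z (torus_proj e @^-1` chart_dom d).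
    by apply: torus_proj_cts; apply: open_nbhs_nbhs; split=> //; exact: chart_dom_open.
  apply: filterS => w dw; apply/torus_projP.
  by have [im inv] := chart_mapP dw; rewrite -(ad _ im) inv.
- by move=> x _; exact: torus_proj_surj.
- move=> z W; rewrite nbhsE => -[W' [oW' W'z] W'W].
  apply: (@filterS _ _ _ (torus_proj e @` W')); first exact: image_subset.
  by apply: open_nbhs_nbhs; split; [exact: torus_proj_open|exists z].
Qed.

(** Near 1 a logarithm of w is ln |w| + i arctan (Im w / Re w). *)
Lemma exp_open (z : C) (e : R) : 0 < e -> exists2 d : R, 0 < d &
  forall w, nrm (w - complex_exp z) < d -> exists2 u : C, nrm (u - z) < e & complex_exp u = w.
Proof.
move=> e0.
have [d d0 H] : exists2 d : R, 0 < d & forall w : C, nrm (w - 1) < d ->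
    exists2 u : C, nrm u < e & complex_exp u = w.
  pose lg (w : C) : C := (ln (nrm w) +i* atan (complex.Im w / complex.Re w))%C.
  have re1 : complex.Re (1 : C) != 0 by rewrite /= oner_neq0.
  have cl : {for (1 : C), continuous lg}.
    apply: (@complex_continuous R C (fun w => ln (nrm w))
      (fun w => atan (complex.Im w / complex.Re w))).
      apply: continuous_comp; first exact: nrm_continuous.
      by apply: continuous_ln; rewrite nrm1.
    apply: (@continuous_comp _ _ _ (fun w : C => complex.Im w / complex.Re w) (@atan R));
      last exact: continuous_atan.
    apply: continuousM; first exact: Im_continuous.
    by apply: continuousV => //; exact: Re_continuous.
  have lg1 : lg 1 = 0 by rewrite /lg nrm1 ln1 /= mul0r atan0.
  have [d d0 dP] := (cts_nrmP _ _).1 cl e e0.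
  exists (Num.min d 1); first by rewrite lt_min d0 ltr01.
  move=> w; rewrite lt_min => /andP[wd w1]; exists (lg w).
    by have := dP w wd; rewrite lg1 subr0.
  case: w w1 {wd} => a b w1.
  have a0 : 0 < a.
    have := le_lt_trans (Re_le_nrm _) w1; rewrite raddfB /= ltr_norml => /andP[+ _]; lra.
  have nw0 : 0 < nrm (a +i* b)%C.
    by apply: lt_le_trans a0 _; apply: le_trans (Re_le_nrm (a +i* b)%C); exact: ler_norm.
  pose t := b / a; pose s := Num.sqrt (1 + t ^+ 2).
  have s0 : 0 < s by rewrite sqrtr_gt0 ltr_pwDl// sqr_ge0.
  have cE : cos (atan t) = s^-1 by exact: cos_atan.
  have sE : sin (atan t) = t * s^-1.
    by rewrite -cE -{2}[t]atanK /tan divfK// cE invr_eq0 gt_eqF.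
  have nE : nrm (a +i* b)%C = a * s.
    apply/eqP; rewrite -(@eqrXn2 _ 2%N) ?nrm_ge0 ?mulr_ge0 ?(ltW a0) ?(ltW s0)//.
    rewrite nrm2E /= exprMn sqr_sqrtr; last by rewrite addr_ge0 ?sqr_ge0.
    by apply/eqP; rewrite /t; field; rewrite gt_eqF.
  rewrite /lg /complex_exp /= lnK ?posrE// -/t cE sE nE /t.
  by congr (_ +i* _)%C; field; rewrite !gt_eqF.
have n0 : 0 < nrm (complex_exp z) by rewrite nrm_gt0 complex_exp_neq0.
exists (d * nrm (complex_exp z)); first by rewrite mulr_gt0.
move=> w wd; have [|u ue uE] := H (w / complex_exp z).
  have -> : w / complex_exp z - 1 = (w - complex_exp z) / complex_exp z.
    by rewrite mulrBl divff ?complex_exp_neq0.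
  by rewrite nrmM nrmV ltr_pdivrMr.
exists (z + u); first by rewrite addrAC subrr add0r.
by rewrite complex_expD uE mulrC divfK ?complex_exp_neq0.
Qed.

Lemma exp_covering m : @open_holomorphic_surjection m (Cn R m)
  (map_mx (@complex_exp R)) (Cstar R m).
Proof.
have de (z : 'rV[C]_m) : differentiable (map_mx (@complex_exp R) : 'rV[C]_m -> 'rV[C]_m) z.
  have -> : (map_mx (@complex_exp R) : 'rV[C]_m -> 'rV[C]_m) =
      (\sum_(j < m) (fun z : 'rV[C]_m => complex_exp (z 0 j) *: (delta_mx 0 j : 'rV[C]_m))).
    apply/funext => u; rewrite fct_sumE; apply/rowP => k; rewrite mxE summxE.
    rewrite (bigD1 k)//= !mxE !eqxx mulr1 big1 ?addr0// => j jk.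
    by rewrite !mxE eqxx eq_sym (negbTE jk) mulr0.
  apply: differentiable_sum => j; apply: differentiableZl.
  apply: (@differentiable_comp _ _ _ _ (fun z : 'rV[C]_m => z 0 j : C) (@complex_exp R)).
    exact: differentiable_coord.
  exact: is_derive_differentiable (is_derive_exp _).
split.
- move=> z; split; first exact: (@differentiable_continuous _ _ _ _ _ (de z)).
  by move=> c d -> _ -> _; exact: de.
- by move=> z j; rewrite mxE complex_exp_neq0.
- move=> x xne; have /choice[f fP] : forall j, exists w : C, complex_exp w = x 0 j.
    by move=> j; exact/complex_exp_surj/xne.
  by exists (\row_j f j); apply/rowP => j; rewrite !mxE.
- move=> z W nW.
  have /nbhs_ballP[e0 /= /gt0_complexP[e e1 ->] eW] : nbhs (z : 'rV[C]_m) W by exact: nW.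
  have /choice[d dP] : forall j, exists d : R, 0 < d /\ forall w, nrm (w - complex_exp (z 0 j)) < d ->
      exists2 u : C, nrm (u - z 0 j) < e & complex_exp u = w.
    by move=> j; have [d d0 H] := exp_open (z 0 j) e1; exists d.
  have [dm dm0 dmP] : exists2 dm : R, 0 < dm & forall j, dm <= d j.
    exists (\big[Num.min/1]_(j < m) d j).
      by elim/big_ind: _ => // [x y x0 y0|j _]; [rewrite lt_min x0|have [] := dP j].
    by move=> j; exact: bigmin_le_cond.
  suff : nbhs (map_mx (@complex_exp R) z : 'rV[C]_m) (map_mx (@complex_exp R) @` W) by [].
  apply/nbhs_ballP; exists (dm%:C)%C; first by rewrite /= ltcR.
  move=> x [_ xz]; have /choice[u uP] : forall j, exists u : C,
      nrm (u - z 0 j) < e /\ complex_exp u = x 0 j.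
    move=> j; have [_ Hj] := dP j; have [|u u1 u2] := Hj (x 0 j); last by exists u.
    have := xz 0 j; rewrite -ball_normE /ball_ /= mxE nrmE nrmB ltcR => /lt_le_trans; exact.
  exists (\row_j u j); last by apply/rowP => j; rewrite !mxE; have [] := uP j.
  apply: eW; split; first by rewrite ltcR.
  move=> i j; rewrite -ball_normE /ball_ /= !mxE ord1 nrmE nrmB ltcR.
  by have [] := uP j.
Qed.

Lemma covering_transfer n (X Z : complex_manifold R) (A : set Z) (pr : Cn R n -> Z) :
  open_holomorphic_surjection pr A -> open A -> biholomorphic [set: X] A ->
  exists q : Cn R n -> X, open_holomorphic_surjection q setT.
Proof.
move=> [hpr prA prS prO] oA [f [g [hf hg fg gf]]]; exists (g \o pr); split=> //.
- by move=> z; apply: hol_at_comp => //; apply: (hol_on_open _ oA).1.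
- by move=> x _; have [Afx E] := fg x I; have [z zE] := prS _ Afx; exists z; rewrite /= zE.
- move=> z W /prO nW; have cf : {for g (pr z), continuous f}.
    by apply: hol_at_cts; exact: hol_on_setT.
  have [_ fgz] := gf _ (prA z).
  have : nbhs (g (pr z)) (f @^-1` (pr @` W)) by apply: cf; rewrite fgz.
  apply: filterS => x [w Ww wE]; exists w => //=.
  by rewrite wE; have [] := fg x I.
Qed.

Lemma Cstar_open m : open (Cstar R m : set (Cn R m)).
Proof.
rewrite openE => z zP.
suff : nbhs (z : 'rV[C]_m) (fun w : 'rV[C]_m => forall j, w 0 j != 0) by [].
apply: (@filter_forall _ _ (fun j => [set w : 'rV[C]_m | w 0 j != 0]) (nbhs (z : 'rV[C]_m))) => j.
have zj := zP j; rewrite -nrm_gt0 in zj.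
have cz := @coord_continuous C 1 m 0 j z.
have : nbhs (z 0 j : C) [set w : C | w != 0].
  apply/nbhs_nrmP; exists (nrm (z 0 j)) => // w.
  by apply: contraTneq => ->; rewrite sub0r nrmN ltxx.
by move=> /cz.
Qed.

End Coverings.

(** * Flat line bundles *)

Section Logarithm.
Variable R : realType.
Local Notation C := (Cplx R).

Let tpi : C := ((2 * pi)*i)%C.

Lemma tpi_neq0 : tpi != 0.
Proof.
apply/eqP => -[] /eqP; apply/negP; rewrite mulf_eq0 negb_or pnatr_eq0 /=.
by rewrite gt_eqF// pi_gt0.
Qed.

Lemma complex_log (a : C) : a != 0 -> exists f : C, complex_exp (tpi * f) = a.
Proof.
move=> /complex_exp_surj[w wE]; exists (w / tpi).
by rewrite mulrC divfK ?tpi_neq0.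
Qed.

Lemma complex_exp_period (k : int) : complex_exp (tpi * k%:~R) = 1.
Proof.
have e1 : complex_exp tpi = 1.
  by rewrite /tpi /complex_exp mulr_natl cos2pi sin2pi expR0 mulr0 mulr1.
have en (m : nat) : complex_exp (tpi * m%:R) = 1.
  elim: m => [|m IH]; first by rewrite mulr0 complex_exp0.
  by rewrite -natr1 mulrDr mulr1 complex_expD IH e1 mulr1.
case: k => m; first exact: en.
apply: (mulfI (complex_exp_neq0 (tpi * m.+1%:R))).
by rewrite -complex_expD NegzE mulrNz mulrN subrr complex_exp0 en mulr1.
Qed.

(** Up to an integer z is a real number x in [0, 1[, and cos (2 pi x) = 1 gives
    sin (pi x) = 0. *)
Lemma complex_exp_eq1 (z : C) : complex_exp (tpi * z) = 1 -> exists k : int, z = k%:~R.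
Proof.
move=> ez; pose k := Num.floor (complex.Re z); exists k.
pose t := z - k%:~R.
suff : t = 0 by move=> /eqP; rewrite subr_eq0 => /eqP.
have et : complex_exp (tpi * t) = 1.
  rewrite /t mulrBr complex_expD ez mul1r.
  apply: (mulfI (complex_exp_neq0 (tpi * k%:~R))).
  by rewrite -complex_expD subrr complex_exp0 complex_exp_period mulr1.
have /andP[x0 x1] : 0 <= complex.Re t < 1.
  rewrite /t raddfB /= -(rmorph_int (real_complex R)) /=.
  rewrite subr_ge0 ltrBlDr -[X in _ < X + _]/(1%:~R) -intrD [(1 + _)%R]addrC.
  by rewrite floor_le floorD1_gt.
case: t et x0 x1 => x y et /= x0 x1.
have y0 : y = 0.
  have : nrm (complex_exp (tpi * (x +i* y)%C)) = 1 by rewrite et nrm1.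
  rewrite nrm_exp /tpi /= mul0r sub0r => /eqP.
  rewrite -[X in _ == X]expR0 (inj_eq (@expR_inj R)) oppr_eq0 mulf_eq0 mulf_eq0 pnatr_eq0 /=.
  by rewrite gt_eqF ?pi_gt0//= => /eqP.
have cx : cos (2 * pi * x) = 1.
  have := congr1 (@complex.Re R) et; rewrite /tpi y0 /=.
  by rewrite !(mul0r, mulr0, oppr0, add0r, expR0, mul1r).
have s0 : sin (pi * x) = 0.
  apply/eqP; rewrite -norm_cos_eq1.
  have : cos (pi * x) ^+ 2 = 1.
    have e2 : 2 * pi * x = (pi * x) *+ 2 by rewrite -[RHS]mulr_natl mulrA.
    by have := cos_mulr2n (pi * x); rewrite -e2 cx mulr2n => E; lra.
  by move/eqP; rewrite sqrf_eq1 => /orP[] /eqP ->; rewrite ?normrN normr1.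
suff x00 : x = 0 by rewrite x00 y0.
apply/eqP; rewrite eq_le x0 andbT leNgt; apply/negP => xp.
have : 0 < sin (pi * x).
  by apply: sin_gt0_pi; rewrite mulr_gt0 ?pi_gt0//= gtr_pMr ?pi_gt0.
by rewrite s0 ltxx.
Qed.

End Logarithm.

Section FlatLineBundle.
Variable R : realType.
Local Notation C := (Cplx R).
Variables (X : complex_manifold R) (L : line_bundle X) (U : set (tot L)).
Variables (n : nat) (pr : Cn R n -> X).
Variables (V W : X -> set X) (Phi l : X -> tot L -> C1 R).
Variables (Psi : X -> prod_manifold (C1 R) X -> tot L).
Variables (eta : X -> prod_manifold X (C1 R) -> tot L).

Hypothesis pr_covering : open_holomorphic_surjection pr setT.
Hypothesis zeroU : zero_section L `<=` U.
Hypothesis disc : forall x, disc_chart (bundle_proj L) U (V x) (Phi x) (Psi x).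
Hypothesis line : forall x, line_chart (W x) (l x) (eta x).
Hypothesis Vx : forall x, V x x.
Hypothesis Wx : forall x, W x x.

Local Notation p := (bundle_proj L).

Let o (y : X) : tot L := eta y (y, (0 : C) : C1 R).

Let V_open x : open (V x). Proof. by have [] := disc x. Qed.
Let W_open x : open (W x). Proof. by have [] := line x. Qed.

Let PhiP x v : U v -> V x (p v) ->
  [/\ hol_at (Phi x) v, nrm (Phi x v) < 1 & Psi x (Phi x v, p v) = v].
Proof. by have [_ H _] := disc x; exact: H. Qed.

Let PsiP x (w : C) y : nrm w < 1 -> V x y ->
  [/\ hol_at (Psi x) (w : C1 R, y), U (Psi x (w : C1 R, y)),
      p (Psi x (w : C1 R, y)) = y & Phi x (Psi x (w : C1 R, y)) = w].
Proof. by have [_ _ H] := disc x; exact: H. Qed.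

Let lP x v : W x (p v) -> [/\ hol_at (l x) v, eta x (p v, l x v) = v &
  forall a, l x (fib_scale L a v) = a * (l x v : C) :> C].
Proof. by have [_ H _] := line x; exact: H. Qed.

Let etaP x y (c : C) : W x y -> [/\ hol_at (eta x) (y, c : C1 R),
  p (eta x (y, c : C1 R)) = y & l x (eta x (y, c : C1 R)) = c].
Proof. by have [_ _ H] := line x; exact: H. Qed.

Let o_proj y : p (o y) = y. Proof. by have [] := etaP 0 (Wx y). Qed.

Let l_inj x v v' : p v = p v' -> W x (p v) -> l x v = l x v' -> v = v'.
Proof.
move=> pv Wv lv; have [_ <- _] := lP Wv; rewrite lv pv; rewrite pv in Wv.
by have [_ -> _] := lP Wv.
Qed.

Let o_scale y : fib_scale L 0 (o y) = o y.
Proof.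
have W1 : W y (p (o y)) by rewrite o_proj.
apply: (@l_inj y); [by rewrite proj_scale|by rewrite proj_scale|].
have [_ _ ->] := lP W1; rewrite mul0r.
by have [_ _ ->] := etaP 0 (Wx y).
Qed.

Let o_U y : U (o y).
Proof. by apply: zeroU; exists (o y) => //; exact: o_scale. Qed.

Let l_o x y : W x y -> l x (o y) = 0 :> C.
Proof.
move=> Wy; have W1 : W x (p (o y)) by rewrite o_proj.
by rewrite -o_scale; have [_ _ ->] := lP W1; rewrite mul0r.
Qed.

Let o_eta x y : W x y -> eta x (y, (0 : C) : C1 R) = o y.
Proof.
move=> Wy; have [_ pe le] := etaP 0 Wy.
by apply: (@l_inj x); rewrite ?pe ?o_proj// le l_o.
Qed.

Let o_hol y : hol_at o y.
Proof.
apply: (@near_eq_hol_at _ _ _ (fun y' => eta y (y', (0 : C) : C1 R))).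
  have : nbhs y (W y) by apply: open_nbhs_nbhs; split; [exact: W_open|exact: Wx].
  by apply: filterS => y' Wy'; exact: o_eta.
apply: (hol_at_comp (f := fun y' : X => (y', (0 : C) : C1 R) : prod_manifold X (C1 R))).
  apply: hol_at_pair; first exact: hol_at_id.
  exact: (@hol_at_cst R X (C1 R)).
by have [] := etaP 0 (Wx y).
Qed.

Let gamma (z v : 'rV[C]_n) (t : C) : X := pr (z + t *: v).

Let gamma_hol z v (t : C) : hol_at (gamma z v : C1 R -> X) t.
Proof.
have [hpr _ _ _] := pr_covering.
exact: (hol_at_comp (@hol_at_line R n z v t) (hpr _)).
Qed.

Let gamma_open z v (A : set X) : open A -> open [set t : C | A (gamma z v t)].
Proof.
move=> oA; apply: (@open_comp C X (gamma z v)) => // t _.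
exact: hol_at_cts (gamma_hol z v t).
Qed.

Let trans_fiber i j y (w : C) : V i y -> V j y -> nrm w < 1 ->
  differentiable (fun w : C => Phi j (Psi i (w : C1 R, y)) : C) w.
Proof.
move=> iy jy w1; have [hPsi UPsi pPsi _] := PsiP w1 iy.
apply/(hol_at_C1 (fun w : C1 R => Phi j (Psi i (w, y)))).
apply: (hol_at_comp (f := fun w : C1 R => Psi i (w, y)) (g := Phi j)).
  apply: (hol_at_comp (f := fun w : C1 R => (w, y) : prod_manifold (C1 R) X)) => //.
  apply: hol_at_pair; first exact: hol_at_id.
  exact: (@hol_at_cst R (C1 R) X).
by rewrite -pPsi in jy; have [] := PhiP UPsi jy.
Qed.

Let trans_base i j z v (t w : C) : V i (gamma z v t) -> V j (gamma z v t) -> nrm w < 1 ->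
  differentiable (fun t : C => Phi j (Psi i (w : C1 R, gamma z v t)) : C) t.
Proof.
move=> it jt w1; have [hPsi UPsi pPsi _] := PsiP w1 it.
apply/(hol_at_C1 (fun t : C1 R => Phi j (Psi i (w : C1 R, gamma z v t)))).
apply: (hol_at_comp (f := fun t : C1 R => Psi i (w : C1 R, gamma z v t)) (g := Phi j)).
  apply: (hol_at_comp (f := fun t : C1 R => (w : C1 R, gamma z v t) : prod_manifold (C1 R) X)) => //.
  apply: hol_at_pair; last exact: gamma_hol.
  exact: (@hol_at_cst R (C1 R) (C1 R)).
by rewrite -pPsi in jt; have [] := PhiP UPsi jt.
Qed.

Let E z v (t : C) : set (tot L) := U `&` p @^-1` [set gamma z v t].

Let E_Phi z v i t u : V i (gamma z v t) -> E z v t u ->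
  nrm (Phi i u) < 1 /\ Psi i (Phi i u, gamma z v t) = u.
Proof. by move=> it [Uu pu]; rewrite -pu in it *; have [] := PhiP Uu it. Qed.

Let E_Psi z v i t (w : C) : V i (gamma z v t) -> nrm w < 1 ->
  E z v t (Psi i (w : C1 R, gamma z v t)) /\ Phi i (Psi i (w : C1 R, gamma z v t)) = w.
Proof. by move=> it w1; have [_ Uw pw Pw] := PsiP w1 it. Qed.

(** The discs over the entire curve gamma z v form a flat bundle, of which the
    zero section is a section. *)
Let section_derivative i z v : V i (pr z) ->
  is_derive (0 : C) (1 : C) (fun t : C => Phi i (o (gamma z v t)) : C) 0.
Proof.
move=> iz.
apply: (@flat_section_derivative_eq0 R (tot L) X (E z v) (fun i => [set t | V i (gamma z v t)])
  Phi (fun i t w => Psi i (w : C1 R, gamma z v t)) (fun t => o (gamma z v t))).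
- by move=> j; exact/gamma_open/V_open.
- by move=> t; exists (gamma z v t); exact: Vx.
- by move=> j t u; exact: E_Phi.
- by move=> j t w; exact: E_Psi.
- by move=> j k t w; exact: trans_fiber.
- by move=> j k t w; exact: trans_base.
- by move=> t; split; [exact: o_U|exact: o_proj].
- move=> j t jt; apply/(hol_at_C1 (fun t : C1 R => Phi j (o (gamma z v t)))).
  apply: (hol_at_comp (f := fun t : C1 R => o (gamma z v t)) (g := Phi j)).
    by apply: hol_at_comp (gamma_hol z v t) _; exact: o_hol.
  have jt' : V j (p (o (gamma z v t))) by rewrite o_proj.
  by have [] := PhiP (o_U _) jt'.
- by rewrite /= /gamma scale0r addr0.
Qed.

(** Statements about nearby points of X are proved along images of segments. *)
Let near_segments (A : set X) y : open A -> A y ->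
  exists z (r : R), [/\ pr z = y, 0 < r, forall v, vnrm v < r -> A (pr (z + v)) &
    forall Q : X -> Prop, (forall v, vnrm v < r -> Q (pr (z + v))) -> \forall y' \near y, Q y'].
Proof.
move=> oA Ay; have [hpr _ prS prO] := pr_covering.
have [z zE] := prS y I.
have /nbhs_vnrmP[r r0 rA] : nbhs (z : 'rV[C]_n) (pr @^-1` A).
  by apply: (hol_at_cts (hpr z)); rewrite zE; exact: open_nbhs_nbhs.
exists z, r; split=> //.
  by move=> v vr; apply: rA; rewrite addrAC subrr add0r.
move=> Q HQ; rewrite -zE.
have nb : nbhs z [set z' : 'rV[C]_n | vnrm (z' - z) < r].
  by apply/(@nbhs_vnrmP R 'rV[C]_n z); exists r.
apply: filterS (prO z _ nb) => _ [z' zz' <-].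
by rewrite -(subrK z z') addrC; exact: HQ.
Qed.

Let sigma i (y : X) : C := Phi i (o y).

Lemma section_locally_constant i y : V i y -> \forall y' \near y, sigma i y' = sigma i y.
Proof.
move=> iy; have [z [r [zE r0 rV nQ]]] := near_segments (V_open i) iy.
apply: nQ => v vr.
have -> : pr (z + v) = gamma z v (0 + 1) by rewrite /gamma add0r scale1r.
have -> : y = gamma z v 0 by rewrite /gamma scale0r addr0 zE.
apply: (@zero_derivative_segment R (fun t : C => sigma i (gamma z v t)) 0 1) => s /andP[s0 s1].
rewrite add0r mulr1.
have iz : V i (pr (z + (s%:C)%C *: v)).
  by apply: rV; rewrite vnrmZ nrm_real ger0_norm// (le_lt_trans _ vr)// ler_piMl ?vnrm_ge0.
have ds : is_derive ((s%:C)%C : C) (1 : C) (fun t : C => t - (s%:C)%C) 1.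
  by apply: is_derive_eq; exact: subr0.
have := section_derivative v iz; rewrite -[X in is_derive X](subrr ((s%:C)%C : C)) => d0.
have := is_derive_chain ds d0; rewrite mul0r.
congr (is_derive _ _ _ _); apply/funext => t; rewrite /sigma /gamma /=.
by rewrite -addrA -scalerDl [_ + (t - _)]addrC subrK.
Qed.

Lemma trans_locally_constant i j y : V i y -> V j y ->
  \forall y' \near y, forall w : C, nrm w < 1 ->
    Phi j (Psi i (w : C1 R, y')) = Phi j (Psi i (w : C1 R, y)).
Proof.
move=> iy jy; have oij : open (V i `&` V j) by exact: openI.
have [z [r [zE r0 rV nQ]]] := near_segments oij (conj iy jy).
have r20 : 0 < r / 2 by rewrite divr_gt0.
have [_ _ _ prO] := pr_covering.
have nb : nbhs z [set z' : 'rV[C]_n | vnrm (z' - z) < r / 2].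
  by apply/(@nbhs_vnrmP R 'rV[C]_n z); exists (r / 2).
rewrite -zE; apply: filterS (prO z _ nb) => _ [z' zz' <-] w w1.
pose v := z' - z : 'rV[C]_n.
have -> : pr z' = gamma z v 1 by rewrite /gamma scale1r addrC subrK.
have -> : pr z = gamma z v 0 by rewrite /gamma scale0r addr0.
apply: (@trans_constant R (tot L) X (E z v) (fun i => [set t | V i (gamma z v t)])
  Phi (fun i t w => Psi i (w : C1 R, gamma z v t)) _ _ _ _ i j 0 1 w 2) => //.
- by move=> k t u; exact: E_Phi.
- by move=> k t u; exact: E_Psi.
- by move=> k m t u; exact: trans_fiber.
- by move=> k m t u; exact: trans_base.
- move=> u; rewrite subr0 => u2; apply: rV; rewrite vnrmZ.
  apply: (@le_lt_trans _ _ (2 * vnrm v)); first by rewrite ler_wpM2r ?vnrm_ge0// ltW.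
  by rewrite mulrC -ltr_pdivlMr.
- by rewrite subr0 nrm1 ltr1n.
Qed.

Let B i := V i `&` W i.

Let B_open i : open (B i). Proof. exact: openI. Qed.

Let sigma_lt1 i y : V i y -> nrm (sigma i y) < 1.
Proof. by move=> iy; rewrite -(o_proj y) in iy; have [] := PhiP (o_U y) iy. Qed.

Let Psi_sigma i y : V i y -> Psi i (sigma i y : C1 R, y) = o y.
Proof.
move=> iy; rewrite -(o_proj y) in iy; have [_ _] := PhiP (o_U y) iy.
by rewrite o_proj.
Qed.

Let near_disc (w : C) : nrm w < 1 -> \forall w' \near w, nrm w' < 1.
Proof.
move=> w1; apply/nbhs_nrmP; exists (1 - nrm w); first by rewrite subr_gt0.
by move=> w' w'w; rewrite -(subrK w w') (le_lt_trans (nrmD _ _))// -ltrBrDr.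
Qed.

Let lPsi i (w : C) (y : X) : C := l i (Psi i (w : C1 R, y)).

Let lPsi_hol i y (w : C) : B i y -> nrm w < 1 ->
  hol_at (fun q : prod_manifold (C1 R) X => l i (Psi i q)) (w : C1 R, y).
Proof.
move=> [iy jy] w1; have [hPsi _ pPsi _] := PsiP w1 iy.
by apply: hol_at_comp hPsi _; rewrite -pPsi in jy; have [] := lP jy.
Qed.

Let lPsi_fiber i y (w : C) : B i y -> nrm w < 1 -> differentiable (lPsi i ^~ y) w.
Proof.
move=> iy w1; apply/(hol_at_C1 (fun w : C1 R => l i (Psi i (w, y)))).
apply: (hol_at_comp (f := fun w : C1 R => (w, y) : prod_manifold (C1 R) X)
  (g := fun q : prod_manifold (C1 R) X => l i (Psi i q))); last exact: lPsi_hol.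
apply: hol_at_pair; first exact: hol_at_id.
exact: (@hol_at_cst R (C1 R) X).
Qed.

(** The coordinate in l i of the image of the vector 1 by the differential of
    Psi i at the zero section, that is, of a frame of the normal bundle of the
    zero section, which is L. *)
Let frame i (y : X) : C := 'D_1 (lPsi i ^~ y) (sigma i y).

(** The derivatives of the transition automorphisms at the zero section. *)
Let lambda i j (y : X) : C := 'D_1 (fun w : C => Phi i (Psi j (w : C1 R, y)) : C) (sigma j y).

Let is_derive_frame i y : B i y -> is_derive (sigma i y) (1 : C) (lPsi i ^~ y) (frame i y).
Proof.
move=> iy; apply: differentiable_is_derive; apply: lPsi_fiber => //.
by case: iy => iy _; exact: sigma_lt1.
Qed.

Let is_derive_lambda i j y : V i y -> V j y -> is_derive (sigma j y) (1 : C)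
  (fun w : C => Phi i (Psi j (w : C1 R, y)) : C) (lambda i j y).
Proof.
by move=> iy jy; apply: differentiable_is_derive; apply: trans_fiber => //; exact: sigma_lt1.
Qed.

Lemma lambda_locally_constant i j y : V i y -> V j y ->
  \forall y' \near y, lambda i j y' = lambda i j y.
Proof.
move=> iy jy.
have nij : nbhs y (V i `&` V j) by apply: open_nbhs_nbhs; split=> //; exact: openI.
apply: filterS (filterI nij (filterI (section_locally_constant jy)
  (trans_locally_constant jy iy))) => y' [[iy' jy'] [sy Ty]].
have d1 := is_derive_lambda iy' jy'; rewrite sy in d1.
apply: (is_derive_uniq (near_eq_is_derive _ d1) (is_derive_lambda iy jy)).
by apply: filterS (near_disc (sigma_lt1 jy)) => w w1; exact: Ty.
Qed.

Let l_linear i j y v : W i y -> W j y -> p v = y ->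
  l i v = (l j v : C) * (l i (eta j (y, (1 : C) : C1 R)) : C) :> C.
Proof.
move=> iy jy pv; have [_ pe le] := etaP 1 jy.
have Wje : W j (p (eta j (y, (1 : C) : C1 R))) by rewrite pe.
have Wie : W i (p (eta j (y, (1 : C) : C1 R))) by rewrite pe.
have {1}-> : v = fib_scale L (l j v : C) (eta j (y, (1 : C) : C1 R)).
  apply: (@l_inj j); [by rewrite proj_scale pe|by rewrite pv|].
  by have [_ _ ->] := lP Wje; rewrite le mulr1.
by have [_ _ ->] := lP Wie.
Qed.

(** Both sides are the derivative of l i (Psi j (w, y)): through the chart l j,
    and through the trivialisation Psi i. *)
Let frame_transition i j y : B i y -> B j y ->
  frame j y * (l i (eta j (y, (1 : C) : C1 R)) : C) = frame i y * lambda i j y.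
Proof.
move=> iy jy; have [Viy Wiy] := iy; have [Vjy Wjy] := jy.
set m : C := l i _.
have d1 : is_derive (sigma j y) (1 : C) (fun w : C => lPsi j w y * m) (frame j y * m).
  have d := is_derive_frame jy; apply: is_derive_eq.
  by rewrite scaler0 add0r -[_ *: _]/(_ * _) mulrC.
have d2 := is_derive_lambda Viy Vjy.
have d3 : is_derive (Phi i (Psi j (sigma j y : C1 R, y)) : C) (1 : C) (lPsi i ^~ y) (frame i y).
  by rewrite (Psi_sigma Vjy); exact: is_derive_frame.
have d4 := is_derive_chain d2 d3.
apply: (is_derive_uniq d1); apply: near_eq_is_derive d4.
apply: filterS (near_disc (sigma_lt1 Vjy)) => w w1.
have [_ Uw pw _] := PsiP w1 Vjy.
rewrite /= /lPsi -(l_linear Wiy Wjy pw).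
have Viw : V i (p (Psi j (w : C1 R, y))) by rewrite pw.
by have [_ _] := PhiP Uw Viw; rewrite pw => ->.
Qed.

(** Phi i is a left inverse of Psi i, and is holomorphic along the fibre. *)
Let frame_neq0 i y : B i y -> frame i y != 0.
Proof.
move=> iy; have [Viy Wiy] := iy.
have s1 := sigma_lt1 Viy.
have c0 : lPsi i (sigma i y) y = 0 by rewrite /lPsi Psi_sigma// l_o.
have dk : differentiable (fun c : C => Phi i (eta i (y, c : C1 R)) : C) 0.
  apply/(hol_at_C1 (fun c : C1 R => Phi i (eta i (y, c)))).
  apply: (hol_at_comp (f := fun c : C1 R => eta i (y, c)) (g := Phi i)).
    apply: (hol_at_comp (f := fun c : C1 R => (y, c) : prod_manifold X (C1 R))).
      apply: hol_at_pair; last exact: hol_at_id.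
      exact: (@hol_at_cst R (C1 R) X).
    by have [] := etaP 0 Wiy.
  rewrite (o_eta Wiy); rewrite -(o_proj y) in Viy.
  by have [] := PhiP (o_U y) Viy.
have d1 := differentiable_is_derive dk; rewrite -c0 in d1.
have d2 := is_derive_chain (is_derive_frame iy) d1.
have di : is_derive (sigma i y) (1 : C) (@id C) 1 by exact: is_derive_id.
have inverse : \forall w \near sigma i y,
    ((fun c : C => Phi i (eta i (y, c : C1 R)) : C) \o (lPsi i ^~ y)) w = id w.
  apply: filterS (near_disc s1) => w w1; have [_ Uw pw Pw] := PsiP w1 Viy.
  rewrite /= /lPsi.
  have Ww : W i (p (Psi i (w : C1 R, y))) by rewrite pw.
  by have [_] := lP Ww; rewrite pw => -> _.
have := is_derive_uniq (near_eq_is_derive inverse d2) di.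
move=> E1; apply/eqP => f0; move: E1; rewrite f0 mulr0 => /eqP.
by rewrite eq_sym oner_eq0.
Qed.

Let lambda_neq0 i j y : B i y -> B j y -> lambda i j y != 0.
Proof.
move=> iy jy; have [_ Wjy] := jy; have [_ Wiy] := iy.
have cancel0 (a b c d : C) : a * b = c * d -> a != 0 -> d = 0 -> b = 0.
  by move=> abcd a0 d0; apply: (mulfI a0); rewrite abcd d0 !mulr0.
apply/eqP => /(cancel0 _ _ _ _ (frame_transition iy jy) (frame_neq0 jy)) m0.
have [_ pe le] := etaP 1 Wiy.
have := l_linear Wiy Wjy pe; rewrite m0 mulr0 le => /eqP.
by rewrite oner_eq0.
Qed.

Let frame_section i (y : X) : tot L := eta i (y, frame i y : C1 R).

Let frame_section_proj i y : B i y -> p (frame_section i y) = y.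
Proof. by move=> [_ Wiy]; have [_ H _] := etaP (frame i y) Wiy. Qed.

Let frame_section_l i y : B i y -> l i (frame_section i y) = frame i y :> C.
Proof. by move=> [_ Wiy]; have [_ _ H] := etaP (frame i y) Wiy. Qed.

Let frame_section_transition i j y : B i y -> B j y ->
  frame_section j y = fib_scale L (lambda i j y) (frame_section i y).
Proof.
move=> iy jy; have [Viy Wiy] := iy; have [Vjy Wjy] := jy.
have pj := frame_section_proj jy; have pi_ := frame_section_proj iy.
have Wi' : W i (p (frame_section i y)) by rewrite pi_.
have Wj' : W i (p (frame_section j y)) by rewrite pj.
have pZ := proj_scale (lambda i j y) (frame_section i y).
apply: (@l_inj i); [by apply: etrans pj _; apply: esym; apply: etrans pZ pi_|exact: Wj'|].
apply: etrans (l_linear Wiy Wjy pj) _; rewrite (frame_section_l jy).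
apply: etrans (frame_transition iy jy) _; apply: esym.
have [_ _ Z] := lP Wi'; apply: etrans (Z (lambda i j y)) _.
rewrite (frame_section_l iy).
by generalize (lambda i j y) (frame i y) => a b; exact: mulrC.
Qed.

(** In a chart of X the frame is the fibre derivative, at the locally constant
    point sigma i, of a bounded holomorphic function. *)
Let frame_hol i y : B i y -> hol_at (frame i : X -> C1 R) y.
Proof.
move=> iy; have [Viy Wiy] := iy; have s1 := sigma_lt1 Viy.
set w0 := sigma i y in s1 *.
have chart_diff (c : chart R X (mdim X)) : matlas c -> chart_dom c y ->
    differentiable (frame i \o chart_inv c) (chart_map c y).
  move=> ac cy; have [im inv] := chart_mapP cy.
  set x0 := chart_map c y in im inv *.
  have cinv : {for x0, continuous (chart_inv c)} by exact: chart_inv_cts.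
  have near_x0 (A : set X) : nbhs y A -> nbhs x0 (chart_inv c @^-1` A).
    by move=> nA; apply: cinv; rewrite inv.
  have := hol_at_cts (lPsi_hol iy s1).
  move=> /(_ _ (near_nrm (lPsi i w0 y) ltr01)) [[/= N1 N2] [/= n1 n2] N12].
  have [r1 r10 rN] := (nbhs_nrmP w0 N1).1 n1.
  have [r2 r20 rD] := (nbhs_nrmP w0 _).1 (near_disc s1).
  have nB : nbhs y (B i) by apply: open_nbhs_nbhs.
  have nimg : nbhs x0 (chart_img c).
    by apply: open_nbhs_nbhs; split=> //; exact: chart_img_open.
  have [rho rho0 rhoP] := (nbhs_vnrmP x0 _).1
    (filterI (near_x0 _ n2) (filterI (near_x0 _ nB) nimg)).
  pose F (u : 'rV[C]_(mdim X)) (w : C) : C := lPsi i w (chart_inv c u).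
  have dF : differentiable (fun u => 'D_1 (F u) w0) x0.
    apply: (@fiber_derivative_differentiable R _ F x0 w0 (nrm (lPsi i w0 y) + 1)
      (Num.min r1 r2) rho) => //; first by rewrite lt_min r10.
    move=> u w /rhoP[/= N2u [Bu uim]]; rewrite lt_min => /andP[/rN N1w /rD w1].
    split.
    - exact: lPsi_fiber.
    - have hw : hol_at (fun y : X => l i (Psi i (w : C1 R, y))) (chart_inv c u).
        apply: (hol_at_comp (f := fun y : X => (w : C1 R, y) : prod_manifold (C1 R) X)
          (g := fun q : prod_manifold (C1 R) X => l i (Psi i q))); last exact: lPsi_hol.
        apply: hol_at_pair; last exact: hol_at_id.
        exact: (@hol_at_cst R X (C1 R)).
      have [du ue] := chart_invP uim.
      have [_ /(_ c ac du)] := (hol_at_to_C1 _ _).1 hw.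
      by rewrite ue.
    - have := N12 (w : C1 R, chart_inv c u) (conj N1w N2u) => /= /ltW H.
      rewrite -(subrK (lPsi i w0 y) (F u w)) (le_trans (nrmD _ _))// addrC lerD2l.
      exact: H.
  apply: near_eq_differentiable dF.
  apply: filterS (near_x0 _ (section_locally_constant Viy)) => u /= su.
  by rewrite /frame su.
apply/hol_at_to_C1; split; last exact: chart_diff.
have [c ac cy] := matlas_cover y.
have cc : {for y, continuous (fun y' => (frame i \o chart_inv c) (chart_map c y'))}.
  apply: continuous_comp; first exact: chart_map_cts.
  exact: differentiable_continuous (chart_diff c ac cy).
move=> A; have [_ inv] := chart_mapP cy.
have nd : nbhs y (chart_dom c) by apply: open_nbhs_nbhs; split=> //; exact: chart_dom_open.
move=> nA; have := cc A; rewrite /= inv => /(_ nA) nA'.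
apply: filterS (filterI nd nA') => y' [dy'] /=.
by have [_ ->] := chart_mapP dy'.
Qed.

Let frame_section_hol i y : B i y -> hol_at (frame_section i) y.
Proof.
move=> iy; have [_ Wiy] := iy.
apply: (hol_at_comp (f := fun y : X => (y, frame i y : C1 R) : prod_manifold X (C1 R))).
  by apply: hol_at_pair; [exact: hol_at_id|exact: frame_hol].
by have [] := etaP (frame i y) Wiy.
Qed.

Let lambda_cocycle i j k y : B i y -> B j y -> B k y ->
  lambda j k y * lambda i j y = lambda i k y.
Proof.
move=> iy jy ky; have [_ Wiy] := iy.
have Wi : W i (p (frame_section i y)) by rewrite (frame_section_proj iy).
have Wj : W i (p (frame_section j y)) by rewrite (frame_section_proj jy).
have [_ _ Zi] := lP Wi; have [_ _ Zj] := lP Wj.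
have e1 : l i (frame_section k y) = lambda j k y * (l i (frame_section j y) : C) :> C.
  by rewrite (frame_section_transition jy ky); exact: Zj.
have e2 : l i (frame_section j y) = lambda i j y * frame i y :> C.
  rewrite (frame_section_transition iy jy).
  exact: etrans (Zi _) (congr1 (fun c => lambda i j y * c) (frame_section_l iy)).
have e3 : l i (frame_section k y) = lambda i k y * frame i y :> C.
  rewrite (frame_section_transition iy ky).
  exact: etrans (Zi _) (congr1 (fun c => lambda i k y * c) (frame_section_l iy)).
have compose (a b c f u v : C) : u = a * v -> v = b * f -> u = c * f -> f != 0 -> a * b = c.
  by move=> -> -> abc f0; apply: (mulIf f0); rewrite -mulrA.
exact: compose e1 e2 e3 (frame_neq0 iy).
Qed.

(** The transition functions of the frames are locally constant, hence so are
    their logarithms f; the cocycle of c_1 is then the coboundary of Re f. *)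
Theorem flat_chern_class_eq0 : ~ real_chern_class_neq0 L.
Proof.
have /choice[lg lgP] : forall a : C, exists f : C, a != 0 ->
    complex_exp ((2 * pi)*i%C * f) = a.
  move=> a; have [a0|a0] := pselect (a != 0); last by exists 0.
  by have [f fE] := complex_log a0; exists f.
pose f i j y : C := lg (lambda i j y).
have fE i j y : B i y -> B j y -> complex_exp ((2 * pi)*i%C * f i j y) = lambda i j y.
  by move=> iy jy; exact: lgP (lambda_neq0 iy jy).
have f_cst i j y : B i y -> B j y -> \forall y' \near y, f i j y' = f i j y.
  move=> [Viy _] [Vjy _].
  by apply: filterS (lambda_locally_constant Viy Vjy) => y' /(congr1 lg).
have /choice[c cP] : forall q : X * X * X * X, exists k : int,
    B q.1.1.1 q.2 -> B q.1.1.2 q.2 -> B q.1.2 q.2 ->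
    (k%:~R : C) = cech_d1 (f : X -> X -> X -> C) q.1.1.1 q.1.1.2 q.1.2 q.2.
  move=> [[[i j] k] y] /=.
  have [[iy jy ky]|nB] := pselect [/\ B i y, B j y & B k y]; last first.
    by exists 0 => iy jy ky; case: nB.
  have [z zE] : exists z : int, cech_d1 (f : X -> X -> X -> C) i j k y = z%:~R.
    apply: complex_exp_eq1; rewrite /cech_d1 mulrDr mulrBr !complex_expD.
    have eN (a : C) : complex_exp (- a) = (complex_exp a)^-1.
      apply: (mulfI (complex_exp_neq0 a)).
      by rewrite -complex_expD subrr complex_exp0 divff ?complex_exp_neq0.
    have quotient1 (u v w a b d : C) : u = a -> v = d -> w = b -> a * b = d -> d != 0 ->
        u / v * w = 1.
      by move=> -> -> -> abd d0; rewrite mulrAC abd divff.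
    rewrite eN; exact: quotient1 (fE _ _ _ jy ky) (fE _ _ _ iy ky) (fE _ _ _ iy jy)
      (lambda_cocycle iy jy ky) (lambda_neq0 iy ky).
  by exists z => *; rewrite zE.
have cover_B : open_cover B.
  split; first exact: B_open.
  by apply/seteqP; split=> // y _; exists y.
move=> hL; apply: (hL X B (fun i j k y => c (i, j, k, y))).
  split=> //; exists frame_section, (f : X -> X -> X -> C1 R); split.
  - by move=> i; apply/hol_on_open => // y iy; exact: frame_section_hol.
  - move=> i y iy; split; first exact: frame_section_proj.
    move=> [v _ vE]; have := frame_section_l iy.
    have Wv : W i (p v).
      by have := frame_section_proj iy; rewrite -vE proj_scale => ->; case: iy.
    have [_ _ Z] := lP Wv; rewrite -vE => lv.
    have zero_of (a b d : C) : a = 0 * b -> a = d -> d = 0 by move=> -> <-; rewrite mul0r.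
    have f0 : frame i y = 0 := zero_of _ _ _ (Z 0) lv.
    exact: (negP (frame_neq0 iy) (introT eqP f0)).
  - move=> i j; apply/hol_on_open; first exact: openI.
    move=> y [iy jy]; apply: (@near_eq_hol_at _ _ _ (cst (f i j y : C1 R))).
      by apply: filterS (f_cst _ _ _ iy jy) => y'; exact: esym.
    exact: (@hol_at_cst R X (C1 R)).
  - move=> i j y [iy jy]; rewrite (fE _ _ _ iy jy).
    exact: frame_section_transition.
  - by move=> i j k y [[iy jy] ky]; exact: cP (i, j, k, y) iy jy ky.
exists X, B, id, (fun i j y => complex.Re (f i j y)); split; [exact: cover_B|by move=> i y| |].
  move=> i j y [iy jy]; apply: filterS (f_cst _ _ _ iy jy) => y' fy' _.
  exact: congr1 fy'.
move=> i j k y [[iy jy] ky]; have := congr1 (@complex.Re R) (cP (i, j, k, y) iy jy ky).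
by rewrite /cech_d1 raddfD raddfB /= -(rmorph_int (real_complex R)).
Qed.

End FlatLineBundle.

Theorem proposition2p5 (R : realType) (X : complex_manifold R)
  (hX : (exists (n : nat) (e : 'I_(2 * n) -> 'rV[Cplx R]_n) (he : real_free e),
           biholomorphic [set: X] [set: complex_torus he]) \/
        (exists2 m : nat, (2 <= m)%N & biholomorphic [set: X] (Cstar R m)))
  (L : line_bundle X) (hL : real_chern_class_neq0 L)
  (U : set (tot L)) (hU : open U) (hU0 : zero_section L `<=` U)
  (hUD : forall x : X, biholomorphic (fiber L x `&` U) (unit_disc R)) :
  ~ hol_locally_trivial U (bundle_proj L).
Proof.
move=> triv.
have [n [pr prP]] : exists n (pr : Cn R n -> X), open_holomorphic_surjection pr setT.
  case: hX => [[n [e [he XT]]]|[m _ XC]].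
    have [pr prP] := covering_transfer (torus_covering he) openT XT.
    by exists n, pr.
  have [pr prP] := covering_transfer (exp_covering R m) (@Cstar_open R m) XC.
  by exists m, pr.
have [_ _ prS _] := prP.
have cp : continuous (bundle_proj L).
  by move=> v; exact: hol_at_cts (hol_on_setT (@proj_hol R X L) v).
have hUD' x : biholomorphic (U `&` bundle_proj L @^-1` [set x]) (unit_disc R).
  by rewrite setIC; exact: hUD.
pose data x (D : (set X * (tot L -> C1 R)) * (prod_manifold (C1 R) X -> tot L)) :=
  D.1.1 x /\ disc_chart (bundle_proj L) U D.1.1 D.1.2 D.2.
have /choice[D DP] : forall x, exists D, data x D.
  move=> x; have [V [Phi [Psi [Vx VP]]]] := disc_chart_exists hU cp triv (hUD' x) x.
  by exists (V, Phi, Psi).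
pose ldata x (D : (set X * (tot L -> C1 R)) * (prod_manifold X (C1 R) -> tot L)) :=
  D.1.1 x /\ line_chart D.1.1 D.1.2 D.2.
have /choice[E EP] : forall x, exists D, ldata x D.
  move=> x; have [W [l [eta [Wx WP]]]] := line_chart_exists L x.
  by exists (W, l, eta).
exact: (flat_chern_class_eq0 prP hU0 (fun x => (DP x).2) (fun x => (EP x).2)
  (fun x => (DP x).1) (fun x => (EP x).1)).
Qed.
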